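(* Consider the kinetically constrained model (KCM) on $\mathbb{Z}^d$ with i.i.d. random thresholds $\omega\sim\nu$, where the probability that a threshold equals $1$ is nonzero and the probability that a threshold is more than $d$ is zero. Then $\nu$-almost surely there exist $\underline{\alpha}$ and $\overline{\alpha}$ (real numbers not depending on $q$, which may depend on $\omega$) such that $$\mathbb{P}_{\mu}\left[\tau_{0}\ge q^{-\overline{\alpha}}\right]\xrightarrow{q\rightarrow0}0,\qquad \mathbb{P}_{\mu}\left[\tau_{0}\le q^{-\underline{\alpha}}\right]\xrightarrow{q\rightarrow0}0.$$
   Context: Environment: the thresholds $\omega=(\omega_x)_{x\in\mathbb{Z}^d}$ are i.i.d. random variables with values in $\{1,2,\dots\}$; $\nu$ denotes their law. The environment is fixed (quenched). Configurations: $\Omega=\{0,1\}^{\mathbb{Z}^d}$; a site $x$ is empty if $\eta_x=0$ and occupied if $\eta_x=1$. The constraint is $c_x(\eta)=1$ if $\sum_{y\sim x}(1-\eta_y)\ge\omega_x$ (sum over the nearest neighbors $y$ of $x$ in $\mathbb{Z}^d$), and $c_x(\eta)=0$ otherwise. For $q\in(0,1)$, $\mu=\bigotimes_{x\in\mathbb{Z}^d}\mu_x$ with each $\mu_x$ Bernoulli of parameter $1-q$ (each site is empty with probability $q$). The KCM is the continuous time Markov process on $\Omega$, reversible with respect to $\mu$, with generator $\mathcal{L}f=\sum_x c_x(\mu_x f-f)$ for local functions $f$, where $\mu_x f$ denotes the average of $f$ over $\eta_x\sim\mu_x$ with the other coordinates fixed. $\mathbb{P}_\mu$ denotes probability for the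 process started from the equilibrium measure $\mu$ (the environment $\omega$ being fixed). $\tau_0=\inf\{t:\eta_0(t)=0\}$ is the first time at which the origin is empty. *)

(* Defs.v *)
From HB Require Import structures.
From mathcomp Require Import all_boot all_order all_algebra finmap.
From mathcomp Require Import all_classical all_reals all_analysis.

Set Implicit Arguments.
Unset Strict Implicit.
Unset Printing Implicit Defensive.

Import Order.TTheory GRing.Theory Num.Theory.
Import numFieldNormedType.Exports.

Local Open Scope classical_set_scope.
Local Open Scope ring_scope.

(* Independence is not in the library: it is stated as the product rule over
   all finite subfamilies. *)
Definition iid_family (R : realType) (dT : measure_display)
    (T : measurableType dT) (P : probability T R) (dE : measure_display)
    (E : measurableType dE) (nu : probability E R) (I : choiceType)
    (X : I -> T -> E) : Prop :=
  (forall i, measurable_fun [set: T] (X i)) /\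
  (forall (A : {fset I}) (B : I -> set E), (forall i, measurable (B i)) ->
     P (\bigcap_(i in [set` A]) (X i @^-1` B i)) =
     (\prod_(i <- A) nu (B i))%E).

Definition site (d : nat) : Type := 'rV[int]_d.
HB.instance Definition _ d := GRing.Zmodule.on (site d).

(* [true] means occupied, [false] means empty. *)
Definition config (d : nat) : Type := site d -> bool.

Definition coordinate_events (d : nat) : set (set (config d)) :=
  [set A | exists x b, A = [set eta | eta x = b]].

HB.instance Definition _ d :=
  Topological.copy (config d) (prod_topology (fun _ : site d => bool)).
HB.instance Definition _ d :=
  Pointed.copy (config d) (prod_topology (fun _ : site d => bool)).
HB.instance Definition _ d :=
  Measurable.copy (config d) (g_sigma_algebraType (@coordinate_events d)).

Section Dynamics.
Context {R : realType} {d : nat}.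
Implicit Types (omega : site d -> nat) (eta : config d) (f g : config d -> R).

Definition unit_vector (i : 'I_d) : site d := delta_mx ord0 i.

(* The nearest neighbours of [x] are the [2 d] sites [x + e_i] and [x - e_i]. *)
Definition empty_neighbors (x : site d) eta : nat :=
  (\sum_(i < d) (~~ eta (x + unit_vector i)%R + ~~ eta (x - unit_vector i)%R))%N.

Definition constraint omega (x : site d) eta : bool :=
  (omega x <= empty_neighbors x eta)%N.

Definition update eta (x : site d) (b : bool) : config d :=
  fun y => if y == x then b else eta y.

Definition site_average (q : R) (x : site d) f eta : R :=
  q * f (update eta x false) + (1 - q) * f (update eta x true).

Definition local_function f : Prop :=
  exists A : {fset site d}, forall eta xi : config d,
    (forall x, x \in A -> eta x = xi x) -> f eta = f xi.

(* For a local [f] only finitely many terms are nonzero; the sum over a set is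
   [0] by convention when its support is infinite, so this is meaningful on
   local functions only. *)
Definition generator omega (q : R) f eta : R :=
  \sum_(x \in [set: site d])
    (constraint omega x eta)%:R * (site_average q x f eta - f eta).

Definition equilibrium (q : R) (mu : probability (config d) R) : Prop :=
  iid_family mu (bernoulli_prob (1 - q)) (fun x eta => eta x).

(* Markov semigroups on the continuous functions of the compact space of
   configurations; values of [S t f] for [t < 0] or [f] discontinuous are
   irrelevant. *)
Record markov_semigroup (S : R -> (config d -> R) -> config d -> R) : Prop := {
  semigroup_continuous : forall (t : R) f, 0 <= t -> continuous f ->
    continuous (S t f);
  semigroup_linear : forall (t a : R) f g, 0 <= t ->
    continuous f -> continuous g ->
    S t (fun eta => a * f eta + g eta) =
    (fun eta => a * S t f eta + S t g eta);
  semigroup_ge0 : forall (t : R) f, 0 <= t -> continuous f ->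
    (forall eta, 0 <= f eta) -> forall eta, 0 <= S t f eta;
  semigroup_cst1 : forall t : R, 0 <= t -> S t (fun=> 1) = (fun=> 1);
  semigroup_0 : forall f, continuous f -> S 0 f = f;
  semigroup_add : forall (s t : R) f, 0 <= s -> 0 <= t -> continuous f ->
    S (s + t) f = S s (S t f);
  semigroup_cvg0 : forall f, continuous f -> forall e : R, 0 < e ->
    \forall t \near 0^'+, forall eta, `|S t f eta - f eta| < e }.

(* The generator of [S] extends [L] on local functions. For the bounded finite
   range rates considered here, the closure of [L] is already the generator of a
   Markov semigroup (Liggett), so this determines [S]. *)
Definition has_generator (S : R -> (config d -> R) -> config d -> R)
    (L : (config d -> R) -> config d -> R) : Prop :=
  forall f, local_function f -> forall e : R, 0 < e ->
    \forall t \near 0^'+, forall eta,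
      `|(S t f eta - f eta) / t - L f eta| < e.

Definition reversible (S : R -> (config d -> R) -> config d -> R)
    (mu : probability (config d) R) : Prop :=
  forall (t : R) f g, 0 <= t -> continuous f -> continuous g ->
    \int[mu]_eta (f eta * S t g eta) = \int[mu]_eta (S t f eta * g eta).

Section Process.
Context {dT : measure_display} {T : measurableType dT} (P : probability T R).
Implicit Type X : R -> T -> config d.

Definition natural_filtration X (s : R) : set (set T) :=
  <<s \bigcup_(u in `[0, s]) preimage_set_system [set: T] (X u) measurable >>.

(* E[f(X_{s+t}) | F_s] = (S_t f)(X_s), tested against the events of F_s. *)
Definition markov_property X (S : R -> (config d -> R) -> config d -> R)
    : Prop :=
  forall (s t : R) f, 0 <= s -> 0 <= t -> continuous f ->
    forall A, natural_filtration X s A ->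
      \int[P]_(w in A) f (X (s + t) w) = \int[P]_(w in A) S t f (X s w).

Definition cadlag (x : R -> config d) : Prop :=
  (forall t : R, 0 <= t -> x u @[u --> t^'+] --> x t) /\
  (forall t : R, 0 < t -> cvg (x u @[u --> t^'-])).

(* [P] is P_mu: only times [t >= 0] of the process [X] matter. *)
Definition stationary_kcm omega (q : R) X : Prop :=
  exists (mu : probability (config d) R)
         (S : R -> (config d -> R) -> config d -> R),
    [/\ equilibrium q mu,
        [/\ markov_semigroup S, has_generator S (generator omega q) &
            reversible S mu],
        forall t : R, 0 <= t -> measurable_fun [set: T] (X t),
        (forall w, cadlag (fun t => X t w)) /\ markov_property X S &
        forall A, measurable A -> P (X 0 @^-1` A) = mu A].

(* tau_0, equal to +oo when the origin is never empty. *)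
Definition emptying_time X (w : T) : \bar R :=
  ereal_inf [set t%:E | t in [set t : R | 0 <= t /\ X t w 0%R = false]].

End Process.
End Dynamics.

(* Main.v *)
(** Lower bound: the origin is initially occupied with probability [1 - q] and is
    emptied at rate at most [q], so it is still occupied at time 1 with high
    probability.

    Upper bound: almost surely there are disjoint sets [B_0] (containing the
    origin), [B_1], ... of bounded size such that [B_i] and [B_(i+1)] can each be
    emptied by legal moves once the other one is empty. Let [delta_A] be the
    indicator that [A] is empty, divided by its probability. Emptying sites one at
    a time, [delta_(B_0) - N^-1 sum_(i <= N) delta_(B_i)] is a combination of
    polynomially many functions [1_(A empty) (eta_x - (1 - q))] in which [x] is
    unconstrained when [A] is empty. By reversibility the H^-1 norm of each of them
    is bounded, so its average over the time interval [0, t] is of order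
    [t^(-1/2)]. If the origin stays occupied then [delta_(B_0)] vanishes, whereas
    [N^-1 sum_i delta_(B_i)] is close to 1 as soon as [N] is a large power of [1/q].
    Hence [t] is at most polynomial in [1/q].

    The sets [B_i] are made of cubes of a large constant side. An empty cube empties
    an adjacent one slice by slice if every slice is filled by bootstrap percolation
    started from its sites of threshold 1; by induction on the dimension, boxes fill
    with probability superpolynomially close to 1. Such cubes being very likely, a
    contour-free path counting argument produces an infinite staircase of them from
    the origin, if the side is suitably chosen depending on the environment. *)
Require Import Defs.
From mathcomp Require Import all_boot all_order all_algebra finmap.
From mathcomp Require Import all_classical all_reals all_analysis.
From mathcomp Require Import measurable_realfun.
From mathcomp Require Import ring lra zify.

Set Implicit Arguments.
Unset Strict Implicit.
Unset Printing Implicit Defensive.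

Import Order.TTheory GRing.Theory Num.Theory.
Import numFieldNormedType.Exports.

Local Open Scope classical_set_scope.
Local Open Scope ring_scope.

(** * Bounded random variables and functions of the configuration *)

(** The environment enters only through the chain of the [B_i]: the analytic half holds for every
    [omega] that has one, however high the thresholds are elsewhere, because only functions living
    on the chain are estimated and no spectral gap is involved. The sizes of the [B_i] need a common
    bound, since it becomes the exponent: [delta_A] has second moment [q^(-|A|)], so averages along
    the chain concentrate only once [N] exceeds such a power. As [q] tends to 0 in a fixed
    environment, the chain has to be infinite. The dynamics is known only through the small time
    behaviour of the semigroup on local functions. All computations therefore live on a time grid of
    step [h]; how small [h] must be does not depend on the number of steps, so the horizon [t] can
    be fixed before [h] is chosen. For a fixed side of the cubes the staircase is only shown to
    exist with probability close to 1. Taking a sequence of sides makes failure at all of them a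
    null event, at the price of an exponent that depends on the environment. *)

Section BoundedExpectation.
Context {R : realType} {dT : measure_display} {T : measurableType dT}.
Variable P : probability T R.
Implicit Types f g : T -> R.

(** Unlike integrability, boundedness is stable under products, so the integrability conditions
    below all follow from closure rules. *)
Definition bounded_measurable f : Prop :=
  measurable_fun [set: T] f /\ exists M : R, forall w, `|f w| <= M.

Lemma bm_cst c : bounded_measurable (fun=> c).
Proof. by split; [exact: measurable_cst|exists `|c|]. Qed.

Lemma bmD f g : bounded_measurable f -> bounded_measurable g ->
  bounded_measurable (fun w => f w + g w).
Proof.
move=> [mf [M fM]] [mg [N gN]]; split; first exact: measurable_funD.
by exists (M + N) => w; rewrite (le_trans (ler_normD _ _))// lerD.
Qed.

Lemma bmM f g : bounded_measurable f -> bounded_measurable g ->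
  bounded_measurable (fun w => f w * g w).
Proof.
move=> [mf [M fM]] [mg [N gN]]; split; first exact: measurable_funM.
by exists (M * N) => w; rewrite normrM ler_pM.
Qed.

Lemma bm_sum (I : Type) (r : seq I) (F : I -> T -> R) :
  (forall i, bounded_measurable (F i)) ->
  bounded_measurable (fun w => \sum_(i <- r) F i w).
Proof.
move=> bF; elim: r => [|i r ih].
  rewrite (_ : (fun _ => _) = fun=> 0); first exact: bm_cst.
  by apply/funext => w; rewrite big_nil.
rewrite (_ : (fun _ => _) = (fun w => F i w + \sum_(j <- r) F j w)).
  exact: bmD.
by apply/funext => w; rewrite big_cons.
Qed.

Lemma bm_sqr f : bounded_measurable f -> bounded_measurable (fun w => f w ^+ 2).
Proof.
move=> bf; rewrite (_ : (fun _ => _) = fun w => f w * f w); first exact: bmM.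
by apply/funext.
Qed.

Lemma bm_indic (A : set T) : measurable A -> bounded_measurable (\1_A : T -> R).
Proof.
move=> mA; split; first exact: measurable_indic.
by exists 1 => w; rewrite indicE; case: (_ \in _); rewrite ?normr1 ?normr0.
Qed.

Lemma bm_integrable f : bounded_measurable f ->
  P.-integrable [set: T] (EFin \o f).
Proof.
move=> [mf [M fM]]; apply: measurable_bounded_integrable => //.
- by rewrite (le_lt_trans (probability_le1 _ _)) ?ltry.
- exists M; split; first exact: num_real.
  by move=> x Mx w _; apply: (le_trans (fM w)); exact: ltW.
Qed.

Lemma expD f g : bounded_measurable f -> bounded_measurable g ->
  \int[P]_w (f w + g w) = \int[P]_w f w + \int[P]_w g w.
Proof. by move=> bf bg; rewrite RintegralD//; exact: bm_integrable. Qed.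

Lemma expB f g : bounded_measurable f -> bounded_measurable g ->
  \int[P]_w (f w - g w) = \int[P]_w f w - \int[P]_w g w.
Proof. by move=> bf bg; rewrite RintegralB//; exact: bm_integrable. Qed.

Lemma expZ c f : bounded_measurable f ->
  \int[P]_w (c * f w) = c * \int[P]_w f w.
Proof. by move=> bf; rewrite RintegralZl//; exact: bm_integrable. Qed.

Lemma exp_cst c : \int[P]_w c = c.
Proof.
rewrite (Rintegral_cst P (measurableT : measurable [set: T])).
by transitivity (c * fine (P [set: T])) => //; rewrite probability_setT mulr1.
Qed.

Lemma exp_le f g : bounded_measurable f -> bounded_measurable g ->
  (forall w, f w <= g w) -> \int[P]_w f w <= \int[P]_w g w.
Proof.
by move=> bf bg fg; apply: le_Rintegral => //; exact: bm_integrable.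
Qed.

Lemma exp_ge0 f : (forall w, 0 <= f w) -> 0 <= \int[P]_w f w.
Proof. by move=> f0; apply: Rintegral_ge0. Qed.

Lemma exp_sum (I : Type) (r : seq I) (F : I -> T -> R) :
  (forall i, bounded_measurable (F i)) ->
  \int[P]_w (\sum_(i <- r) F i w) = \sum_(i <- r) \int[P]_w F i w.
Proof.
move=> bF; elim: r => [|i r ih].
  rewrite big_nil -[RHS](exp_cst 0); apply: eq_Rintegral => w _.
  by rewrite big_nil.
rewrite big_cons -ih -expD//; last exact: bm_sum.
by apply: eq_Rintegral => w _; rewrite big_cons.
Qed.

Lemma exp_indic (A : set T) : measurable A -> \int[P]_w \1_A w = fine (P A).
Proof. by move=> mA; rewrite /Rintegral integral_indic// setIT. Qed.

Lemma eq_exp f g : f =1 g -> \int[P]_w f w = \int[P]_w g w.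
Proof. by move=> fg; apply: eq_Rintegral => w _; exact: fg. Qed.

Lemma exp_restrict (A : set T) f : \int[P]_(w in A) f w = \int[P]_w (\1_A w * f w).
Proof.
rewrite Rintegral_mkcond; apply: eq_exp => w.
by rewrite patchE indicE; case: ifPn => _; rewrite ?mul1r ?mul0r.
Qed.

End BoundedExpectation.

(** * Local and continuous functions on the space of configurations *)

Section Configurations.
Context {R : realType} {d : nat}.
Implicit Types (eta xi : config d) (f g : config d -> R).

Lemma config_cvg (F : set_system (config d)) eta : Filter F ->
  (forall x, F [set xi | xi x = eta x]) -> F --> eta.
Proof.
move=> FF Fx; apply/cvg_sup => x U.
have /= -> := @nbhsE (initial_topology (fun h : forall _ : site d, bool => h x)) eta.
case=> B [[C oC <-] Cx] /filterS; apply.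
by apply: filterS (Fx x) => xi /= ->.
Qed.

Lemma near_coordinate eta x : \forall xi \near eta, xi x = eta x.
Proof.
have := @proj_continuous (site d) (fun _ => bool) x eta.
by move=> /(_ [set eta x]); apply; exact: discrete_set1.
Qed.

Lemma filter_seq (I : eqType) (r : seq I) (V : Type) (F : set_system V)
    (Q : I -> V -> Prop) : Filter F ->
  (forall i, i \in r -> F (Q i)) -> F [set v | forall i, i \in r -> Q i v].
Proof.
move=> FF; elim: r => [|i r ih] Fr; first by apply: filterS filterT.
have Fi := Fr i (mem_head _ _).
have FI := ih (fun j jr => Fr j (mem_behead (s := i :: r) jr)).
apply: filterS (filterI Fi FI) => v [/= Qi Qr] j.
by rewrite in_cons => /predU1P[->//|]; exact: Qr.
Qed.

Local Instance config_nbhs_filter eta : Filter (nbhs eta).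
Proof. exact: (@filter_filter _ (nbhs (eta : prod_topology (fun _ : site d => bool)))).
    Qed.

Lemma local_continuous f : local_function f -> continuous f.
Proof.
move=> [A Af] eta U /nbhs_singleton fU.
change (nbhs eta (f @^-1` U)).
have H := @filter_seq _ A _ (nbhs (eta : config d)) (fun x (xi : config d) => xi x =
    eta x) (config_nbhs_filter eta) (fun x _ => near_coordinate eta x).
apply: (@filterS _ _ (config_nbhs_filter eta)) H => xi /= xiA.
by rewrite /preimage /= (Af xi eta).
Qed.

Definition restriction_to (A : {fset site d}) eta : config d :=
  fun x => x \in [fset y in A | eta y]%fset.

Lemma local_restriction (A : {fset site d}) f :
  (forall eta xi, (forall x, x \in A -> eta x = xi x) -> f eta = f xi) ->
  forall eta, f eta = f (restriction_to A eta).
Proof. by move=> Af eta; apply: Af => x xA; rewrite /restriction_to !inE xA. Qed.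

Lemma local_bounded f : local_function f -> exists M : R, forall eta, `|f eta| <= M.
Proof.
move=> [A Af]; exists (\sum_(B <- fpowerset A) `|f (fun x => x \in B)|) => eta.
rewrite (local_restriction Af eta).
have BA : [fset y in A | eta y]%fset \in fpowerset A.
  by rewrite fpowersetE; apply/fsubsetP => y; rewrite !inE => /andP[].
rewrite (big_fsetD1 _ BA)/= lerDl; exact: sumr_ge0.
Qed.

Lemma measurable_coordinate x b : measurable [set eta : config d | eta x = b].
Proof. by apply: sub_sigma_algebra; exists x, b. Qed.

Lemma measurable_cylinder (A : {fset site d}) (b : site d -> bool) :
  measurable [set eta : config d | forall x, x \in A -> eta x = b x].
Proof.
rewrite (_ : [set _ | _] = \bigcap_(x in [set` A]) [set eta | eta x = b x]).
  by apply: fin_bigcap_measurable => // x _; exact: measurable_coordinate.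
by apply/seteqP; split=> eta.
Qed.

Lemma local_preimage_measurable f (U : set R) : local_function f ->
  measurable (f @^-1` U).
Proof.
move=> [A Af].
pose I := [set B | B \in fpowerset A /\ U (f (fun x => x \in B))].
rewrite (_ : f @^-1` U = \bigcup_(B in I)
   [set eta : config d | forall x, x \in A -> eta x = (x \in B)]).
  apply: fin_bigcup_measurable; last by move=> B _; exact: measurable_cylinder.
  by apply: sub_finite_set (finite_fset (fpowerset A)) => B [].
apply/seteqP; split=> eta /=.
  rewrite (local_restriction Af) => fU.
  exists [fset y in A | eta y]%fset; last by move=> x xA /=; rewrite !inE xA.
  split=> //; rewrite fpowersetE; apply/fsubsetP => y.
  by rewrite !inE => /andP[].
by move=> [B [_ UB]] /= etaB; rewrite (Af _ (fun x => x \in B)).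
Qed.

Lemma local_measurable f : local_function f -> measurable_fun [set: config d] f.
Proof.
by move=> lf _ U mU; rewrite setTI; exact: local_preimage_measurable.
Qed.

(** The sigma-algebra is generated by the coordinates and not by the open sets. Emptying all sites
    but the first [n] of an enumeration turns [f] into a local function, and these converge
    pointwise to [f] by continuity. *)
Lemma continuous_measurable f : continuous f ->
  measurable_fun [set: config d] f.
Proof.
move=> cf.
pose tr (n : nat) (eta : config d) : config d :=
  fun x => eta x && (@choice.pickle 'rV[int]_d x < n)%N.
apply: (@measurable_realfun.measurable_fun_cvg _ _ _ _ (fun n => f \o tr n)).
  move=> n; apply: local_measurable.
  exists [fset x : site d in pmap (@choice.unpickle 'rV[int]_d) (iota 0 n)]%fset => eta
      xi h /=.
  congr f; apply/funext => x; rewrite /tr; case: ltnP => xn; rewrite ?andbF//.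
  rewrite !andbT; apply: h; rewrite !inE mem_pmap; apply/mapP.
  by exists (@choice.pickle 'rV[int]_d x); rewrite ?mem_iota// choice.pickleK.
move=> eta _.
have trc : (fun n => tr n eta) @ \oo --> (eta : config d).
  apply: config_cvg => x; exists (@choice.pickle 'rV[int]_d x).+1 => // n /= xn.
  by rewrite /tr xn andbT.
exact: (@cvg_comp _ _ _ (fun n => tr n eta) f \oo (nbhs eta) (nbhs (f eta)) trc (cf eta)).
Qed.

Definition bounded_continuous f : Prop :=
  continuous f /\ exists M : R, forall eta, `|f eta| <= M.

Lemma bc_local f : local_function f -> bounded_continuous f.
Proof. by move=> lf; split; [exact: local_continuous|exact: local_bounded]. Qed.

Lemma bc_bm f : bounded_continuous f -> bounded_measurable f.
Proof. by case=> cf bf; split => //; exact: continuous_measurable. Qed.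

Lemma bc_cst (c : R) : bounded_continuous (fun=> c).
Proof. by split; [move=> eta; exact: cvg_cst|exists `|c|]. Qed.

Lemma bcD f g : bounded_continuous f -> bounded_continuous g ->
  bounded_continuous (fun eta => f eta + g eta).
Proof.
move=> [cf [M fM]] [cg [N gN]]; split.
  by move=> eta; apply: cvgD; [exact: cf|exact: cg].
by exists (M + N) => w; rewrite (le_trans (ler_normD _ _))// lerD.
Qed.

Lemma bcM f g : bounded_continuous f -> bounded_continuous g ->
  bounded_continuous (fun eta => f eta * g eta).
Proof.
move=> [cf [M fM]] [cg [N gN]]; split.
  by move=> eta; apply: cvgM; [exact: cf|exact: cg].
by exists (M * N) => w; rewrite normrM ler_pM.
Qed.

Lemma bcZ c f : bounded_continuous f -> bounded_continuous (fun eta => c * f eta).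
Proof. exact: (bcM (bc_cst c)). Qed.

Lemma bcB f g : bounded_continuous f -> bounded_continuous g ->
  bounded_continuous (fun eta => f eta - g eta).
Proof.
move=> bf bg; rewrite (_ : (fun _ => _) = fun eta => f eta + (-1) * g eta).
  exact: bcD bf (bcZ _ bg).
by apply/funext => eta; rewrite mulN1r.
Qed.

Lemma bc_sum (I : Type) (r : seq I) (F : I -> config d -> R) :
  (forall i, bounded_continuous (F i)) ->
  bounded_continuous (fun w => \sum_(i <- r) F i w).
Proof.
move=> bF; elim: r => [|i r ih].
  rewrite (_ : (fun _ => _) = fun=> 0); first exact: bc_cst.
  by apply/funext => w; rewrite big_nil.
rewrite (_ : (fun _ => _) = (fun w => F i w + \sum_(j <- r) F j w)).
  exact: bcD.
by apply/funext => w; rewrite big_cons.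
Qed.

Lemma localM f g : local_function f -> local_function g ->
  local_function (fun eta => f eta * g eta).
Proof.
move=> [A Af] [B Bg]; exists (A `|` B)%fset => eta xi h.
by rewrite (Af eta xi) ?(Bg eta xi)// => x xA; apply: h; rewrite inE xA ?orbT.
Qed.

Lemma localD f g : local_function f -> local_function g ->
  local_function (fun eta => f eta + g eta).
Proof.
move=> [A Af] [B Bg]; exists (A `|` B)%fset => eta xi h.
by rewrite (Af eta xi) ?(Bg eta xi)// => x xA; apply: h; rewrite inE xA ?orbT.
Qed.

Lemma local_cst (c : R) : local_function (fun _ : config d => c).
Proof. by exists fset0. Qed.

Lemma local_sum (I : Type) (r : seq I) (F : I -> config d -> R) :
  (forall i, local_function (F i)) ->
  local_function (fun w => \sum_(i <- r) F i w).
Proof.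
move=> bF; elim: r => [|i r ih].
  rewrite (_ : (fun _ => _) = fun=> 0); first exact: local_cst.
  by apply/funext => w; rewrite big_nil.
rewrite (_ : (fun _ => _) = (fun w => F i w + \sum_(j <- r) F j w)).
  exact: localD.
by apply/funext => w; rewrite big_cons.
Qed.

End Configurations.

(** * Time averages under a reversible semigroup *)

Section Semigroup.
Context {R : realType} {d : nat}.
Variable S : R -> (config d -> R) -> config d -> R.
Hypothesis hS : markov_semigroup S.
Implicit Types (eta xi : config d) (f g : config d -> R).

Lemma semigroupZ t c f : 0 <= t -> continuous f ->
  S t (fun eta => c * f eta) = fun eta => c * S t f eta.
Proof.
move=> t0 cf; have c0 : continuous (fun _ : config d => 0 : R).
  by move=> eta; exact: cvg_cst.
have S0 : S t (fun=> 0) = fun=> 0.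
  have := semigroup_linear hS 1 t0 c0 c0.
  rewrite (_ : (fun _ => _) = fun=> 0); last by apply/funext => eta; rewrite mulr0 addr0.
  move=> h; apply/funext => eta; move/(congr1 (@^~ eta)) : h => /=; lra.
have := semigroup_linear hS c t0 cf c0.
rewrite S0 (_ : (fun _ => _) = fun eta => c * f eta); last first.
  by apply/funext => eta; rewrite addr0.
by move=> ->; apply/funext => eta; rewrite addr0.
Qed.

Lemma semigroup_sum t (I : eqType) (r : seq I) (c : I -> R)
    (G : I -> config d -> R) : 0 <= t -> (forall i, i \in r -> continuous (G i)) ->
  S t (fun xi => \sum_(i <- r) c i * G i xi) =
  fun eta => \sum_(i <- r) c i * S t (G i) eta.
Proof.
move=> t0; elim: r => [|p r ih] cr.
  rewrite (_ : (fun _ => _) = fun xi => 0 * 1); last first.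
    by apply/funext => xi; rewrite big_nil mul0r.
  rewrite semigroupZ//; last by move=> ?; exact: cvg_cst.
  by apply/funext => eta; rewrite big_nil mul0r.
rewrite (_ : (fun _ => _) = fun xi => c p * G p xi + \sum_(i <- r) c i * G i xi); last
    first.
  by apply/funext => xi; rewrite big_cons.
have cr' q : q \in r -> continuous (G q) by move=> qr; apply: cr; rewrite inE qr orbT.
rewrite (semigroup_linear hS)//.
- by rewrite ih//; apply/funext => eta; rewrite big_cons.
- by apply: cr; rewrite inE eqxx.
elim: r {ih cr} cr' => [|q r ih] cr.
  rewrite (_ : (fun _ => _) = fun xi => 0); first by move=> ?; exact: cvg_cst.
  by apply/funext => xi; rewrite big_nil.
rewrite (_ : (fun _ => _) = fun xi => c q * G q xi + \sum_(i <- r) c i * G i xi); last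
    first.
  by apply/funext => xi; rewrite big_cons.
move=> eta; apply: cvgD; last first.
  by apply: ih => q' q'r; apply: cr; rewrite inE q'r orbT.
by apply: cvgM; [exact: cvg_cst|apply: cr; rewrite inE eqxx].
Qed.

Lemma semigroup_le t f g : 0 <= t -> continuous f -> continuous g ->
  (forall eta, f eta <= g eta) -> forall eta, S t f eta <= S t g eta.
Proof.
move=> t0 cf cg fg eta.
have : 0 <= S t (fun xi => (-1) * f xi + g xi) eta.
  apply: (semigroup_ge0 hS) => //.
    by move=> xi; apply: cvgD; [apply: cvgM; [exact: cvg_cst|exact: cf]|exact: cg].
  by move=> xi; have := fg xi; lra.
rewrite (semigroup_linear hS)//; lra.
Qed.

Lemma semigroup_cst t c : 0 <= t -> S t (fun=> c) = fun=> c.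
Proof.
move=> t0.
rewrite (_ : (fun=> c) = fun _ : config d => c * 1); last by apply/funext => ?; rewrite
    mulr1.
rewrite semigroupZ//; last by move=> ?; exact: cvg_cst.
by rewrite (semigroup_cst1 hS).
Qed.

Lemma semigroup_contraction t f M : 0 <= t -> continuous f ->
  (forall eta, `|f eta| <= M) -> forall eta, `|S t f eta| <= M.
Proof.
move=> t0 cf fM eta; have cc c : continuous (fun _ : config d => c : R).
  by move=> ?; exact: cvg_cst.
have := semigroup_le t0 cf (cc M) (fun xi => ler_normlW (fM xi)) eta.
have := semigroup_le t0 (cc (- M)) cf _ eta.
rewrite !semigroup_cst// => lo up; rewrite ler_norml up andbT; apply: lo => xi.
by have := fM xi; rewrite ler_norml => /andP[].
Qed.

Lemma bcS t f : 0 <= t -> bounded_continuous f -> bounded_continuous (S t f).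
Proof.
move=> t0 [cf [M fM]]; split; first exact: (semigroup_continuous hS).
by exists M => eta; exact: semigroup_contraction.
Qed.

(** Quadratic expressions are expanded into lists of coefficients and functions, to which [S t] and
    the expectation apply term by term. A recursive conjunction can be split mechanically on an
    explicit list. *)
Fixpoint all_bc (r : seq (R * (config d -> R))) : Prop :=
  if r is p :: r' then bounded_continuous p.2 /\ all_bc r' else True.

Lemma all_bcP r p : all_bc r -> p \in r -> bounded_continuous p.2.
Proof.
elim: r => [//|q r ih] [bq br]; rewrite inE => /predU1P[->//|]; exact: ih.
Qed.

Lemma all_bc_sum r : all_bc r ->
  bounded_continuous (fun xi => \sum_(p <- r) p.1 * p.2 xi).
Proof.
elim: r => [_|p r ih [bp br]].
  rewrite (_ : (fun _ => _) = fun=> 0); first exact: bc_cst.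
  by apply/funext => xi; rewrite big_nil.
rewrite (_ : (fun _ => _) = fun xi => p.1 * p.2 xi + \sum_(p <- r) p.1 * p.2 xi); last
    first.
  by apply/funext => xi; rewrite big_cons.
by apply: bcD (ih br); exact: bcZ.
Qed.

Variable mu : probability (config d) R.
Hypothesis hrev : reversible S mu.

Local Notation E f := (\int[mu]_eta f eta).

Lemma exp_semigroup t f : 0 <= t -> bounded_continuous f ->
  E (fun eta => S t f eta) = E f.
Proof.
move=> t0 [cf bf].
have c1 : continuous (fun _ : config d => 1 : R) by move=> ?; exact: cvg_cst.
have := hrev t0 c1 cf; rewrite (semigroup_cst1 hS)// => h.
transitivity (E (fun eta => 1 * S t f eta)); first by apply: eq_exp => eta; rewrite mul1r.
by rewrite [LHS]h; apply: eq_exp => eta; rewrite mul1r.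
Qed.

(** [S t] is the square of the self-adjoint [S (t / 2)], so the integral is that of
    [(S (t / 2) f) ^+ 2]. *)
Lemma exp_semigroup_sqr t f : 0 <= t -> bounded_continuous f ->
  0 <= E (fun eta => f eta * S t f eta).
Proof.
move=> t0 bf; have t20 : 0 <= t / 2 by lra.
have -> : t = t / 2 + t / 2 by lra.
rewrite (semigroup_add hS)//; last exact: bf.1.
rewrite (hrev t20 bf.1 (bcS t20 bf).1).
by apply: exp_ge0 => eta; rewrite -expr2 sqr_ge0.
Qed.

Lemma exp_comb r : all_bc r ->
  E (fun xi => \sum_(p <- r) p.1 * p.2 xi) = \sum_(p <- r) p.1 * E p.2.
Proof.
elim: r => [_|p r ih [bp br]].
  by rewrite big_nil -[RHS](exp_cst mu 0); apply: eq_exp => xi; rewrite big_nil.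
rewrite big_cons -ih// -expZ; last exact: bc_bm.
rewrite -expD.
- by apply: eq_exp => xi; rewrite big_cons.
- by apply: bc_bm; exact: bcZ.
by apply: bc_bm; exact: all_bc_sum.
Qed.

Variables (a s V : config d -> R).
Hypotheses (ba : bounded_continuous a) (bs : bounded_continuous s)
  (bV : bounded_continuous V).
Hypothesis a01 : forall eta, 0 <= a eta <= 1.
Variables (h eps : R) (n : nat) (M : R).
Hypotheses (h0 : 0 < h) (VM : forall eta, `|V eta| <= M).

Let F eta := \sum_(m < n) S (m%:R * h) V eta.

Let mh0 (m : nat) : 0 <= m%:R * h. Proof. by rewrite mulr_ge0// ltW. Qed.

Let bF : bounded_continuous F.
Proof. by apply: bc_sum => m; exact: bcS. Qed.

Let FM eta : `|F eta| <= n%:R * M.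
Proof.
rewrite (le_trans (ler_norm_sum _ _ _))//.
rewrite (le_trans (ler_sum _ (G := fun=> M) _))//.
  by move=> m _; apply: semigroup_contraction => //; exact: bV.1.
by rewrite sumr_const card_ord mulr_natl.
Qed.

Let SF eta : S h F eta = F eta - V eta + S (n%:R * h) V eta.
Proof.
have FE : F = fun eta => \sum_(m <- enum 'I_n) 1 * S ((m : nat)%:R * h) V eta.
  by apply/funext => xi; rewrite big_enum/=; apply: eq_bigr => m _; rewrite mul1r.
have -> : S h F eta = \sum_(m < n) S (m.+1%:R * h) V eta.
  rewrite FE semigroup_sum ?ltW//; last by move=> m _; exact: (bcS _ bV).1.
  rewrite !big_enum/=; apply: eq_bigr => m _.
  rewrite mul1r -(semigroup_add hS (ltW h0) (mh0 m) bV.1).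
  by rewrite -natr1 mulrDl mul1r addrC.
rewrite /F.
have := @big_ord_recr R 0 +%R n (fun m : 'I_n.+1 => S (m%:R * h) V eta).
rewrite big_ord_recl /= mul0r (semigroup_0 hS); last exact: bV.1.
under eq_bigr do rewrite /bump leq0n add1n; lra.
Qed.

Ltac bc := repeat first [exact: ba|exact: bs|exact: bV|exact: bF|exact: bc_cst
  |apply: bcM|apply: bcS => //; rewrite ?ltW//].

Let G eta := 2^-1 * (a eta * S h s eta - a eta * s eta
  + S h (fun xi => a xi * s xi) eta - s eta * S h a eta).

(* Let [psi eta xi = (a eta + a xi) / 2 * (s xi - s eta)], which is antisymmetric,
   so that [G eta = S h (psi eta) eta]; the first hypothesis says that its drift
   is nearly [- h V].  Reversibility turns the cross term in
     [0 <= \int S h (fun xi => (psi eta xi - h * (F xi - F eta)) ^+ 2) eta d mu]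
   into [\int V F] up to the error [eps], and [F - S h F] telescopes: this bounds
   the H^-1 norm of [V] without identifying the domain of the generator. *)
Lemma flow_energy :
  (forall eta, `|G eta + h * V eta| <= h * eps) ->
  E (fun eta => s eta ^+ 2) - E (fun eta => s eta * S h s eta) <= 2 * h ->
  E (fun eta => V eta * F eta) <= 2 / h + 2 * eps * n%:R * M.
Proof.
move=> Gh kh.
have h0' : 0 <= h by rewrite ltW.
pose l := - h.
have pos eta : 0 <= S h (fun xi => \sum_(p <- [::
    (1, fun xi => s xi * s xi); (-2 * s eta, s); (s eta ^+ 2, fun=> 1);
    (l * a eta, fun xi => s xi * F xi); (l, fun xi => a xi * s xi * F xi);
    (- l * a eta * s eta, F); (- l * s eta, fun xi => a xi * F xi);
    (- l * a eta * F eta, s); (- l * F eta, fun xi => a xi * s xi);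
    (l * a eta * s eta * F eta, fun=> 1); (l * s eta * F eta, a);
    (l ^+ 2, fun xi => F xi * F xi); (- 2 * l ^+ 2 * F eta, F);
    (l ^+ 2 * F eta ^+ 2, fun=> 1)]) p.1 * p.2 xi) eta.
  apply: (semigroup_ge0 hS) => //.
    apply: (proj1 (_ : bounded_continuous _)).
    by apply: all_bc_sum; rewrite /=; do ![split=> //; bc].
  move=> xi; rewrite !big_cons big_nil/=.
  set u := s xi - s eta; set v := F xi - F eta; set w := (a xi + a eta) / 2.
  rewrite [X in 0 <= X](_ : _ = u ^+ 2 + 2 * l * w * u * v + l ^+ 2 * v ^+ 2); last first.
    by rewrite /u /v /w; field.
  (* [psi ^+ 2 = w ^+ 2 * u ^+ 2] has been enlarged to [u ^+ 2], which is allowed since [w] lies in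
     [[0, 1]]. The mean of [u ^+ 2] over one time step is twice the left side of [kh]. *)
  have -> : u ^+ 2 + 2 * l * w * u * v + l ^+ 2 * v ^+ 2 =
     (w * u + l * v) ^+ 2 + (1 - w ^+ 2) * u ^+ 2 by ring.
  have /andP[p1 p2] := a01 xi; have /andP[p3 p4] := a01 eta.
  rewrite addr_ge0 ?sqr_ge0// mulr_ge0 ?sqr_ge0// subr_ge0.
  by rewrite expr_le1//; rewrite /w; lra.
have pos' eta : 0 <= \sum_(p <- [::
    (1, fun xi => S h (fun z => s z * s z) xi); (-2, fun xi => s xi * S h s xi);
    (1, fun xi => s xi * s xi);
    (l, fun xi => a xi * S h (fun z => s z * F z) xi);
    (l, fun xi => S h (fun z => a z * s z * F z) xi);
    (- l, fun xi => a xi * s xi * S h F xi);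
    (- l, fun xi => s xi * S h (fun z => a z * F z) xi);
    (- l, fun xi => a xi * F xi * S h s xi);
    (- l, fun xi => F xi * S h (fun z => a z * s z) xi);
    (l, fun xi => a xi * s xi * F xi); (l, fun xi => s xi * F xi * S h a xi);
    (l ^+ 2, fun xi => S h (fun z => F z * F z) xi);
    (- 2 * l ^+ 2, fun xi => F xi * S h F xi);
    (l ^+ 2, fun xi => F xi * F xi)]) p.1 * p.2 eta.
  have := pos eta; rewrite semigroup_sum//; last first.
    move=> p /all_bcP bp; apply: (proj1 (bp _)).
    by rewrite /=; do ![split=> //; bc].
  rewrite !big_cons !big_nil/= !semigroup_cst//; congr (0 <= _); ring.
have := exp_ge0 mu pos'.
rewrite exp_comb; last by rewrite /=; do ![split=> //; bc].
rewrite !big_cons big_nil/=.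
have comm f g : E (fun xi => f xi * g xi) = E (fun xi => g xi * f xi).
  by apply: eq_exp => xi; rewrite mulrC.
have rev f g : bounded_continuous f -> bounded_continuous g ->
    E (fun xi => f xi * S h g xi) = E (fun xi => g xi * S h f xi).
  by move=> bf bg; rewrite (hrev h0' bf.1 bg.1) comm.
rewrite !exp_semigroup//; try by bc.
rewrite (rev a (fun z => s z * F z)); try by bc.
rewrite (rev (fun z => a z * s z) F); try by bc.
rewrite (rev s (fun z => a z * F z)); try by bc.
set y := E (fun eta => V eta * F eta) in kh *.
rewrite (_ : (fun eta => s eta ^+ 2) = fun eta => s eta * s eta) in kh; last first.
  by apply/funext => eta; rewrite expr2.
set Ess := E (fun eta => s eta * s eta) in kh *.
set EsSs := E (fun eta => s eta * S h s eta) in kh *.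
set x1 := E (fun xi => s xi * F xi * S h a xi).
set x2 := E (fun xi => a xi * s xi * F xi).
set x3 := E (fun xi => F xi * S h (fun z => a z * s z) xi).
set x4 := E (fun xi => a xi * F xi * S h s xi).
set x5 := E (fun xi => F xi * F xi).
set x6 := E (fun xi => F xi * S h F xi).
move=> main.
have flow : 2^-1 * (x4 - x2 + x3 - x1) <= - h * y + h * eps * (n%:R * M).
  have -> : 2^-1 * (x4 - x2 + x3 - x1) = E (fun xi => F xi * G xi).
    transitivity (E (fun xi => \sum_(p <- [:: (2^-1, fun xi => a xi * F xi * S h s xi);
      (- 2^-1, fun xi => a xi * s xi * F xi);
      (2^-1, fun xi => F xi * S h (fun z => a z * s z) xi);
      (- 2^-1, fun xi => s xi * F xi * S h a xi)]) p.1 * p.2 xi)).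
      rewrite exp_comb; last by rewrite /=; do ![split=> //; bc].
      rewrite !big_cons big_nil/= -/x1 -/x2 -/x3 -/x4; ring.
    by apply: eq_exp => xi; rewrite !big_cons big_nil/= /G; ring.
  have -> : - h * y + h * eps * (n%:R * M) =
      E (fun xi => \sum_(p <- [:: (- h, fun xi => V xi * F xi);
        (h * eps * (n%:R * M), fun=> 1)]) p.1 * p.2 xi).
    rewrite exp_comb; last by rewrite /=; do ![split=> //; bc].
    by rewrite !big_cons big_nil/= exp_cst -/y; ring.
  apply: exp_le.
  - rewrite (_ : (fun _ => _) = fun xi => \sum_(p <- [:: (2^-1, fun xi => a xi * F xi *
      S h s xi);
      (- 2^-1, fun xi => a xi * s xi * F xi);
      (2^-1, fun xi => F xi * S h (fun z => a z * s z) xi);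
      (- 2^-1, fun xi => s xi * F xi * S h a xi)]) p.1 * p.2 xi).
      by apply: bc_bm; apply: all_bc_sum; rewrite /=; do ![split=> //; bc].
    by apply/funext => xi; rewrite !big_cons big_nil/= /G; ring.
  - by apply: bc_bm; apply: all_bc_sum; rewrite /=; do ![split=> //; bc].
  move=> xi; rewrite !big_cons big_nil/=.
  have : F xi * (G xi + h * V xi) <= n%:R * M * (h * eps).
    rewrite (le_trans (ler_norm _))// normrM ler_pM//.
  lra.
(* The boundary term left by telescoping has the favourable sign: by reversibility it is a sum of
   integrals of [V * S ((m + n) * h) V]. *)
have tail : 0 <= E (fun xi => F xi * S (n%:R * h) V xi).
  rewrite (_ : (fun xi => _) = fun xi => \sum_(m < n) S (m%:R * h) V xi * S (n%:R * h)
      V xi).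
    rewrite exp_sum; last by move=> m; apply: bc_bm; bc.
    apply: sumr_ge0 => m _; rewrite -(hrev (mh0 m) bV.1 (bcS (mh0 n) bV).1).
    rewrite -(semigroup_add hS (mh0 m) (mh0 n) bV.1).
    by apply: exp_semigroup_sqr => //; rewrite addr_ge0.
  by apply/funext => xi; rewrite /F mulr_suml.
have FSF : x5 - y <= x6.
  rewrite /x6 (_ : (fun xi => F xi * S h F xi) = fun xi => \sum_(p <- [::
     (1, fun xi => F xi * F xi); (-1, fun xi => V xi * F xi);
     (1, fun xi => F xi * S (n%:R * h) V xi)]) p.1 * p.2 xi); last first.
    by apply/funext => xi; rewrite !big_cons big_nil/= SF; ring.
  rewrite exp_comb; last by rewrite /=; do ![split=> //; bc].
  by rewrite !big_cons big_nil/= -/y -/x5; lra.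
set nM := n%:R * M in flow.
have h2y : h ^+ 2 * (x5 - x6) <= h ^+ 2 * y.
  by rewrite ler_pM2l ?exprn_gt0//; lra.
have lflow : h * (2^-1 * (x4 - x2 + x3 - x1)) <= h * (- h * y + h * eps * nM).
  by rewrite ler_pM2l.
have : h ^+ 2 * y <= h ^+ 2 * (2 / h + 2 * eps * n%:R * M).
  have -> : h ^+ 2 * (2 / h + 2 * eps * n%:R * M) = 2 * h + 2 * h ^+ 2 * eps * nM.
    by rewrite /nM; field; rewrite gt_eqF.
  move: main kh h2y lflow; rewrite /l; lra.
by rewrite ler_pM2l ?exprn_gt0.
Qed.

End Semigroup.

(** * The generator on local functions and the energy of a flow *)

Section Generator.
Context {R : realType} {d : nat}.
Variables (omega : site d -> nat) (q : R).
Implicit Types (eta xi : config d) (f g : config d -> R) (A : {fset site d}).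

Lemma generator_fset A f :
  (forall eta xi, (forall x, x \in A -> eta x = xi x) -> f eta = f xi) ->
  forall eta, generator omega q f eta =
  \sum_(x <- A) (constraint omega x eta)%:R * (site_average q x f eta - f eta).
Proof.
move=> Af eta; rewrite /generator [RHS]fsbig_seq ?fset_uniq//.
symmetry; apply: fsbig_widen => // x [_ /= /negP xA].
have fE b : f (update eta x b) = f eta.
  apply: Af => y yA; rewrite /update; case: eqP => // yx.
  by move: xA; rewrite -yx yA.
rewrite /site_average !fE; ring.
Qed.

Definition vacant A eta : bool := all (fun y => ~~ eta y) A.

Lemma vacant_local A : local_function (fun eta => (vacant A eta)%:R : R).
Proof.
by exists A => eta xi h; congr (_%:R); congr nat_of_bool; apply: eq_in_all => x xA;
    rewrite h.
Qed.

Lemma occupied_local x : local_function (fun eta : config d => (eta x)%:R : R).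
Proof. by exists [fset x]%fset => eta xi ->//; rewrite inE. Qed.

Lemma vacant_update A x b eta : x \notin A ->
  vacant A (update eta x b) = vacant A eta.
Proof.
move=> xA; apply: eq_in_all => y yA; rewrite /update; case: eqP => // yx.
by move: xA; rewrite -yx yA.
Qed.

(** Flips inside [A] change only [a], so their contributions to the last two terms cancel. The flip
    at [x] changes only [s]; it counts in the first two terms, with rate 1 wherever [a] does not
    vanish. This is twice the drift of the antisymmetric function of [flow_energy]. *)
Lemma generator_flow A x : x \notin A ->
  (forall eta, vacant A eta -> constraint omega x eta) ->
  let a := fun eta => (vacant A eta)%:R : R in
  let s := fun eta => (eta x)%:R : R in
  forall eta, a eta * generator omega q s eta
    + generator omega q (fun xi => a xi * s xi) eta
    - s eta * generator omega q a eta = - 2 * (a eta * (s eta - (1 - q))).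
Proof.
move=> xA Ac a s eta; pose A' := (x |` A)%fset.
rewrite !(@generator_fset A'); first last.
- by move=> e1 e2 h; rewrite /s h// !inE eqxx.
- move=> e1 e2 h; rewrite /s h// ?inE ?eqxx//; congr (_ * _); congr (_%:R); congr
    nat_of_bool.
  by apply: eq_in_all => y yA; rewrite h// inE yA orbT.
- move=> e1 e2 h; congr (_%:R); congr nat_of_bool.
  by apply: eq_in_all => y yA; rewrite h// inE yA orbT.
rewrite !big_fsetU1//=.
have upx b : s (update eta x b) = b%:R by rewrite /s /update eqxx.
have upa b : a (update eta x b) = a eta by rewrite /a vacant_update.
have -> : \sum_(y <- A) (constraint omega y eta)%:R * (site_average q y s eta - s eta)
    = 0.
  rewrite big_seq big1// => y yA.
  have yx : x != y by apply: contraNneq xA => ->.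
  by rewrite /site_average /s /update (negbTE yx); ring.
have -> : \sum_(y <- A) (constraint omega y eta)%:R *
    (site_average q y (fun xi => a xi * s xi) eta - a eta * s eta) =
   s eta * \sum_(y <- A) (constraint omega y eta)%:R * (site_average q y a eta - a eta).
  rewrite big_distrr/= big_seq [RHS]big_seq; apply: eq_bigr => y yA.
  have yx : x != y by apply: contraNneq xA => ->.
  by rewrite /site_average /s /update (negbTE yx); ring.
rewrite /site_average !upx !upa.
have : a eta * (constraint omega x eta)%:R = a eta.
  rewrite /a; have [/Ac ->|] := boolP (vacant A eta); by rewrite ?mulr1 ?mul0r.
set c := _%:R; set SA := \sum_(_ <- _) _; move: (a eta) (s eta) => u v uc.
transitivity (2 * (u * c) * (1 - q - v)); last by rewrite uc; ring.
rewrite (_ : false%:R = 0 :> R)// (_ : true%:R = 1 :> R)//; ring.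
Qed.

Lemma generator_occupied x eta :
  generator omega q (fun eta => (eta x)%:R) eta =
  (constraint omega x eta)%:R * ((1 - q) - (eta x)%:R).
Proof.
rewrite (@generator_fset [fset x]%fset); last by move=> e1 e2 -> //; rewrite inE.
by rewrite big_seq_fset1 /site_average /update eqxx mulr0 mulr1 add0r.
Qed.

End Generator.

Section FlowBound.
Context {R : realType} {d : nat}.
Variables (omega : site d -> nat) (q : R).
Hypothesis q01 : 0 < q < 1.
Variables (S : R -> (config d -> R) -> config d -> R)
  (mu : probability (config d) R).
Hypotheses (hS : markov_semigroup S) (hL : has_generator S (generator omega q))
  (hrev : reversible S mu).
Implicit Types (eta xi : config d) (f g : config d -> R) (A : {fset site d}).

Lemma semigroup_expansion f e : local_function f -> 0 < e ->
  \forall h \near 0^'+, forall eta,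
    `|S h f eta - f eta - h * generator omega q f eta| <= h * e.
Proof.
move=> lf e0; near=> h => eta.
have h0 : 0 < h by near: h; exact: nbhs_right_gt.
have : `|(S h f eta - f eta) / h - generator omega q f eta| < e.
  by move: eta; near: h; exact: hL.
move=> /ltW he; have -> : S h f eta - f eta - h * generator omega q f eta =
    h * ((S h f eta - f eta) / h - generator omega q f eta).
  by field; rewrite gt_eqF.
by rewrite normrM gtr0_norm// ler_pM2l.
Unshelve. all: by end_near. Qed.

(* [1 - q] is the mean of [eta x], so that [flow A x] is, up to sign, the gradient
   along the moves at [x] that are allowed by the vacancy of [A]. *)
Definition flow (A : {fset site d}) (x : site d) eta : R :=
  (vacant A eta)%:R * ((eta x)%:R - (1 - q)).

Lemma flow_local A x : local_function (flow A x).
Proof.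
apply: localM; first exact: vacant_local.
by apply: localD; [exact: occupied_local|exact: local_cst].
Qed.

Lemma flow_le1 A x eta : `|flow A x eta| <= 1.
Proof.
have /andP[q0 q1] := q01.
by rewrite /flow ler_norml; case: (vacant A eta); case: (eta x);
  rewrite /= ?mulr0n ?mulr1n; lra.
Qed.

(** The functions [a], [s] and [a * s] are local, hence have first order expansions in [h] to which
    [flow_energy] applies. The condition on [h] precedes [n], so that later [n] can grow as [h]
    decreases. *)
Lemma flow_correlations A x (e : R) : x \notin A ->
  (forall eta, vacant A eta -> constraint omega x eta) -> 0 < e -> e <= 1 ->
  \forall h \near 0^'+, forall n,
  \int[mu]_eta (flow A x eta * \sum_(m < n) S (m%:R * h) (flow A x) eta)
    <= 2 / h + 2 * e * n%:R.
Proof.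
move=> xA Ac e0 e1.
pose a := fun eta => (vacant A eta)%:R : R.
pose s := fun eta : config d => (eta x)%:R : R.
have la : local_function a := vacant_local A.
have ls : local_function s := occupied_local x.
have e2 : 0 < e / 2 by lra.
have a01 eta : 0 <= a eta <= 1 by rewrite /a; case: (vacant A eta); rewrite ?ler01
    ?lexx ?ler01.
have s01 eta : 0 <= s eta <= 1 by rewrite /s; case: (eta x); rewrite ?ler01 ?lexx ?ler01.
have Ha := semigroup_expansion la e2.
have Hs := semigroup_expansion ls e2.
have Has := semigroup_expansion (localM la ls) e2.
near=> h => n.
have h0 : 0 < h by near: h; exact: nbhs_right_gt.
have Ha' : forall eta, `|S h a eta - a eta - h * generator omega q a eta| <= h * (e / 2).
  by near: h; exact: Ha.
have Hs' : forall eta, `|S h s eta - s eta - h * generator omega q s eta| <= h * (e / 2).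
  by near: h; exact: Hs.
have Has' : forall eta, `|S h (fun xi => a xi * s xi) eta - a eta * s eta -
    h * generator omega q (fun xi => a xi * s xi) eta| <= h * (e / 2).
  by near: h; exact: Has.
have := @flow_energy _ _ S hS mu hrev a s (flow A x) (bc_local la) (bc_local ls)
  (bc_local (flow_local A x)) a01 h e n 1 h0 (flow_le1 A x).
rewrite mulr1; apply.
  move=> eta; have := generator_flow q xA Ac eta; rewrite -/a -/s => L.
  have := Ha' eta; have := Hs' eta; have := Has' eta.
  set r1 := S h (fun xi => a xi * s xi) eta - _ - _.
  set r2 := S h s eta - _ - _; set r3 := S h a eta - _ - _ => R1 R2 R3.
  have -> : 2^-1 * (a eta * S h s eta - a eta * s eta +
     S h (fun xi => a xi * s xi) eta - s eta * S h a eta) + h * flow A x eta =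
     2^-1 * (a eta * r2 + r1 - s eta * r3).
    rewrite /flow -/(a eta) -/(s eta) /r1 /r2 /r3.
    have -> : a eta * (s eta - (1 - q)) = - 2^-1 * (a eta * generator omega q s eta +
       generator omega q (fun xi => a xi * s xi) eta - s eta * generator omega q a eta).
      by rewrite L; field.
    by field.
  rewrite normrM ger0_norm ?invr_ge0//.
  have T : `|a eta * r2 + r1 - s eta * r3| <= `|a eta * r2| + `|r1| + `|s eta * r3|.
    by rewrite (le_trans (ler_normB _ _))// lerD2r ler_normD.
  have Ta : `|a eta * r2| <= h * (e / 2).
    have /andP[a0 a1] := a01 eta.
    by rewrite normrM (le_trans _ R2)// ger0_norm// ler_piMl.
  have Ts : `|s eta * r3| <= h * (e / 2).
    have /andP[a0 a1] := s01 eta.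
    by rewrite normrM (le_trans _ R3)// ger0_norm// ler_piMl.
  have he : 0 <= h * e by rewrite mulr_ge0 ?ltW.
  by lra.
(* The second hypothesis of [flow_energy], on the Dirichlet form of [s], holds pointwise: the rates
   are at most 1 and the error of the expansion is at most [h]. *)
rewrite -expB; [|apply: bc_bm|apply: bc_bm]; first last.
- by apply: bcM (bc_local ls) (bcS hS (ltW h0) (bc_local ls)).
- exact: (bc_local (localM ls ls)).
rewrite -[leRHS](exp_cst mu); apply: exp_le.
- apply: bc_bm; apply: bcB; first exact: (bc_local (localM ls ls)).
  by apply: bcM (bc_local ls) (bcS hS (ltW h0) (bc_local ls)).
- exact: bm_cst.
move=> eta; have := Hs' eta; rewrite generator_occupied -/(s eta).
have : s eta ^+ 2 = s eta by rewrite /s; case: (eta x); rewrite ?expr1n ?expr0n.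
have /andP[s0 s1] := s01 eta; move: s0 s1.
have : 0 <= ((constraint omega x eta)%:R : R) <= 1.
  by case: (constraint omega x eta); rewrite ?ler01 ?lexx ?ler01.
set c := (constraint _ _ _)%:R; set u := s eta; set Su := S h s eta => c01 u0 u1 uu.
rewrite ler_norml => /andP[lo _].
have Sl : u + h * (c * (1 - q - u)) - h * (e / 2) <= Su by lra.
have /andP[q0 q1] := q01; have /andP[c0 c1] := c01.
have cb : -1 <= c * (1 - q - u) by nra.
have hcb : h * -1 <= h * (c * (1 - q - u)) by rewrite ler_pM2l.
have he : h * (e / 2) <= h * 1 by rewrite ler_pM2l//; lra.
have uSu : u * (u - 2 * h) <= u * Su by apply: ler_wpM2l => //; lra.
have uh : u * h <= h by rewrite ler_piMl// ltW.
rewrite uu; rewrite mulrBr -expr2 uu in uSu; lra.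
Unshelve. all: by end_near. Qed.

End FlowBound.

(** * Stationarity and second moments of time averages *)

Section Stationary.
Context {R : realType} {d : nat}.
Variables (S : R -> (config d -> R) -> config d -> R)
  (mu : probability (config d) R).
Hypotheses (hS : markov_semigroup S) (hrev : reversible S mu).
Context {dT : measure_display} {T : measurableType dT}.
Variables (P : probability T R) (X : R -> T -> config d).
Hypotheses (mX : forall t : R, 0 <= t -> measurable_fun [set: T] (X t))
  (hmk : markov_property P X S)
  (X0 : forall A, measurable A -> P (X 0 @^-1` A) = mu A).
Implicit Types (eta xi : config d) (f g : config d -> R) (A : {fset site d}).

Lemma bm_comp t f : 0 <= t -> bounded_measurable f ->
  bounded_measurable (fun w => f (X t w)).
Proof.
move=> t0 [mf [M fM]]; split; last by exists M => w.
exact: (measurableT_comp mf (mX t0)).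
Qed.

Lemma exp_initial f : bounded_measurable f ->
  \int[P]_w f (X 0 w) = \int[mu]_eta f eta.
Proof.
move=> bf; have m0 := mX (lexx 0).
have mf : measurable_fun [set: config d] (EFin \o f).
  by apply/measurable_EFinP; exact: bf.1.
rewrite /Rintegral; congr fine.
rewrite -(@eq_measure_integral _ _ _ setT mu (pushforward P (X 0))); last first.
  by move=> A mA _; exact: X0.
rewrite integral_pushforward// preimage_setT.
exact: (bm_integrable P (bm_comp (lexx 0) bf)).
Qed.

Lemma exp_stationary t f : 0 <= t -> bounded_continuous f ->
  \int[P]_w f (X t w) = \int[mu]_eta f eta.
Proof.
move=> t0 bf.
have FT : natural_filtration X 0 [set: T].
  by have [h0 hD _] := smallest_sigma_algebra [set: T]
    (\bigcup_(u in `[0, 0 : R]) preimage_set_system [set: T] (X u) measurable);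
  rewrite -(setD0 [set: T]); exact: hD.
have := hmk (lexx 0) t0 bf.1 FT; rewrite add0r => ->.
by rewrite (exp_initial (bc_bm (bcS hS t0 bf))) (exp_semigroup hS hrev).
Qed.

Lemma exp_markov_indic s t f (C : set (config d)) : 0 <= s -> 0 <= t ->
  bounded_continuous f -> measurable C ->
  local_function (\1_C : config d -> R) ->
  \int[P]_w (\1_C (X s w) * f (X (s + t) w)) =
  \int[mu]_eta (\1_C eta * S t f eta).
Proof.
move=> s0 t0 bf mC lC.
have FC : natural_filtration X s (X s @^-1` C).
  apply: sub_sigma_algebra; exists s; first by rewrite /= in_itv/= s0 lexx.
  by exists C => //; rewrite setTI.
rewrite -(@exp_stationary s) //; last exact: bcM (bc_local lC) (bcS hS t0 bf).
have := hmk s0 t0 bf.1 FC; rewrite !(exp_restrict P (X s @^-1` C)) => h.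
by rewrite -[RHS]h; apply: eq_exp => w; rewrite !indicE.
Qed.

Lemma local_decomposition A f :
  (forall eta xi, (forall x, x \in A -> eta x = xi x) -> f eta = f xi) ->
  forall eta, f eta = \sum_(B <- fpowerset A) f (fun x => x \in B) *
    \1_[set eta : config d | forall x, x \in A -> eta x = (x \in B)] eta.
Proof.
move=> Af eta; pose B0 := [fset y in A | eta y]%fset.
have B0A : B0 \in fpowerset A.
  by rewrite fpowersetE; apply/fsubsetP => y; rewrite !inE => /andP[].
have B0E x : x \in A -> eta x = (x \in B0) by move=> xA; rewrite !inE xA.
rewrite (bigD1_seq B0)//=; last exact: fset_uniq.
rewrite indicE mem_set// mulr1 -(Af eta)// big_seq_cond big1 ?addr0// => B /andP[BA BB0].
rewrite indicE memNset ?mulr0// => etaB; move/eqP: BB0; apply.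
apply/fsetP => x; move: BA; rewrite fpowersetE => /fsubsetP BA.
have [xA|xA] := boolP (x \in A); first by rewrite -etaB// -B0E.
by rewrite (contraNF (BA x))// !inE (negbTE xA).
Qed.

(** A local [g] is a finite combination of indicators of cylinders, and for these the identity is
    the Markov property tested on an event of time [s]. *)
Lemma exp_markov s t f g : 0 <= s -> 0 <= t -> local_function g ->
  bounded_continuous f ->
  \int[P]_w (g (X s w) * f (X (s + t) w)) = \int[mu]_eta (g eta * S t f eta).
Proof.
move=> s0 t0 [A Ag] bf.
pose C (B : {fset site d}) := [set eta : config d | forall x, x \in A -> eta x = (x \in
    B)].
have mC B : measurable (C B) by exact: measurable_cylinder.
have lC B : local_function (\1_(C B) : config d -> R).
  exists A => eta xi h; rewrite !indicE; congr (_%:R); congr nat_of_bool.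
  apply/idP/idP; rewrite !inE /C /= => hC x xA; first by rewrite -h// hC.
  by rewrite h// hC.
rewrite (eq_exp P (g := fun w => \sum_(B <- fpowerset A) g (fun x => x \in B) *
   (\1_(C B) (X s w) * f (X (s + t) w)))); last first.
  move=> w; rewrite (local_decomposition Ag) mulr_suml.
  by apply: eq_bigr => B _; rewrite mulrA.
rewrite (eq_exp mu (g := fun eta => \sum_(B <- fpowerset A) g (fun x => x \in B) *
   (\1_(C B) eta * S t f eta))); last first.
  move=> eta; rewrite [in LHS](local_decomposition Ag) mulr_suml.
  by apply: eq_bigr => B _; rewrite mulrA.
have bP B : bounded_measurable (fun w => \1_(C B) (X s w) * f (X (s + t) w)).
  apply: bmM; first exact: (bm_comp s0 (bc_bm (bc_local (lC B)))).
  by apply: bm_comp (bc_bm bf); rewrite addr_ge0.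
have bmu B : bounded_measurable (fun eta => \1_(C B) eta * S t f eta).
  by apply: bc_bm; apply: bcM (bc_local (lC B)) (bcS hS t0 bf).
rewrite !exp_sum; first last.
- by move=> B; exact: (bmM (bm_cst _) (bP B)).
- by move=> B; exact: (bmM (bm_cst _) (bmu B)).
by apply: eq_bigr => B _; rewrite !expZ// exp_markov_indic.
Qed.

(** Expanding the square gives the correlations [phi] at lag [|j - k|]. As [phi >= 0] by
    reversibility, each half of a row, before and after the diagonal, is at most the sum of [phi]
    over all lags below [n]. *)
Lemma exp_time_average V h n : local_function V -> 0 <= h ->
  \int[P]_w (\sum_(k < n) V (X (k%:R * h) w)) ^+ 2 <=
  2 * n%:R * \int[mu]_eta (V eta * \sum_(m < n) S (m%:R * h) V eta).
Proof.
move=> lV h0; have bV := bc_local lV.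
have mh0 (m : nat) : 0 <= m%:R * h by rewrite mulr_ge0.
pose phi m := \int[mu]_eta (V eta * S (m%:R * h) V eta).
have phi0 m : 0 <= phi m by exact: (exp_semigroup_sqr hS hrev).
have bX (j k : nat) : bounded_measurable (fun w => V (X (j%:R * h) w) * V (X (k%:R * h)
    w)).
  by apply: bmM; apply: bm_comp => //; exact: bc_bm.
have phiE (j k : nat) : (j <= k)%N ->
    \int[P]_w (V (X (j%:R * h) w) * V (X (k%:R * h) w)) = phi (k - j)%N.
  move=> jk; rewrite /phi -(@exp_markov (j%:R * h))//.
  by rewrite -mulrDl -natrD subnKC.
have rowle (j : nat) : (j < n)%N ->
    \sum_(k < n) \int[P]_w (V (X (j%:R * h) w) * V (X (k%:R * h) w)) <=
    2 * \sum_(m < n) phi m.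
  move=> jn.
  rewrite (bigID (fun k : 'I_n => (j <= k)%N))/= (_ : 2 = 1 + 1 :> R)// mulrDl mul1r.
  have reindexle (Q : pred 'I_n) (u : 'I_n -> 'I_n) : {in Q &, injective u} ->
     \sum_(k < n | Q k) phi (u k) <= \sum_(m < n) phi m.
    move=> uI; rewrite -(big_imset (fun m : 'I_n => phi m))/=; last first.
      exact: uI.
    rewrite [leRHS](bigID (mem [set u k | k in Q]%SET))/= lerDl.
    by apply: sumr_ge0.
  apply: lerD.
    pose u (k : 'I_n) : 'I_n := Ordinal (leq_ltn_trans (leq_subr j k) (ltn_ord k)).
    rewrite (eq_bigr (fun k => phi (u k))); last by move=> k jk; rewrite phiE.
    apply: reindexle => x y; rewrite !unfold_in => jx jy /(congr1 val)/= xy.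
    by apply/val_inj => /=; lia.
  pose u (k : 'I_n) : 'I_n := Ordinal (leq_ltn_trans (leq_subr k j) jn).
  rewrite (eq_bigr (fun k => phi (u k))); last first.
    move=> k; rewrite -ltnNge => /ltnW kj; rewrite -(phiE _ _ kj).
    by apply: eq_exp => w; rewrite mulrC.
  apply: reindexle => x y; rewrite !unfold_in => jx jy /(congr1 val)/= xy.
  by apply/val_inj => /=; lia.
have -> : \int[mu]_eta (V eta * \sum_(m < n) S (m%:R * h) V eta) = \sum_(m < n) phi m.
  rewrite /phi -exp_sum; last first.
    by move=> m; apply: bc_bm; apply: bcM => //; exact: bcS.
  by apply: eq_exp => eta; rewrite mulr_sumr.
rewrite (eq_exp P (g := fun w => \sum_(j < n) \sum_(k < n)
    (V (X (j%:R * h) w) * V (X (k%:R * h) w)))); last first.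
  by move=> w; rewrite expr2 mulr_suml; apply: eq_bigr => j _; rewrite mulr_sumr.
rewrite exp_sum; last by move=> j; apply: bm_sum => k; exact: bX.
apply: (@le_trans _ _ (\sum_(j < n) 2 * \sum_(m < n) phi m)).
  by apply: ler_sum => j _; rewrite exp_sum//; exact: rowle.
by rewrite sumr_const card_ord -mulr_natl; lra.
Qed.

End Stationary.

(** * Droplets *)

Section Droplets.
Context {R : realType} {d : nat}.
Implicit Types (omega : site d -> nat) (A B C : {fset site d}) (xs : seq (site d)).

Fixpoint legal omega A xs : Prop :=
  if xs is x :: xs' then
    [/\ x \notin A, (omega x <= empty_neighbors x (fun y => y \notin A))%N
      & legal omega (x |` A)%fset xs']
  else True.

Definition fill omega A C : Prop :=
  exists2 xs, legal omega A xs & C = (A `|` [fset x in xs])%fset.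

(** Constraints are monotone in the set of empty sites: a move that is legal when exactly [A] is
    empty stays legal whenever [A] is. *)
Lemma vacant_constraint omega A x (eta : config d) :
  (omega x <= empty_neighbors x (fun y => y \notin A))%N ->
  vacant A eta -> constraint omega x eta.
Proof.
move=> ox /allP vA; apply: (leq_trans ox); apply: leq_sum => i _.
have le y : (~~ (y \notin A) <= ~~ eta y)%N.
  by case: (boolP (y \in A)) => // /vA ->.
by apply: leq_add; exact: le.
Qed.

Variables (omega : site d -> nat) (q : R).
Hypothesis q01 : 0 < q < 1.
Implicit Types (eta : config d) (f g : config d -> R).

Let q0 : 0 < q. Proof. by case/andP: q01. Qed.
Let q1 : q < 1. Proof. by case/andP: q01. Qed.

Definition droplet A eta : R := (vacant A eta)%:R / q ^+ #|` A|.

Lemma droplet_local A : local_function (droplet A).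
Proof.
exact: (localM (vacant_local A) (local_cst _)).
Qed.

(** This does the bookkeeping of the exponents: the number of flows and the size of their
    coefficients enter the final estimate only through [m * K]. *)
Definition flow_combination (m : nat) (K : R) f : Prop :=
  exists r : seq (R * ({fset site d} * site d)),
    [/\ (size r <= m)%N,
      forall p, p \in r -> [/\ `|p.1| <= K, p.2.2 \notin p.2.1 &
        forall eta, vacant p.2.1 eta -> constraint omega p.2.2 eta]
    & forall eta, f eta = \sum_(p <- r) p.1 * flow q p.2.1 p.2.2 eta].

Lemma flow_combination0 K : flow_combination 0 K (fun=> 0).
Proof. by exists [::]; split => // eta; rewrite big_nil. Qed.

Lemma flow_combinationD m1 m2 K f g : flow_combination m1 K f ->
  flow_combination m2 K g -> flow_combination (m1 + m2) K (fun eta => f eta + g eta).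
Proof.
move=> [r [sr Pr fr]] [r' [sr' Pr' gr]]; exists (r ++ r'); split.
- by rewrite size_cat leq_add.
- by move=> p; rewrite mem_cat => /orP[/Pr|/Pr'].
- by move=> eta; rewrite big_cat/= fr gr.
Qed.

Lemma flow_combinationZ c m K f : `|c| <= 1 -> flow_combination m K f ->
  flow_combination m K (fun eta => c * f eta).
Proof.
move=> c1 [r [sr Pr fr]]; exists [seq (c * p.1, p.2) | p <- r]; split.
- by rewrite size_map.
- move=> p /mapP[p' /Pr[p1 p2 p3] ->]; split=> //=.
  by rewrite normrM -[leRHS]mul1r ler_pM.
- by move=> eta; rewrite big_map fr mulr_sumr; apply: eq_bigr => p _; rewrite mulrA.
Qed.

Lemma flow_combination_le m m' K K' f : (m <= m')%N -> K <= K' ->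
  flow_combination m K f -> flow_combination m' K' f.
Proof.
move=> mm' KK' [r [sr Pr fr]]; exists r; split => //; first exact: leq_trans mm'.
by move=> p /Pr[p1 p2 p3]; split=> //; exact: le_trans KK'.
Qed.

Lemma flow_combination_sum (I : Type) (r : seq I) m K (f : I -> config d -> R) :
  (forall i, flow_combination m K (f i)) ->
  flow_combination (size r * m) K (fun eta => \sum_(i <- r) f i eta).
Proof.
move=> fK; elim: r => [|i r ih].
  rewrite (_ : (fun _ => _) = fun=> 0); first exact: flow_combination0.
  by apply/funext => eta; rewrite big_nil.
rewrite (_ : (fun _ => _) = fun eta => f i eta + \sum_(j <- r) f j eta).
  exact: flow_combinationD.
by apply/funext => eta; rewrite big_cons.
Qed.

Lemma inv_exp_le (m n : nat) : (m <= n)%N -> (q ^+ m)^-1 <= (q ^+ n)^-1.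
Proof.
by move=> mn; rewrite lef_pV2 ?posrE ?exprn_gt0//; apply: ler_wiXn2l => //; exact: ltW.
Qed.

(** The difference is the indicator that [A] is empty times [(1 - eta x - q) / q ^+ #|A|.+1], a
    single flow up to sign and normalisation. *)
Lemma flow_combination_step A x : x \notin A ->
  (omega x <= empty_neighbors x (fun y => y \notin A))%N ->
  flow_combination 1 (q ^+ #|` A|.+1)^-1
    (fun eta => droplet (x |` A)%fset eta - droplet A eta).
Proof.
move=> xA ox; exists [:: (- (q ^+ #|` A|.+1)^-1, (A, x))]; split=> //.
- move=> p; rewrite inE => /eqP -> /=; split=> //.
    by rewrite normrN ger0_norm// invr_ge0 exprn_ge0// ltW.
  by move=> eta; exact: vacant_constraint.
move=> eta; rewrite big_seq1/= /droplet /flow cardfsU1 xA add1n.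
have -> : vacant (x |` A)%fset eta = ~~ eta x && vacant A eta.
  apply/allP/andP => [h|[ex /allP vA] y].
    split; first by apply: h; rewrite !inE eqxx.
    by apply/allP => y yA; apply: h; rewrite inE yA orbT.
  by rewrite !inE => /predU1P[->//|/vA].
have qn : q ^+ #|` A| != 0 by rewrite expf_neq0// gt_eqF.
rewrite exprS; case: (eta x); case: (vacant A eta);
  rewrite /= ?mulr0n ?mulr1n; field; rewrite ?qn ?gt_eqF//.
Qed.

Lemma flow_combination_fill A C : fill omega A C ->
  flow_combination #|` C| (q ^+ #|` C|.+1)^-1
    (fun eta => droplet C eta - droplet A eta).
Proof.
move=> [xs lxs CE].
have cC : #|` C| = (#|` A| + size xs)%N.
  rewrite CE; elim: xs A lxs {CE C} => [|x xs ih] A /=.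
    by move=> _; rewrite addn0; congr #|` _|; apply/fsetP => y; rewrite !inE orbF.
  move=> [xA _ /ih]; rewrite cardfsU1 xA add1n addSnnS => <-.
  by congr #|` _|; apply/fsetP => y; rewrite !inE; case: (y \in A); case: (y == x).
apply: (@flow_combination_le (size xs) _ (q ^+ #|` C|.+1)^-1) => //.
  by rewrite cC leq_addl.
elim: xs A lxs CE cC => [|x xs ih] A /=.
  move=> _ CE _; rewrite (_ : (fun _ => _) = fun=> 0); first exact: flow_combination0.
  apply/funext => eta; rewrite (_ : C = A) ?subrr//.
  by rewrite CE; apply/fsetP => y; rewrite !inE orbF.
move=> [xA ox lxs] CE cC.
rewrite (_ : (fun _ => _) = fun eta => (droplet (x |` A)%fset eta - droplet A eta)
  + (droplet C eta - droplet (x |` A)%fset eta)); last by apply/funext => eta; ring.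
rewrite -add1n; apply: flow_combinationD.
  apply: flow_combination_le (flow_combination_step xA ox) => //.
  by apply: inv_exp_le; rewrite ltnS cC leq_addr.
apply: ih => //.
  by rewrite CE; apply/fsetP => y; rewrite !inE; case: (y \in A); case: (y == x).
by rewrite cardfsU1 xA cC add1n addSnnS.
Qed.

(** Both densities are compared with that of the union, which has at most [2 * M] sites and is
    reached from either side in at most [2 * M] moves. *)
Lemma flow_combination_link A B M : (#|` A| <= M)%N -> (#|` B| <= M)%N ->
  fill omega A (A `|` B)%fset -> fill omega B (A `|` B)%fset ->
  flow_combination (4 * M) (q ^+ (2 * M).+1)^-1
    (fun eta => droplet A eta - droplet B eta).
Proof.
move=> AM BM fA fB; set C := (A `|` B)%fset in fA fB.
have CM : (#|` C| <= 2 * M)%N by have := cardfsUI A B; rewrite -/C; lia.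
rewrite (_ : (fun _ => _) = fun eta => (droplet C eta - droplet B eta)
  + (-1) * (droplet C eta - droplet A eta)); last by apply/funext => eta; ring.
rewrite (_ : (4 * M = 2 * M + 2 * M)%N); last by lia.
have le X : fill omega X C -> flow_combination (2 * M) (q ^+ (2 * M).+1)^-1
    (fun eta => droplet C eta - droplet X eta).
  by move=> /flow_combination_fill; apply: flow_combination_le => //; exact: inv_exp_le.
by apply: flow_combinationD; [exact: le|apply: flow_combinationZ (le _ fA); rewrite
    normrN1].
Qed.

End Droplets.

(** * Droplet densities under the product measure *)

Section Equilibrium.
Context {R : realType} {d : nat}.
Variables (q : R) (mu : probability (config d) R).
Hypotheses (q01 : 0 < q < 1) (hmu : equilibrium q mu).
Implicit Types (A B : {fset site d}) (eta : config d).

Lemma measurable_vacant A : measurable [set eta : config d | vacant A eta].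
Proof.
rewrite (_ : [set _ | _] = [set eta : config d | forall x, x \in A -> eta x = false]).
  exact: (@measurable_cylinder _ A (fun=> false)).
apply/seteqP; split=> eta /= => [/allP vA x xA|vA].
  by apply/negbTE; exact: vA.
by apply/allP => x /vA ->.
Qed.

Lemma equilibrium_vacant A : mu [set eta | vacant A eta] = (q ^+ #|` A|)%:E.
Proof.
have [_ /(_ A (fun=> [set false]))] := hmu => h.
rewrite (_ : [set eta | vacant A eta] =
   \bigcap_(i in [set` A]) ((fun eta : config d => eta i) @^-1` [set false])).
  rewrite h//.
  have q1 : (0 <= 1 - q <= 1)%R by have /andP[? ?] := q01; apply/andP; lra.
  have nuE : bernoulli_prob (1 - q) [set false] = q%:E.
    rewrite bernoulli_probE//= !diracE.
    have -> : true \in [set false] = false by apply/negbTE; rewrite notin_setE.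
    rewrite (mem_set (erefl : [set false] false)).
    by rewrite mule0 add0e mule1; congr _%:E; exact: subKr.
  transitivity (\prod_(i <- A) q%:E)%E; first by apply: eq_bigr => i _; exact: nuE.
  by elim: (enum_fset A) => [|x r ih]; rewrite ?big_nil// big_cons ih exprS.
apply/seteqP; split=> eta /= => [/allP vA x xA|vA].
  by apply/negbTE; exact: vA.
by apply/allP => x xA; rewrite (vA x xA).
Qed.

Lemma exp_vacant A : \int[mu]_eta (vacant A eta)%:R = q ^+ #|` A|.
Proof.
rewrite -[RHS]/(fine (q ^+ #|` A|)%:E) -equilibrium_vacant.
rewrite -exp_indic; last exact: measurable_vacant.
by apply: eq_exp => eta; rewrite indicE mem_setE.
Qed.

Let qn n : q ^+ n != 0.
Proof. by have /andP[? ?] := q01; rewrite expf_neq0// gt_eqF. Qed.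

Lemma bm_vacant A : bounded_measurable (fun eta : config d => (vacant A eta)%:R : R).
Proof. exact: bc_bm (bc_local (vacant_local A)). Qed.

Lemma exp_droplet A : \int[mu]_eta droplet q A eta = 1.
Proof.
transitivity (\int[mu]_eta ((q ^+ #|` A|)^-1 * (vacant A eta)%:R)).
  by apply: eq_exp => eta; rewrite mulrC.
by rewrite expZ ?exp_vacant ?mulVf//; exact: bm_vacant.
Qed.

Lemma exp_dropletM A B : [disjoint A & B]%fset ->
  \int[mu]_eta (droplet q A eta * droplet q B eta) = 1.
Proof.
move=> AB; transitivity (\int[mu]_eta ((q ^+ #|` A `|` B|%fset)^-1 * (vacant (A `|`
    B)%fset eta)%:R)).
  apply: eq_exp => eta.
  have -> : vacant (A `|` B)%fset eta = vacant A eta && vacant B eta.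
    apply/allP/andP => [h|[/allP vA /allP vB] x].
      by split; apply/allP => x xA; apply: h; rewrite inE xA ?orbT.
    by rewrite inE => /orP[/vA|/vB].
  have -> : #|` A `|` B|%fset = (#|` A| + #|` B|)%N.
    by rewrite cardfsU (eqP AB) cardfs0 subn0.
  rewrite /droplet exprD invfM; case: (vacant A eta); case: (vacant B eta);
    rewrite /= ?mulr0n ?mulr1n; ring.
by rewrite expZ ?exp_vacant ?mulVf//; exact: bm_vacant.
Qed.

Lemma exp_droplet_sqr A :
  \int[mu]_eta (droplet q A eta * droplet q A eta) = (q ^+ #|` A|)^-1.
Proof.
transitivity (\int[mu]_eta ((q ^+ #|` A|)^-1 ^+ 2 * (vacant A eta)%:R)).
  apply: eq_exp => eta; rewrite /droplet; case: (vacant A eta);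
    rewrite /= ?mulr0n ?mulr1n; ring.
by rewrite expZ ?exp_vacant; [field; exact: qn|exact: bm_vacant].
Qed.

Lemma droplet_variance (N M : nat) (B : nat -> {fset site d}) : (0 < N)%N ->
  (forall i, #|` B i| <= M)%N ->
  (forall i j, i != j -> [disjoint B i & B j]%fset) ->
  \int[mu]_eta (N%:R^-1 * \sum_(i < N) droplet q (B i.+1) eta - 1) ^+ 2
    <= (q ^+ M)^-1 / N%:R.
Proof.
move=> N0 BM dB; have N0' : (N%:R : R) != 0 by rewrite pnatr_eq0 -lt0n.
pose D i eta := droplet q (B i) eta - 1.
have lD i : local_function (D i) by exact: localD (droplet_local _ _) (local_cst _).
have bD i : bounded_continuous (D i) := bc_local (lD i).
have bdr i : bounded_continuous (droplet q (B i)) := bc_local (droplet_local q (B i)).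
rewrite (eq_exp mu (g := fun eta => N%:R^-1 ^+ 2 * \sum_(i < N) \sum_(j < N) (D i.+1
    eta * D j.+1 eta))); last first.
  move=> eta; rewrite (_ : _ - 1 = N%:R^-1 * \sum_(i < N) D i.+1 eta); last first.
    rewrite /D big_split/= sumr_const card_ord -mulr_natl mulrDr.
    by field.
  rewrite exprMn; congr (_ * _); rewrite expr2 mulr_suml; apply: eq_bigr => i _.
  by rewrite mulr_sumr.
rewrite expZ; last first.
  by apply: bm_sum => i; apply: bm_sum => j; exact: (bc_bm (bcM (bD _) (bD _))).
rewrite exp_sum; last by move=> i; apply: bm_sum => j; exact: (bc_bm (bcM (bD _) (bD _))).
have DD i j : \int[mu]_eta (D i eta * D j eta) =
    \int[mu]_eta (droplet q (B i) eta * droplet q (B j) eta) - 1.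
  rewrite (eq_exp mu (g := fun eta => \sum_(p <- [:: (1, fun eta => droplet q (B i) eta
      * droplet q (B j) eta);
     (-1, droplet q (B i)); (-1, droplet q (B j)); (1, fun=> 1)]) p.1 * p.2 eta)); last
         first.
    by move=> eta; rewrite !big_cons big_nil/= /D; ring.
  rewrite exp_comb; last by split; [exact: (bcM (bdr _) (bdr _))|split; [exact:
      bdr|split; [exact: bdr|split; [exact: bc_cst|]]]].
  by rewrite !big_cons big_nil/= !exp_droplet exp_cst; ring.
apply: (@le_trans _ _ (N%:R^-1 ^+ 2 * \sum_(i < N) (q ^+ M)^-1)); last first.
  by rewrite sumr_const card_ord -[_ *+ N]mulr_natl le_eqVlt; apply/orP; left;
      apply/eqP; field; rewrite N0' qn.
rewrite ler_wpM2l ?sqr_ge0//; apply: ler_sum => i _.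
rewrite exp_sum; last by move=> j; exact: (bc_bm (bcM (bD _) (bD _))).
rewrite (bigD1 i)//= big1 ?addr0.
  rewrite DD exp_droplet_sqr (le_trans (y := (q ^+ #|` B i.+1|)^-1))//; first by
      rewrite gerBl.
  exact: inv_exp_le.
move=> j ji; rewrite DD exp_dropletM ?subrr//; apply: dB.
by rewrite eqSS eq_sym; apply: contraNneq ji => /val_inj ->.
Qed.

End Equilibrium.

(** Cauchy-Schwarz against the constant sequence. *)
Lemma sqr_sum_le (R : realFieldType) (I : Type) (r : seq I) (u : I -> R) :
  (\sum_(i <- r) u i) ^+ 2 <= (size r)%:R * \sum_(i <- r) u i ^+ 2.
Proof.
elim: r => [|i r ih]; first by rewrite !big_nil expr0n mulr0.
rewrite !big_cons /= -natr1.
set a := u i; set b := \sum_(_ <- _) u _ in ih *; set c := \sum_(_ <- _) _ ^+ 2 in ih *.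
set k : R := (size r)%:R in ih *.
have k0 : 0 <= k by rewrite ler0n.
have c0 : 0 <= c by apply: sumr_ge0 => j _; exact: sqr_ge0.
have [k00|] := eqVneq k 0.
  have b0 : b = 0.
    by apply/eqP; rewrite -sqrf_eq0 eq_le sqr_ge0 andbT (le_trans ih)// k00 mul0r.
  by rewrite k00 b0 addr0 add0r mul1r lerDl.
move=> kn0; have kp : 0 < k by rewrite lt_neqAle eq_sym kn0.
rewrite -(ler_pM2l kp).
have h1 : (k + 1) * b ^+ 2 <= (k + 1) * (k * c) by rewrite ler_pM2l ?addr_gt0.
have h2 : 0 <= (k * a - b) ^+ 2 by exact: sqr_ge0.
have -> : k * (a + b) ^+ 2 = k * ((k + 1) * a ^+ 2) + (k + 1) * b ^+ 2 - (k * a - b) ^+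
    2 by ring.
rewrite (_ : k * ((k + 1) * (a ^+ 2 + c)) = k * ((k + 1) * a ^+ 2) + (k + 1) * (k *
    c)); last by ring.
lra.
Qed.

(** * From flows to the survival of the occupied origin *)

Section Survival.
Context {R : realType} {d : nat}.
Variables (omega : site d -> nat) (q : R).
Hypothesis q01 : 0 < q < 1.
Variables (S : R -> (config d -> R) -> config d -> R)
  (mu : probability (config d) R).
Hypotheses (hS : markov_semigroup S) (hL : has_generator S (generator omega q))
  (hrev : reversible S mu) (hmu : equilibrium q mu).
Context {dT : measure_display} {T : measurableType dT}.
Variables (P : probability T R) (X : R -> T -> config d).
Hypotheses (mX : forall t : R, 0 <= t -> measurable_fun [set: T] (X t))
  (hmk : markov_property P X S)
  (X0 : forall A, measurable A -> P (X 0 @^-1` A) = mu A).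

(** Cauchy-Schwarz over the at most [m] flows reduces to a single flow. Being finitely many, they
    share one condition on [h]. *)
Lemma flow_combination_average (m : nat) (K e : R) f :
  flow_combination omega q m K f -> 0 < e -> e <= 1 ->
  \forall h \near 0^'+, forall n, (0 < n)%N ->
  \int[P]_w (n%:R^-1 * \sum_(k < n) f (X (k%:R * h) w)) ^+ 2 <=
  (m%:R * K) ^+ 2 * (4 / (n%:R * h) + 4 * e).
Proof.
move=> [r [rm Pr fr]] e0 e1.
have near_r : \forall h \near 0^'+, forall p, p \in r -> forall n,
  \int[mu]_eta (flow q p.2.1 p.2.2 eta *
      \sum_(k < n) S (k%:R * h) (flow q p.2.1 p.2.2) eta) <= 2 / h + 2 * e * n%:R.
  apply: filter_seq => p /Pr[_ p1 p2].
  by apply: (flow_correlations q01 hS hL hrev p1 p2 e0 e1).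
near=> h => n n0; have h0 : 0 < h by near: h; exact: nbhs_right_gt.
have corr : forall p, p \in r -> forall n,
  \int[mu]_eta (flow q p.2.1 p.2.2 eta *
      \sum_(k < n) S (k%:R * h) (flow q p.2.1 p.2.2) eta) <= 2 / h + 2 * e * n%:R.
  by near: h.
have n0' : 0 < (n%:R : R) by rewrite ltr0n.
have kh0 (k : nat) : 0 <= k%:R * h by rewrite mulr_ge0// ltW.
pose Z (p : R * ({fset site d} * site d)) w :=
  \sum_(k < n) flow q p.2.1 p.2.2 (X (k%:R * h) w).
have bZ p : bounded_measurable (Z p).
  by apply: bm_sum => k; exact: (bm_comp mX (kh0 k) (bc_bm (bc_local (flow_local _ _
      _)))).
have lf : local_function f.
  rewrite (_ : f = fun eta => \sum_(p <- r) p.1 * flow q p.2.1 p.2.2 eta).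
    by apply: local_sum => p; apply: localM (local_cst _) (flow_local _ _ _).
  by apply/funext.
apply: (@le_trans _ _ (\int[P]_w (n%:R^-1 ^+ 2 * (m%:R * K ^+ 2) * \sum_(p <- r) Z p w
    ^+ 2))).
  apply: exp_le.
  - apply: bm_sqr; apply: bmM; first exact: bm_cst.
    by apply: bm_sum => k; exact: (bm_comp mX (kh0 k) (bc_bm (bc_local lf))).
  - by apply: bmM; [exact: bm_cst|apply: bm_sum => p; exact: bm_sqr].
  move=> w; rewrite exprMn -[leRHS]mulrA ler_pM2l ?exprn_gt0 ?invr_gt0//.
  have -> : \sum_(k < n) f (X (k%:R * h) w) = \sum_(p <- r) p.1 * Z p w.
    rewrite (eq_bigr (fun k : 'I_n => \sum_(p <- r) p.1 * flow q p.2.1 p.2.2 (X (k%:R *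
        h) w))) //.
    by rewrite exchange_big/=; apply: eq_bigr => p _; rewrite mulr_sumr.
  rewrite (le_trans (sqr_sum_le _ _))// -mulrA.
  apply: ler_pM => //; first by apply: sumr_ge0 => p _; exact: sqr_ge0.
    by rewrite ler_nat.
  rewrite mulr_sumr big_seq [leRHS]big_seq; apply: ler_sum => p /Pr[pK _ _].
  rewrite exprMn ler_wpM2r ?sqr_ge0//.
  by rewrite -[leLHS]real_normK ?num_real// lerXn2r// ?nnegrE// (le_trans _ pK).
rewrite expZ; last by apply: bm_sum => p; exact: bm_sqr.
rewrite exp_sum; last by move=> p; exact: bm_sqr.
have EZ p : p \in r -> \int[P]_w Z p w ^+ 2 <= 2 * n%:R * (2 / h + 2 * e * n%:R).
  move=> pr; rewrite (le_trans (exp_time_average hS hrev mX hmk X0 n (flow_local q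
      p.2.1 p.2.2) (ltW h0)))//.
  by rewrite ler_wpM2l ?corr// mulr_ge0// ler0n.
have big : \sum_(p <- r) \int[P]_w Z p w ^+ 2 <= m%:R * (2 * n%:R * (2 / h + 2 * e *
    n%:R)).
  apply: (@le_trans _ _ (\sum_(p <- r) 2 * n%:R * (2 / h + 2 * e * n%:R))).
    by rewrite big_seq [leRHS]big_seq; apply: ler_sum => p; exact: EZ.
  rewrite big_const_seq count_predT iter_addr_0 -[leLHS]mulr_natl ler_wpM2r ?ler_nat//.
  by rewrite !mulr_ge0 ?addr_ge0 ?divr_ge0 ?mulr_ge0 ?ltW.
apply: (@le_trans _ _ (n%:R^-1 ^+ 2 * (m%:R * K ^+ 2) * (m%:R * (2 * n%:R * (2 / h + 2
    * e * n%:R))))).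
  by rewrite ler_wpM2l// mulr_ge0 ?sqr_ge0// mulr_ge0 ?sqr_ge0 ?ler0n.
rewrite le_eqVlt; apply/orP; left; apply/eqP; field.
by rewrite !gt_eqF.
Unshelve. all: by end_near. Qed.

End Survival.

Definition droplet_chain (d : nat) (omega : site d -> nat) (M : nat)
    (B : nat -> {fset site d}) : Prop :=
  [/\ 0 \in B 0%N, forall i, (#|` B i| <= M)%N,
    forall i j, i != j -> [disjoint B i & B j]%fset,
    forall i, fill omega (B i) (B i `|` B i.+1)%fset
  & forall i, fill omega (B i.+1) (B i `|` B i.+1)%fset].

(** Provides an admissible time step that divides the horizon [t] exactly. *)
Lemma near_right_ex (R : realType) (Q : R -> Prop) : (\forall h \near 0^'+, Q h) ->
  forall t : R, 0 < t -> exists2 n : nat, (0 < n)%N & Q (t / n%:R).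
Proof.
move=> [/= D D0 DQ] t t0.
have n0 : 0 < ((Num.trunc (t / D)).+1%:R : R) by rewrite ltr0n.
exists (Num.trunc (t / D)).+1 => //; apply: DQ; rewrite /ball_ /=; last exact: divr_gt0.
rewrite sub0r normrN gtr0_norm ?divr_gt0//.
by rewrite ltr_pdivrMr// mulrC -ltr_pdivrMr// truncnS_gt.
Qed.

Section SurvivalBound.
Context {R : realType} {d : nat}.
Variables (omega : site d -> nat) (q : R).
Hypothesis q01 : 0 < q < 1.
Variables (S : R -> (config d -> R) -> config d -> R)
  (mu : probability (config d) R).
Hypotheses (hS : markov_semigroup S) (hL : has_generator S (generator omega q))
  (hrev : reversible S mu) (hmu : equilibrium q mu).
Context {dT : measure_display} {T : measurableType dT}.
Variables (P : probability T R) (X : R -> T -> config d).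
Hypotheses (mX : forall t : R, 0 <= t -> measurable_fun [set: T] (X t))
  (hmk : markov_property P X S)
  (X0 : forall A, measurable A -> P (X 0 @^-1` A) = mu A).
Variables (M : nat) (B : nat -> {fset site d}).
Hypothesis chain : droplet_chain omega M B.

Lemma flow_combination_chain (i : nat) :
  flow_combination omega q (4 * M * i) (q ^+ (2 * M).+1)^-1
    (fun eta => droplet q (B 0%N) eta - droplet q (B i) eta).
Proof.
have [_ BM dB fB fB'] := chain; elim: i => [|i ih].
  rewrite muln0 (_ : (fun _ => _) = fun=> 0); first exact: flow_combination0.
  by apply/funext => eta; rewrite subrr.
rewrite mulnS addnC (_ : (fun _ => _) = fun eta => (droplet q (B 0%N) eta - droplet q
    (B i) eta)
   + (droplet q (B i) eta - droplet q (B i.+1) eta)); last by apply/funext => eta; ring.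
by apply: flow_combinationD ih _; apply: flow_combination_link.
Qed.

(* As long as the origin is occupied, [V = droplet (B 0) - Y] equals [- Y], whereas
   the time averages of [V] are close to 0 and those of [Y] are close to 1. *)
Lemma survival_bound (N : nat) (t : R) (U : set T) : (0 < N)%N -> 0 < t ->
  measurable U -> (forall w, U w -> forall s, 0 <= s < t -> X s w 0 = true) ->
  fine (P U) <= 8 * ((4 * M * N * N)%:R * (q ^+ (2 * M).+1)^-1) ^+ 2 / t
    + 2 * ((q ^+ M)^-1 / N%:R).
Proof.
move=> N0 t0 mU Uocc; have [B0 BM dB _ _] := chain.
set m := (4 * M * N * N)%N; set K := (q ^+ (2 * M).+1)^-1.
have N0' : (N%:R : R) != 0 by rewrite pnatr_eq0 -lt0n.
pose Y eta := N%:R^-1 * \sum_(i < N) droplet q (B i.+1) eta.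
pose V eta := droplet q (B 0%N) eta - Y eta.
have VK : flow_combination omega q m K V.
  rewrite (_ : V = fun eta => N%:R^-1 * \sum_(i < N) (droplet q (B 0%N) eta - droplet q
      (B i.+1) eta)).
    apply: flow_combinationZ.
      by rewrite ger0_norm ?invr_ge0// invf_le1 ?ler1n ?ltr0n.
    rewrite /m mulnC -[X in (X * _)%N](card_ord N) cardT enumT.
    apply: flow_combination_sum => i.
    by apply: flow_combination_le (flow_combination_chain i.+1) => //; rewrite leq_mul.
  apply/funext => eta; rewrite /V /Y sumrB sumr_const card_ord -[_ *+ N]mulr_natl.
  by field.
have lY : local_function Y.
  apply: localM (local_cst _) _; apply: local_sum => i; exact: droplet_local.
have lV : local_function V.
  have [r [_ _ Vr]] := VK; rewrite (_ : V = fun eta => \sum_(p <- r) p.1 * flow q p.2.1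
      p.2.2 eta).
    by apply: local_sum => p; apply: localM (local_cst _) (flow_local _ _ _).
  by apply/funext.
(* The error [e] left by the expansion of the semigroup contributes [8 * C * e], which is absorbed
   into an arbitrary [e']. *)
apply/ler_addgt0Pl => e' e'0.
set C := (m%:R * K) ^+ 2; have C0 : 0 <= C by exact: sqr_ge0.
pose e := Num.min 1 (e' / (8 * (C + 1))).
have e0 : 0 < e by rewrite /e lt_min ltr01 divr_gt0// mulr_gt0// ltr_wpDl.
have e1 : e <= 1 by rewrite /e ge_min lexx.
have eC : 8 * C * e <= e'.
  have h1 : e <= e' / (8 * (C + 1)) by rewrite /e ge_min lexx orbT.
  have h2 : 8 * C * e <= 8 * C * (e' / (8 * (C + 1))) by rewrite ler_wpM2l// mulr_ge0.
  rewrite (le_trans h2)// mulrA ler_pdivrMr ?mulr_gt0 ?ltr_wpDl//.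
  by rewrite mulrC ler_wpM2l ?ltW//; lra.
have [n n0 avg] := near_right_ex (flow_combination_average q01 hS hL hrev mX hmk X0 VK
    e0 e1) t0.
have {avg} := avg _ n0; set h := t / n%:R => avg.
have n0' : 0 < (n%:R : R) by rewrite ltr0n.
have h0 : 0 <= h by rewrite divr_ge0 ?ltW.
have kh0 (k : nat) : 0 <= k%:R * h by rewrite mulr_ge0.
have bV (k : nat) : bounded_measurable (fun w => V (X (k%:R * h) w)).
  exact: (bm_comp mX (kh0 k) (bc_bm (bc_local lV))).
have lY1 : local_function (fun eta => (Y eta - 1) ^+ 2).
  have l1 : local_function (fun eta => Y eta - 1) by exact: localD lY (local_cst _).
  exact: (localM l1 l1).
have bY (k : nat) : bounded_measurable (fun w => (Y (X (k%:R * h) w) - 1) ^+ 2).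
  exact: (bm_comp mX (kh0 k) (bc_bm (bc_local lY1))).
have bVs : bounded_measurable (fun w => (n%:R^-1 * \sum_(k < n) V (X (k%:R * h) w)) ^+ 2).
  by apply: bm_sqr; apply: bmM; [exact: bm_cst|apply: bm_sum].
have bYs : bounded_measurable (fun w => n%:R^-1 * \sum_(k < n) (Y (X (k%:R * h) w) - 1)
    ^+ 2).
  by apply: bmM; [exact: bm_cst|apply: bm_sum].
have main : fine (P U) <= 2 * (C * (4 / (n%:R * h) + 4 * e)) + 2 * ((q ^+ M)^-1 / N%:R).
  rewrite -exp_indic//.
  apply: (@le_trans _ _ (\int[P]_w (2 * (n%:R^-1 * \sum_(k < n) V (X (k%:R * h) w)) ^+ 2 +
     2 * (n%:R^-1 * \sum_(k < n) (Y (X (k%:R * h) w) - 1) ^+ 2)))).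
    apply: exp_le.
    - exact: bm_indic.
    - apply: bmD; apply: bmM => //; exact: bm_cst.
    move=> w; rewrite indicE; have [Uw|_] := boolP (w \in U); last first.
      rewrite addr_ge0// mulr_ge0// ?sqr_ge0// mulr_ge0 ?invr_ge0 ?ler0n//.
      by apply: sumr_ge0 => k _; exact: sqr_ge0.
    rewrite inE in Uw.
    have D0 (k : 'I_n) : droplet q (B 0%N) (X (k%:R * h) w) = 0.
      rewrite /droplet (_ : vacant _ _ = false) ?mul0r//.
      apply/negP => /allP /(_ _ B0); rewrite (Uocc w Uw)// kh0/= /h.
      by rewrite mulrA ltr_pdivrMr// mulrC ltr_pM2l// ltr_nat.
    set a := \sum_(k < n) V _; set b := \sum_(k < n) _ ^+ 2.
    pose c := \sum_(k < n) (Y (X (k%:R * h) w) - 1).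
    have ac : a = - c - n%:R.
      rewrite /a /c [X in _ = - X - _]sumrB sumr_const card_ord opprB addrAC subrr
          sub0r -sumrN.
      by apply: eq_bigr => k _; rewrite /V D0 sub0r.
    have cb : c ^+ 2 <= n%:R * b.
      have sz : size (index_enum 'I_n) = n by rewrite -[RHS](card_ord n) cardT enumT.
      by have := sqr_sum_le (index_enum 'I_n) (fun k : 'I_n => Y (X (k%:R * h) w) - 1);
          rewrite sz.
    have cb' : (n%:R^-1 * c) ^+ 2 <= n%:R^-1 * b.
      rewrite exprMn (_ : n%:R^-1 * b = n%:R^-1 ^+ 2 * (n%:R * b)).
        by rewrite ler_pM2l ?exprn_gt0 ?invr_gt0.
      by field; rewrite gt_eqF.
    have -> : n%:R^-1 * a = - (n%:R^-1 * c) - 1 by rewrite ac; field; rewrite gt_eqF.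
    set z := n%:R^-1 * c in cb' *.
    (* On [U] the time averages of [V] and of [Y - 1] are [- z - 1] and [z], and [2 * (z + 1) ^+ 2 +
       2 * z ^+ 2 - 1 = (2 * z + 1) ^+ 2]. *)
    have := sqr_ge0 (2 * z + 1); rewrite /= mulr1n; nra.
  rewrite expD; first last.
  - by apply: bmM => //; exact: bm_cst.
  - by apply: bmM => //; exact: bm_cst.
  rewrite !expZ//; last by apply: bm_sum.
  apply: lerD; first by rewrite ler_pM2l.
  rewrite ler_pM2l// exp_sum//.
  rewrite (eq_bigr (fun=> \int[mu]_eta (Y eta - 1) ^+ 2)); last first.
    by move=> k _; exact: (exp_stationary hS hrev mX hmk X0 (kh0 k) (bc_local lY1)).
  rewrite sumr_const card_ord -[X in _ * X]mulr_natl mulrA mulVf ?gt_eqF// mul1r.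
  exact: (droplet_variance q01 hmu N0 BM dB).
rewrite (le_trans main)//.
have -> : n%:R * h = t by rewrite /h mulrC divfK// gt_eqF.
have -> : 2 * (C * (4 / t + 4 * e)) = 8 * C / t + 8 * C * e by field; rewrite gt_eqF.
lra.
Qed.

End SurvivalBound.

(** * The emptying time *)

Section EmptyingTime.
Context {R : realType} {d : nat} {dT : measure_display} {T : measurableType dT}.
Variable X : R -> T -> config d.
Hypotheses (mX : forall t : R, 0 <= t -> measurable_fun [set: T] (X t))
  (cX : forall w, cadlag (fun t => X t w)).

Lemma emptying_time_ge c w : (c%:E <= emptying_time X w)%E <->
  forall t, 0 <= t -> X t w 0 = false -> c <= t.
Proof.
split=> [cw t t0 Xt|h].
  by rewrite -lee_fin (le_trans cw)//; apply: ereal_inf_lbound; exists t.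
by apply: le_ereal_inf_tmp => _ [t [t0 Xt] <-]; rewrite lee_fin; exact: h.
Qed.

Lemma near_right_constant w t : 0 <= t ->
  \forall u \near t^'+, X u w 0 = X t w 0.
Proof.
move=> t0; have [/(_ t t0) rc _] := cX w.
exact: (rc _ (near_coordinate (X t w) 0)).
Qed.

Lemma measurable_occupied t b : 0 <= t -> measurable [set w | X t w 0 = b].
Proof.
move=> t0; have := mX t0 measurableT (measurable_coordinate 0 b).
by rewrite setTI.
Qed.

(** By right continuity an empty origin stays empty for a positive time, so emptying before [c] is
    seen at some dyadic time before [c]. With dyadic times these events increase with [n], which
    [early_emptying_bound] uses to pass to the limit. *)
Definition dyadic_empty (c : R) (n : nat) : set T :=
  \bigcup_k [set w | k%:R / 2 ^+ n < c /\ X (k%:R / 2 ^+ n) w 0 = false].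

Let dyadic_ge0 (k n : nat) : 0 <= k%:R / 2 ^+ n :> R.
Proof. by rewrite divr_ge0 ?exprn_ge0 ?ler0n. Qed.

Lemma measurable_dyadic_empty c n : measurable (dyadic_empty c n).
Proof.
apply: bigcupT_measurable => k; have [kc|kc] := boolP (k%:R / 2 ^+ n < c).
  rewrite (_ : [set _ | _] = [set w | X (k%:R / 2 ^+ n) w 0 = false]).
    exact: measurable_occupied.
  by apply/seteqP; split=> w //= -[].
rewrite (_ : [set _ | _] = set0)//; apply/seteqP; split=> w //= -[] //.
Qed.

Lemma dyadic_between (t u : R) : 0 <= t -> t < u ->
  exists n k : nat, t < k%:R / 2 ^+ n < u.
Proof.
move=> t0 tu; have ut : 0 < u - t by rewrite subr_gt0.
pose n := Num.trunc (u - t)^-1.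
have n0 : 0 < (2 ^+ n : R) by rewrite exprn_gt0.
have nb : 1 < (u - t) * 2 ^+ n.
  rewrite -ltr_pdivrMl// mulr1 (lt_le_trans (truncnS_gt _))// -natrX ler_nat.
  exact: ltn_expl.
exists n, (Num.trunc (t * 2 ^+ n)).+1.
rewrite ltr_pdivlMr// ltr_pdivrMr// truncnS_gt/=.
have : (Num.trunc (t * 2 ^+ n))%:R <= t * 2 ^+ n.
  by rewrite truncn_le// mulr_ge0// ltW.
rewrite -natr1; lra.
Qed.

Lemma emptying_time_lt c : [set w | (emptying_time X w < c%:E)%E] =
  \bigcup_n dyadic_empty c n.
Proof.
apply/seteqP; split=> w /=.
  rewrite ltNge => /negP nge; apply: contrapT => nD; apply: nge.
  apply/emptying_time_ge => t t0 Xt; rewrite leNgt; apply/negP => tc; apply: nD.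
  have [/= e e0 he] := near_right_constant w t0.
  have te : t < Num.min c (t + e) by rewrite lt_min tc ltrDl.
  have [n [k /andP[tk]]] := dyadic_between t0 te.
  rewrite lt_min => /andP[kc ke]; exists n => //; exists k => //=; split=> //.
  rewrite -Xt; apply: he => //; rewrite /ball_ /= distrC ger0_norm ?subr_ge0 ?ltW//; lra.
move=> [n _ [k _ [kc Xk]]]; rewrite ltNge; apply/negP => /emptying_time_ge h.
by have := h _ (dyadic_ge0 k n) Xk; rewrite leNgt kc.
Qed.

Lemma measurable_emptying_time_lt c :
  measurable [set w | (emptying_time X w < c%:E)%E].
Proof.
rewrite emptying_time_lt; apply: bigcupT_measurable => n.
exact: measurable_dyadic_empty.
Qed.

Lemma measurable_emptying_time_ge c :
  measurable [set w | (c%:E <= emptying_time X w)%E].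
Proof.
rewrite (_ : [set _ | _] = ~` [set w | (emptying_time X w < c%:E)%E]).
  exact: measurableC (measurable_emptying_time_lt c).
by apply/seteqP; split=> w /=; rewrite leNgt => /negP.
Qed.

Lemma measurable_emptying_time_le c :
  measurable [set w | (emptying_time X w <= c%:E)%E].
Proof.
rewrite (_ : [set _ | _] = \bigcap_n [set w | (emptying_time X w < (c +
    n.+1%:R^-1)%:E)%E]).
  by apply: bigcapT_measurable => n; exact: measurable_emptying_time_lt.
apply/seteqP; split=> w /=.
  by move=> wc n _ /=; rewrite (le_lt_trans wc)// lte_fin ltrDl invr_gt0 ltr0n.
move=> h; apply/lee_addgt0Pr => e e0.
have [n ne] : exists n : nat, n.+1%:R^-1 < e.
  exists (Num.trunc e^-1); rewrite invf_plt ?posrE ?ltr0n//.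
  exact: truncnS_gt.
by rewrite -EFinD (le_trans (ltW (h n I)))// lee_fin lerD2l ltW.
Qed.

End EmptyingTime.

(** * The origin is not emptied early *)

Section EarlyEmptying.
Context {R : realType} {d : nat}.
Variables (omega : site d -> nat) (q : R).
Hypothesis q01 : 0 < q < 1.
Variables (S : R -> (config d -> R) -> config d -> R)
  (mu : probability (config d) R).
Hypotheses (hS : markov_semigroup S) (hL : has_generator S (generator omega q))
  (hrev : reversible S mu) (hmu : equilibrium q mu).
Context {dT : measure_display} {T : measurableType dT}.
Variables (P : probability T R) (X : R -> T -> config d).
Hypotheses (mX : forall t : R, 0 <= t -> measurable_fun [set: T] (X t))
  (cX : forall w, cadlag (fun t => X t w))
  (hmk : markov_property P X S)
  (X0 : forall A, measurable A -> P (X 0 @^-1` A) = mu A).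

Let b (eta : config d) : R := (vacant [fset (0 : site d)]%fset eta)%:R.

Let bE eta : b eta = (~~ eta 0)%:R.
Proof.
rewrite /b; congr (nat_of_bool _)%:R; apply/allP/idP => [/(_ 0)|e0 y]; rewrite inE
    ?eqxx//.
  exact.
by move=> /eqP ->.
Qed.

Let b01 eta : 0 <= b eta <= 1.
Proof. by rewrite bE; case: (eta 0) => /=; rewrite ?lexx ?ler01 ?lexx. Qed.

Let lb : local_function b := vacant_local _.

Let lnb : local_function (fun eta => 1 + -1 * b eta).
Proof. by apply: localD (local_cst _) _; exact: localM (local_cst _) lb. Qed.

(** An occupied origin is emptied at rate at most [q]. Expanding the semigroup with error [h * q]
    accounts for the factor 2 and keeps the bound proportional to [q]; stationarity makes it uniform
    in [s]. *)
Lemma emptying_rate : \forall h \near 0^'+, forall s, 0 <= s ->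
  \int[P]_w ((1 + -1 * b (X s w)) * b (X (s + h) w)) <= 2 * h * q.
Proof.
have q0 : 0 < q by case/andP: q01.
near=> h => s s0; have h0 : 0 < h by near: h; exact: nbhs_right_gt.
have ex : forall eta, `|S h b eta - b eta - h * generator omega q b eta| <= h * q.
  by near: h; exact: (semigroup_expansion hL lb q0).
rewrite (exp_markov hS hrev mX hmk X0 s0 (ltW h0) lnb (bc_local lb)).
rewrite -[leRHS](exp_cst mu); apply: exp_le; last 1 first.
- move=> eta; have := ex eta.
  rewrite (@generator_fset _ _ _ _ [fset (0 : site d)]%fset); last first.
    by move=> e1 e2 e12; rewrite !bE e12// inE.
  rewrite big_seq_fset1 /site_average !bE /update eqxx.
  case: (eta 0) => /=; rewrite ?mulr0n ?mulr1n; last first.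
    by move=> _; rewrite mulN1r subrr mul0r !mulr_ge0// ltW.
  have : ((constraint omega 0 eta)%:R : R) <= 1 by case: (constraint omega 0 eta).
  set c := (constraint omega 0 eta)%:R => c1.
  rewrite ler_norml => /andP[_ up].
  have : h * (c * q) <= h * q by rewrite ler_pM2l// ler_piMl// ltW.
  by move: up; lra.
- apply: bc_bm; apply: bcM; first exact: (bc_local lnb).
  apply: bcS (ltW h0) (bc_local lb); exact: hS.
- exact: bm_cst.
Unshelve. all: by end_near. Qed.

(** If the origin is empty at a grid time before 2, either it was empty initially, which has
    probability [q], or one of [2 ^ n.+1] steps of length [2 ^ -n] empties it, which has probability
    at most [4 * q] in total. The window ends at 2 because the dyadic events detect only strict
    inequality, whereas the event here is emptying up to time 1 included. *)
Lemma early_emptying_bound :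
  fine (P [set w | (emptying_time X w <= 1%:E)%E]) <= 5 * q.
Proof.
have q0 : 0 < q by case/andP: q01.
have bX t : 0 <= t -> bounded_measurable (fun w => b (X t w)).
  by move=> t0; exact: (bm_comp mX t0 (bc_bm (bc_local lb))).
have mD n := measurable_dyadic_empty mX 2 n.
have PD : \forall n \near \oo, (P (dyadic_empty X 2 n) <= (5 * q)%:E)%E.
  have [D /= D0 hD] := emptying_rate.
  exists (Num.trunc D^-1) => // n /= Dn.
  have n20 : 0 < (2 ^+ n : R) by rewrite exprn_gt0.
  pose h : R := (2 ^+ n)^-1; have h0 : 0 < h by rewrite invr_gt0.
  have hDn : h < D.
    rewrite /h invf_plt ?posrE// (lt_le_trans (truncnS_gt _))// -natrX ler_nat.
    by rewrite (leq_trans _ (ltn_expl n (isT : (1 < 2)%N))).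
  have rate s : 0 <= s -> \int[P]_w ((1 + -1 * b (X s w)) * b (X (s + h) w)) <= 2 * h * q.
    by apply: hD => //; rewrite /ball_ /= sub0r normrN gtr0_norm.
  have kh0 (k : nat) : 0 <= k%:R * h by rewrite mulr_ge0// ltW.
  have bF (k : nat) : bounded_measurable (fun w => (1 + -1 * b (X (k%:R * h) w)) * b (X
      (k%:R * h + h) w)).
    apply: bmM; first exact: (bm_comp mX (kh0 k) (bc_bm (bc_local lnb))).
    by apply: bX; rewrite addr_ge0// ltW.
  rewrite -[P _]fineK ?fin_num_measure// lee_fin -exp_indic//.
  apply: (@le_trans _ _ (\int[P]_w (b (X 0 w) + \sum_(k < 2 ^ n.+1)
    ((1 + -1 * b (X (k%:R * h) w)) * b (X (k%:R * h + h) w))))).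
    apply: exp_le.
    - exact: bm_indic.
    - by apply: bmD; [exact: bX (lexx 0)|apply: bm_sum].
    move=> w.
    have F0 (k : nat) : 0 <= (1 + -1 * b (X (k%:R * h) w)) * b (X (k%:R * h + h) w).
      have /andP[_ ?] := b01 (X (k%:R * h) w); have /andP[? _] := b01 (X (k%:R * h + h)
          w).
      by rewrite mulr_ge0//; lra.
    have step (k : nat) : b (X (k%:R * h) w) <= b (X 0 w) +
       \sum_(j < k) ((1 + -1 * b (X (j%:R * h) w)) * b (X (j%:R * h + h) w)).
      elim: k => [|k ih]; first by rewrite mul0r big_ord0 addr0.
      rewrite big_ord_recr/= addrA.
      rewrite -[in leLHS]natr1 mulrDl mul1r.
      move: ih (b01 (X (k%:R * h) w)) (b01 (X (k%:R * h + h) w)).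
      set x := b (X (k%:R * h) w); set y := b (X (k%:R * h + h) w).
      set z := _ + \sum_(_ < k) _ => xz /andP[x0 x1] /andP[y0 y1].
      have : 0 <= x * (1 - y) by rewrite mulr_ge0//; lra.
      lra.
    rewrite indicE; have [|_] := boolP (w \in _); last first.
      have /andP[bb _] := b01 (X 0 w).
      by apply: addr_ge0 => //; apply: sumr_ge0.
    rewrite inE => -[k _ [k2 Xk]].
    have -> : true%:R = b (X (k%:R * h) w) by rewrite bE Xk.
    rewrite (le_trans (step k))// lerD2l.
    have k2n : (k <= 2 ^ n.+1)%N.
      by move: k2; rewrite ltr_pdivrMr// -exprS -natrX ltr_nat => /ltnW.
    rewrite (big_ord_widen _ (fun k : nat => (1 + -1 * b (X (k%:R * h) w)) * b (X (k%:R
        * h + h) w)) k2n).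
    by rewrite [leRHS](bigID (fun i : 'I__ => (i < k)%N))/= lerDl; apply: sumr_ge0.
  rewrite expD; first last.
  - by apply: bm_sum.
  - exact: bX (lexx 0).
  have Eb : \int[mu]_eta b eta = q by rewrite (exp_vacant q01 hmu) cardfs1.
  rewrite (exp_initial mX X0 (bc_bm (bc_local lb))) Eb.
  rewrite exp_sum//.
  have : \sum_(k < 2 ^ n.+1) \int[P]_w ((1 + -1 * b (X (k%:R * h) w)) * b (X (k%:R * h
      + h) w))
      <= \sum_(k < 2 ^ n.+1) (2 * h * q) by apply: ler_sum => k _; exact: rate.
  rewrite sumr_const card_ord -[X in _ <= X -> _]mulr_natl natrX exprS.
  have -> : 2 * 2 ^+ n * (2 * h * q) = 4 * q by rewrite /h; field; rewrite gt_eqF.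
  lra.
have mU : measurable (\bigcup_n dyadic_empty X 2 n) by apply: bigcupT_measurable.
have nd : {homo dyadic_empty X 2 : n m / (n <= m)%N >-> (n <= m)%O}.
  move=> n m nm; apply/subsetPset => w [k _ [k2 Xk]].
  have kE : k%:R / 2 ^+ n = (k * 2 ^ (m - n))%:R / 2 ^+ m :> R.
    rewrite natrM natrX (_ : 2 ^+ m = 2 ^+ (m - n) * 2 ^+ n); last by rewrite -exprD
        subnK.
    by field; rewrite !expf_neq0.
  by exists (k * 2 ^ (m - n))%N => //; split; rewrite -kE.
have := nondecreasing_cvg_mu mD mU nd (mu := P) => cv.
have Ple : (P (\bigcup_n dyadic_empty X 2 n) <= (5 * q)%:E)%E.
  by rewrite -(cvg_lim _ cv)//; apply: lime_le => //; apply: cvgP cv.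
have sub : (P [set w | (emptying_time X w <= 1%:E)%E] <= (5 * q)%:E)%E.
  apply: le_trans Ple; apply: le_measure; rewrite ?inE//.
    exact: measurable_emptying_time_le.
  rewrite -(emptying_time_lt cX) => w /=; move=> /le_lt_trans; apply.
  by rewrite lte_fin; lra.
by rewrite -lee_fin fineK// fin_num_measure//; exact: measurable_emptying_time_le.
Qed.

End EarlyEmptying.

(** * Both tails of the emptying time, given a chain of droplets *)

Lemma cvg_linear_bound (R : realType) (C : R) (u : R -> \bar R) :
  (forall q, 0 < q < 1 -> (0 <= u q <= (C * q)%:E)%E) ->
  u q @[q --> 0^'+] --> 0%E.
Proof.
move=> uC; apply: (@squeeze_cvge _ _ _ _ (fun=> 0%E) _ (fun q => (C * q)%:E)).
- near=> q; apply: uC; apply/andP; split; near: q; first exact: nbhs_right_gt.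
  exact: nbhs_right_lt.
- exact: cvg_cst.
- apply: cvg_EFin; first by near=> q.
  rewrite /comp/= -[X in _ --> X](mulr0 C).
  apply: cvgM; first exact: cvg_cst.
  exact: cvg_within.
Unshelve. all: by end_near. Qed.

Lemma chain_emptying_time (R : realType) (d : nat) (omega : site d -> nat)
    (M : nat) (B : nat -> {fset site d}) : droplet_chain omega M B ->
  exists alpha_low alpha_up : R,
    forall (dT : measure_display) (T : R -> measurableType dT)
      (P : forall q : R, probability (T q) R)
      (eta : forall q : R, R -> T q -> config d),
      (forall q : R, 0 < q < 1 -> stationary_kcm (P q) omega q (eta q)) ->
      (P q [set w | ((q `^ (- alpha_up))%:E <= emptying_time (eta q) w)%E]
         @[q --> 0^'+] --> 0%E) /\
      (P q [set w | (emptying_time (eta q) w <= (q `^ (- alpha_low))%:E)%E]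
         @[q --> 0^'+] --> 0%E).
Proof.
(* With [N] of order [q^-(M + 1)] the variance term is of order [q]. Then [4 * M * N ^ 2] flows with
   coefficients [q^-(2 * M + 1)] contribute, after squaring, order [q^-(8 * M + 6)] divided by [t];
   one more power of [1 / q] in [t] makes this of order [q] too. *)
move=> chain; exists 0, (8 * M + 7)%:R => dT T P X kcm; split; last first.
  apply: (@cvg_linear_bound _ 5) => q q01.
  have [mu [S [hmu [hS hL hrev] mX [cX hmk] X0]]] := kcm q q01.
  rewrite measure_ge0/= oppr0 powRr0.
  rewrite -[P q _]fineK ?lee_fin.
    exact: (early_emptying_bound q01 hS hL hrev hmu mX cX hmk X0).
  by apply: fin_num_measure; exact: measurable_emptying_time_le.
apply: (@cvg_linear_bound _ (2048 * M%:R ^+ 2 + 2)) => q q01.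
have [mu [S [hmu [hS hL hrev] mX [cX hmk] X0]]] := kcm q q01.
have /andP[q0 q1] := q01.
rewrite measure_ge0/=.
set t := q `^ _; set U := [set w | _].
have t0 : 0 < t by exact: powR_gt0.
have mU : measurable U by exact: measurable_emptying_time_ge.
have tE : t = (q ^+ (8 * M + 7))^-1 by rewrite /t powRN powR_mulrn// ltW.
rewrite -[P q _]fineK ?lee_fin; last exact: fin_num_measure.
have Uocc w : U w -> forall s, 0 <= s < t -> X q s w 0 = true.
  move=> /emptying_time_ge h s /andP[s0 st]; apply/negPn/negP => /negbTE Xs.
  by have := h s s0 Xs; rewrite leNgt st.
pose p : R := (q ^+ M.+1)^-1.
have p0 : 0 < p by rewrite invr_gt0 exprn_gt0.
have p1 : 1 <= p by rewrite invf_ge1 ?exprn_gt0// exprn_ile1// ltW.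
pose N := (Num.trunc p).+1.
have pN : p < N%:R by exact: truncnS_gt.
have Np : N%:R <= 2 * p.
  have : (Num.trunc p)%:R <= p by rewrite truncn_le ltW.
  by rewrite /N -natr1; lra.
have N0 : (0 < N)%N by [].
have := survival_bound q01 hS hL hrev hmu mX hmk X0 chain N0 t0 mU Uocc.
move=> /le_trans; apply; rewrite [leRHS]mulrDl; apply: lerD; last first.
  rewrite ler_pM2l// ler_pdivrMr ?ltr0n//.
  apply: (@le_trans _ _ (q * p)); last by rewrite ler_pM2l// ltW.
  by rewrite /p exprS; rewrite le_eqVlt; apply/orP; left; apply/eqP; field;
    rewrite expf_neq0 gt_eqF.
rewrite tE invrK -mulrA.
set K := (q ^+ (2 * M).+1)^-1.
have K0 : 0 < K by rewrite invr_gt0 exprn_gt0.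
have mK : (4 * M * N * N)%:R * K <= 4 * M%:R * (2 * p) * (2 * p) * K.
  rewrite ler_pM2r// !natrM.
  by rewrite ler_pM ?mulr_ge0 ?ler0n// ler_pM ?mulr_ge0 ?ler0n.
have mK2 : ((4 * M * N * N)%:R * K) ^+ 2 <= (4 * M%:R * (2 * p) * (2 * p) * K) ^+ 2.
  by rewrite lerXn2r// nnegrE// ?mulr_ge0 ?ler0n// ltW.
apply: (@le_trans _ _ (8 * ((4 * M%:R * (2 * p) * (2 * p) * K) ^+ 2 * q ^+ (8 * M + 7)))).
  by rewrite ler_pM2l// ler_wpM2r// exprn_ge0// ltW.
rewrite le_eqVlt; apply/orP; left; apply/eqP; rewrite /p /K.
have -> : q ^+ (8 * M + 7) = (q ^+ M) ^+ 8 * q ^+ 7 by rewrite -exprM -exprD mulnC.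
have -> : q ^+ (2 * M).+1 = (q ^+ M) ^+ 2 * q by rewrite exprS mulrC -exprM mulnC.
rewrite (exprS q M); field; rewrite expf_neq0 ?gt_eqF//.
Qed.

(** * Independence of local events *)

Section LocalEvents.
Context {R : realType} {dO : measure_display} {O : measurableType dO}.
Variables (Q : probability O R) (I : choiceType) (X : I -> O -> bool) (p : bool -> R).
Hypotheses (mX : forall i b, measurable [set o | X i o = b])
  (cylX : forall (r : seq I) (b : I -> bool), uniq r ->
    fine (Q [set o | forall i, i \in r -> X i o = b i]) = \prod_(i <- r) p (b i)).
Implicit Types (A B D : seq I) (E F : (I -> bool) -> Prop) (s : I -> bool).

(** One implication suffices since [s] and [s'] can be exchanged. With [A] finite, measurability of
    the event follows by conditioning on one coordinate at a time. *)
Definition determined_by A E : Prop :=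
  forall s s', (forall i, i \in A -> s i = s' i) -> E s -> E s'.

Definition event E : set O := [set o | E (X^~ o)].

Definition pr E : R := fine (Q (event E)).

Definition disjoint_seq A B : Prop := forall i, i \in A -> i \in B -> False.

Let assign s i b : I -> bool := fun j => if j == i then b else s j.

Let determined_assign i A E b : determined_by (i :: A) E ->
  determined_by A (fun s => E (assign s i b)).
Proof.
move=> dE s s' ss'; apply: dE => j; rewrite /assign inE.
by case: eqP => //= _; exact: ss'.
Qed.

Let event_assign i A E : determined_by (i :: A) E ->
  forall o, E (X^~ o) <-> E (assign (X^~ o) i (X i o)).
Proof.
by move=> dE o; split; apply: dE => j _; rewrite /assign; case: eqP => // ->.
Qed.

Lemma measurable_event A E : determined_by A E -> measurable (event E).
Proof.
elim: A E => [|i A ih] E dE.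
  have [[s Es]|nE] := pselect (exists s, E s).
    rewrite (_ : event E = setT)//; apply/seteqP; split=> o // _.
    by apply: dE Es.
  rewrite (_ : event E = set0)//; apply/seteqP; split=> o //= Eo.
  by apply: nE; exists (X^~ o).
rewrite (_ : event E = \bigcup_(b in [set: bool])
    (event (fun s => E (assign s i b)) `&` [set o | X i o = b])).
  apply: fin_bigcup_measurable; first exact: finite_finset.
  move=> b _; apply: measurableI; last exact: mX.
  by apply: ih; exact: determined_assign.
apply/seteqP; split=> o /=.
  by move=> /(event_assign dE) Eo; exists (X i o).
by move=> [b _ [/= Eo Xo]]; apply/(event_assign dE); rewrite Xo.
Qed.

Let cylinder B s : set O := [set o | forall i, i \in B -> X i o = s i].

Let measurable_cyl B s : measurable (cylinder B s).
Proof.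
apply: (@measurable_event B (fun s' => forall i, i \in B -> s' i = s i)).
by move=> s1 s2 s12 h i iB; rewrite -s12// h.
Qed.

Let cylinder_cons i B s b : i \notin B ->
  cylinder B s `&` [set o | X i o = b] = cylinder (i :: B) (assign s i b).
Proof.
move=> iB; apply/seteqP; split=> o /=.
  move=> [h Xi] j; rewrite inE /assign; case: eqP => [-> _//|_ /=]; exact: h.
move=> h; split; last by rewrite h ?mem_head// /assign eqxx.
move=> j jB; rewrite h ?inE ?jB ?orbT// /assign; case: eqP => // ji.
by move: iB; rewrite -ji jB.
Qed.

Let pr_cylinder_cons i B s b : uniq (i :: B) ->
  fine (Q (cylinder (i :: B) (assign s i b))) = p b * fine (Q (cylinder B s)).
Proof.
move=> /= /andP[iB uB]; rewrite !cylX//= ?iB// big_cons /assign eqxx.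
congr (_ * _); rewrite big_seq [RHS]big_seq; apply: eq_bigr => j jB.
by case: eqP => // ji; move: iB; rewrite -ji jB.
Qed.

Let fine_split i (U : set O) : measurable U ->
  fine (Q U) = \sum_(b : bool) fine (Q (U `&` [set o | X i o = b])).
Proof.
move=> mU; rewrite big_bool/=.
rewrite -fineD ?fin_num_measure//; try exact: measurableI.
rewrite -measureU//; try exact: measurableI; last first.
  by apply/seteqP; split=> o //= -[[_ ->] []].
congr (fine (Q _)); apply/seteqP; split=> o /=.
  by move=> Uo; case: (X i o); [left|right].
by case=> -[].
Qed.

Let split_event i A E (V : set O) : determined_by (i :: A) E -> measurable V ->
  fine (Q (event E `&` V)) = \sum_(b : bool)
    fine (Q (event (fun s => E (assign s i b)) `&` (V `&` [set o | X i o = b]))).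
Proof.
move=> dE mV; rewrite (@fine_split i); last first.
  by apply: measurableI => //; exact: measurable_event dE.
apply: eq_bigr => b _; congr (fine (Q _)); apply/seteqP; split=> o /=.
  by move=> [[/(event_assign dE) + Vo] Xi]; rewrite Xi.
by move=> [Eo [Vo Xi]]; split=> //; split=> //; apply/(event_assign dE); rewrite Xi.
Qed.

Let constant_event E : determined_by [::] E -> event E = setT \/ event E = set0.
Proof.
move=> dE; have [[s Es]|nE] := pselect (exists s, E s); [left|right].
  by apply/seteqP; split=> o // _; apply: dE Es.
apply/seteqP; split=> o //= Eo; apply: nE; by exists (X^~ o).
Qed.

Let cylinder_nil s : cylinder [::] s = setT.
Proof. by apply/seteqP; split. Qed.

(** The coordinates of [A] are revealed one at a time and moved into the cylinder until [E] is
    constant. The factor obtained does not depend on the cylinder, so the empty cylinder identifies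
    it as [pr E]. *)
Let pr_cylinder A E B s : uniq A -> uniq B -> disjoint_seq A B ->
  determined_by A E ->
  fine (Q (event E `&` cylinder B s)) = pr E * fine (Q (cylinder B s)).
Proof.
elim: A E B s => [|i A ih] E B s uA uB AB dE.
  rewrite /pr; have [->|->] := constant_event dE.
    by rewrite setTI probability_setT/= mul1r.
  by rewrite set0I measure0/= mul0r.
have [/= iA uA'] := andP uA.
have iB : i \notin B by apply/negP => iB; exact: (AB i (mem_head _ _) iB).
have step C s' : uniq C -> i \notin C -> disjoint_seq A C ->
   fine (Q (event E `&` cylinder C s')) =
   (\sum_(b : bool) pr (fun s => E (assign s i b)) * p b) * fine (Q (cylinder C s')).
  move=> uC iC AC; rewrite (split_event dE)// mulr_suml; apply: eq_bigr => b _.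
  rewrite cylinder_cons// ih//=; last exact: determined_assign.
  - by rewrite pr_cylinder_cons/= ?iC// mulrA.
  - by rewrite iC.
  - move=> j jA; rewrite inE => /predU1P[ji|]; last exact: AC.
    by move: iA; rewrite -ji jA.
rewrite step//; last by move=> j jA; apply: AB; rewrite inE jA orbT.
congr (_ * _); have := @step [::] s isT isT.
rewrite cylinder_nil setIT probability_setT mulr1 => <-//.
Qed.

(** Now the coordinates of [D] are revealed while [E] is carried along; once [F] is constant this is
    [pr_cylinder]. *)
Let pr_cylinder2 A E D F B s : uniq A -> uniq D -> uniq B ->
  disjoint_seq A D -> disjoint_seq A B -> disjoint_seq D B ->
  determined_by A E -> determined_by D F ->
  fine (Q (event E `&` (event F `&` cylinder B s))) =
  pr E * fine (Q (event F `&` cylinder B s)).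
Proof.
move=> uA; elim: D F B s => [|i D ih] F B s uD uB AD AB DB dE dF.
  have [->|->] := constant_event dF; first by rewrite setTI (@pr_cylinder A).
  by rewrite set0I setI0 measure0/= mulr0.
have [/= iD uD'] := andP uD.
have iB : i \notin B by apply/negP => iB; exact: (DB i (mem_head _ _) iB).
rewrite setICA (split_event dF); last first.
  by apply: measurableI => //; exact: measurable_event dE.
rewrite [in RHS](split_event dF)// mulr_sumr; apply: eq_bigr => b _.
rewrite -setIA cylinder_cons// setICA ih//=.
- by rewrite iB.
- by move=> j jA jD; apply: (AD j) => //; rewrite inE jD orbT.
- move=> j jA; rewrite inE => /predU1P[ji|]; last exact: AB.
  by apply: (AD j) => //; rewrite ji mem_head.
- move=> j jD; rewrite inE => /predU1P[ji|].
    by move: iD; rewrite -ji jD.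
  by apply: DB; rewrite inE jD orbT.
- exact: determined_assign.
Qed.

Lemma determined_undup A E : determined_by A E -> determined_by (undup A) E.
Proof. by move=> dE s s' h; apply: dE => i iA; apply: h; rewrite mem_undup. Qed.

Lemma pr_and A E D F : disjoint_seq A D -> determined_by A E -> determined_by D F ->
  pr (fun s => E s /\ F s) = pr E * pr F.
Proof.
move=> AD /determined_undup dE /determined_undup dF.
have := @pr_cylinder2 (undup A) E (undup D) F [::] (fun=> true) (undup_uniq _)
    (undup_uniq _).
rewrite cylinder_nil !setIT; apply => //.
by move=> i; rewrite !mem_undup; exact: AD.
Qed.

Lemma determined_sub A B E : {subset A <= B} -> determined_by A E -> determined_by B E.
Proof. by move=> AB dE s s' h; apply: dE => i /AB; exact: h. Qed.

Lemma determined_all (J : eqType) (r : seq J) (A : J -> seq I)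
    (E : J -> (I -> bool) -> Prop) :
  (forall j, j \in r -> determined_by (A j) (E j)) ->
  determined_by (flatten [seq A j | j <- r]) (fun s => forall j, j \in r -> E j s).
Proof.
move=> dE s s' ss' h j jr; apply: (dE j jr s) (h j jr) => i iA; apply: ss'.
by apply/flattenP; exists (A j) => //; apply: map_f.
Qed.

Lemma determined_not A E : determined_by A E -> determined_by A (fun s => ~ E s).
Proof. by move=> dE s s' ss' nE Es; apply: nE; apply: dE Es => i /ss'. Qed.

Lemma pr_all (J : eqType) (r : seq J) (A : J -> seq I) (E : J -> (I -> bool) -> Prop) :
  uniq r -> (forall j, j \in r -> determined_by (A j) (E j)) ->
  (forall j k, j \in r -> k \in r -> j != k -> disjoint_seq (A j) (A k)) ->
  pr (fun s => forall j, j \in r -> E j s) = \prod_(j <- r) pr (E j).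
Proof.
elim: r => [|j r ih] ur dE dA.
  rewrite big_nil /pr (_ : event _ = setT) ?probability_setT//.
  by apply/seteqP; split.
move: ur => /= /andP[jr ur]; rewrite big_cons -ih//; first last.
- by move=> k l kr lr; apply: dA; rewrite inE ?kr ?lr orbT.
- by move=> k kr; apply: dE; rewrite inE kr orbT.
have dr : forall k, k \in r -> determined_by (A k) (E k).
  by move=> k kr; apply: dE; rewrite inE kr orbT.
rewrite -(@pr_and (A j) _ (flatten [seq A k | k <- r])).
- congr (fine (Q _)); apply/seteqP; split=> o /=.
    by move=> h; split; [apply: h; rewrite mem_head|move=> k kr; apply: h; rewrite inE
        kr orbT].
  by move=> [Ej h] k; rewrite inE => /predU1P[->//|]; exact: h.
- move=> i iA /flattenP[_ /mapP[k kr ->] iAk].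
  apply: (dA j k _ _ _ i iA iAk); rewrite ?mem_head// ?inE ?kr ?orbT//.
  by apply: contraNneq jr => ->.
- by apply: dE; rewrite mem_head.
- exact: determined_all.
Qed.

Lemma pr_ge0 E : 0 <= pr E.
Proof. exact: fine_ge0. Qed.

Lemma pr_le1 A E : determined_by A E -> pr E <= 1.
Proof.
move=> /measurable_event mE; rewrite /pr -lee_fin fineK ?fin_num_measure//.
exact: probability_le1.
Qed.

Lemma pr_le A E B F : determined_by A E -> determined_by B F ->
  (forall s, E s -> F s) -> pr E <= pr F.
Proof.
move=> /measurable_event mE /measurable_event mF EF.
rewrite /pr fine_le ?fin_num_measure//; apply: le_measure; rewrite ?inE//.
by move=> o; exact: EF.
Qed.

Lemma pr_not A E : determined_by A E -> pr (fun s => ~ E s) = 1 - pr E.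
Proof.
move=> /measurable_event mE; rewrite /pr (_ : event _ = ~` event E)//.
by rewrite probability_setC// fineB// ?fin_num_measure.
Qed.

Lemma pr_exists (J : eqType) (r : seq J) (A : J -> seq I) (E : J -> (I -> bool) -> Prop) :
  (forall j, j \in r -> determined_by (A j) (E j)) ->
  pr (fun s => exists2 j, j \in r & E j s) <= \sum_(j <- r) pr (E j).
Proof.
elim: r => [|j r ih] dE.
  rewrite big_nil /pr (_ : event _ = set0) ?measure0//.
  by apply/seteqP; split=> // o [].
have dj : determined_by (A j) (E j) by apply: dE; rewrite mem_head.
have dr : forall k, k \in r -> determined_by (A k) (E k).
  by move=> k kr; apply: dE; rewrite inE kr orbT.
have mr : measurable (event (fun s => exists2 j, j \in r & E j s)).
  apply: (@measurable_event (flatten [seq A j | j <- r])).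
  move=> s s' ss' [k kr Ek]; exists k => //; apply: (dr k kr s) Ek => i iA.
  by apply: ss'; apply/flattenP; exists (A k) => //; apply: map_f.
have mj := measurable_event dj.
rewrite big_cons (le_trans _ (lerD (lexx _) (ih dr)))//.
have -> : pr (fun s => exists2 k, k \in j :: r & E k s) =
    fine (Q (event (E j) `|` event (fun s => exists2 k, k \in r & E k s))).
  congr (fine (Q _)); apply/seteqP; split=> o /=.
    by move=> [k]; rewrite inE => /predU1P[->|kr]; [left|right; exists k].
  by move=> [Ej|[k kr Ek]]; [exists j; rewrite ?mem_head|exists k; rewrite // inE kr
      orbT].
rewrite /pr -fineD ?fin_num_measure//.
rewrite fine_le ?fin_num_measure//; first exact: measurableU.
  by rewrite fin_numD !fin_num_measure.
exact: measureU2.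
Qed.

End LocalEvents.

(** * Bootstrap percolation in boxes *)

Section Bootstrap.
Variable d : nat.
Implicit Types (x y a b : site d) (D S : {set 'I_d}) (s : site d -> bool)
  (W Z : site d -> Prop) (m l : nat).

Lemma siteDE x y i : (x + y) 0 i = x 0 i + y 0 i.
Proof. exact: mxE. Qed.

Lemma siteBE x y i : (x - y) 0 i = x 0 i - y 0 i.
Proof. by rewrite siteDE; congr (_ + _); exact: mxE. Qed.

Lemma unit_vectorE (i j : 'I_d) : (unit_vector i : site d) 0 j = (j == i)%:R.
Proof. by rewrite /unit_vector mxE eqxx. Qed.

Definition box_shift (S : {set 'I_d}) (k : int) : site d := \row_i (if i \in S then k
    else 0).

Lemma box_shiftE S k i : box_shift S k 0 i = if i \in S then k else 0.
Proof. exact: mxE. Qed.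

Definition inbox D a m x : Prop :=
  forall i, if i \in D then a 0 i <= x 0 i < a 0 i + m%:Z else x 0 i == a 0 i.

(* One neighbour in each direction of [D] is required, which is more than [#|D|]
   neighbours: directions in which a neighbour is known to be empty can then be
   dropped, see [spanned_lift]. *)
Definition closed_under D s W Z : Prop :=
  forall x, W x ->
    (s x \/ forall i, i \in D -> Z (x + unit_vector i) \/ Z (x - unit_vector i)) -> Z x.

(** The least closed set, defined as an intersection: bootstrap percolation without reference to
    time. *)
Definition spanned D s W x : Prop := forall Z, closed_under D s W Z -> Z x.

Definition filled D a m s : Prop :=
  forall x, inbox D a m x -> spanned D s (inbox D a m) x.

Lemma spanned_closed D s W : closed_under D s W (spanned D s W).
Proof.
move=> x Wx h Z cZ; apply: (cZ x Wx); case: h => [|h]; [by left|right=> i iD].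
by case: (h i iD) => /(_ Z cZ); [left|right].
Qed.

Lemma closed_under_sub D s W W' Z : (forall x, W' x -> W x) ->
  closed_under D s W Z -> closed_under D s W' Z.
Proof. by move=> WW' cZ x /WW'; exact: cZ. Qed.

Lemma spanned_lift D S s W W' Z : closed_under D s W Z ->
  (forall y, W' y -> W y) ->
  (forall y, W' y -> forall i, i \in S -> Z (y + unit_vector i) \/ Z (y - unit_vector
      i)) ->
  forall x, spanned (D :\: S) s W' x -> Z x.
Proof.
move=> cZ W'W hS x; apply => y W'y hy; apply: cZ; first exact: W'W.
case: hy => [|hy]; [by left|right=> i iD].
have [iS|iS] := boolP (i \in S); first exact: hS.
by apply: hy; rewrite inE iS.
Qed.

Lemma filled_lift D S s W Z a m : closed_under D s W Z ->
  (forall y, inbox (D :\: S) a m y -> W y) ->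
  (forall y, inbox (D :\: S) a m y -> forall i, i \in S ->
    Z (y + unit_vector i) \/ Z (y - unit_vector i)) ->
  filled (D :\: S) a m s -> forall x, inbox (D :\: S) a m x -> Z x.
Proof. by move=> cZ W'W hS fS x /fS; exact: spanned_lift cZ W'W hS x. Qed.

(** The added layer splits into faces, indexed by the nonempty set [S] of directions in which the
    coordinate is extremal. From the face of [S], a step back in a direction of [S] leads to a face
    with fewer extremal directions, already covered by induction, so filling the face in the
    directions [D :\: S] suffices. *)
Lemma grow_shell D s W Z a m : (0 < m)%N -> closed_under D s W Z ->
  (forall x, inbox D a m.+1 x -> W x) ->
  (forall x, inbox D a m x -> Z x) ->
  (forall S, (0 < #|S|)%N -> S \subset D -> filled (D :\: S) (a + box_shift S m) m s) ->
  forall x, inbox D a m.+1 x -> Z x.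
Proof.
move=> m0 cZ hW Z0 hF; pose top x := [set i in D | x 0 i == a 0 i + m%:Z]%SET.
suff H n x : #|top x| = n -> inbox D a m.+1 x -> Z x by move=> x; exact: H.
elim: n x => [|n ih] x tn hx.
  apply: Z0 => i; have := hx i; case: ifP => // iD.
  have : i \notin top x by rewrite (cards0_eq tn) inE.
  rewrite inE iD /=; lia.
have tne : (0 < #|top x|)%N by rewrite tn.
have tD : top x \subset D by apply/fintype.subsetP => i; rewrite inE => /andP[].
have inT y : inbox (D :\: top x) (a + box_shift (top x) m) m y ->
    inbox D a m.+1 y /\ top y = top x.
  move=> hy; have hi i : if i \in D then
       if i \in top x then y 0 i == a 0 i + m%:Z else a 0 i <= y 0 i < a 0 i + m%:Z
       else y 0 i == a 0 i.
    have := hy i; rewrite inE siteDE box_shiftE.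
    case: (boolP (i \in top x)) => [it|it] /=; first by rewrite (fintype.subsetP tD _ it).
    by case: ifP => //; rewrite addr0.
  split.
    by move=> i; have := hi i; case: ifP => // iD; case: ifP => _; lia.
  apply/setP => i; rewrite inE; have := hi i; case: (boolP (i \in D)) => iD /=.
    by case: ifP => // _; lia.
  by move=> _; apply/esym/negbTE; apply: contraNN iD; exact: (fintype.subsetP tD).
apply: (filled_lift (D := D) cZ _ _ (hF _ tne tD)).
- by move=> y /inT[hy _]; exact: hW.
- move=> y /inT[hy ty] i it; right; apply: ih.
    have -> : top (y - unit_vector i) = top x :\ i.
      apply/setP => j; rewrite -ty !inE siteBE unit_vectorE.
      have := it; rewrite -ty inE => /andP[iD /eqP yi].
      case: (eqVneq j i) => [->|ji] /=; last by rewrite subr0.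
      by rewrite iD yi; lia.
    by have := cardsD1 i (top x); rewrite it tn => -[].
  move=> j; have := hy j; rewrite siteBE unit_vectorE; case: ifP => jD.
    have := it; rewrite -ty inE => /andP[iD /eqP yi].
    by case: (eqVneq j i) => [->|ji]; rewrite ?yi; lia.
  case: (eqVneq j i) => [ji|ji]; last by rewrite subr0.
  by have := fintype.subsetP tD _ it; rewrite -ji jD.
- move=> i; have := hx i; rewrite !inE siteDE box_shiftE !inE; case: (boolP (i \in D))
    => //= iD.
    by case: eqP => //= ne; rewrite ?addr0; lia.
  by rewrite addr0.
Qed.

Lemma filled_growth D s a m0 m : (0 < m0)%N -> (m0 <= m)%N ->
  (forall x, inbox D a m0 x -> s x) ->
  (forall j S, (m0 <= j < m)%N -> (0 < #|S|)%N -> S \subset D ->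
     filled (D :\: S) (a + box_shift S j) j s) ->
  filled D a m s.
Proof.
move=> m00 m0m seeds hF; have cZ := @spanned_closed D s (inbox D a m).
have sub j k x : (j <= k)%N -> inbox D a j x -> inbox D a k x.
  by move=> jk h i; have := h i; case: ifP => // _; lia.
suff H j : (m0 <= j <= m)%N -> forall x, inbox D a j x -> spanned D s (inbox D a m) x.
  by apply: H; rewrite m0m leqnn.
elim: j => [|j ih] /andP[mj jm] x hx.
  by move: m00; rewrite ltnNge mj.
move: mj; rewrite leq_eqVlt => /predU1P[mj|mj].
  by apply: cZ; [exact: sub hx|left; apply: seeds; rewrite mj].
apply: (grow_shell (leq_trans m00 mj) cZ _ (ih _) _ hx).
- by move=> y; exact: sub.
- by rewrite -ltnS mj ltnW.
- by move=> S; apply: hF; rewrite -ltnS mj.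
Qed.

(** Moving a box by one unit adds a single slice, each site of which has a neighbour of the old box
    behind it; the slice only has to fill in the remaining directions. *)
Lemma slide_forward D s W Z b l i : i \in D -> closed_under D s W Z ->
  (forall x, inbox D (b + unit_vector i) l x -> W x) ->
  (forall x, inbox D b l x -> Z x) ->
  filled (D :\: [set i]%SET) (b + box_shift [set i]%SET l) l s ->
  forall x, inbox D (b + unit_vector i) l x -> Z x.
Proof.
move=> iD cZ hW hZ hF x hx.
have [xi|xi] := eqVneq (x 0 i) (b 0 i + l%:Z); last first.
  apply: hZ => j; have := hx j; rewrite siteDE unit_vectorE.
  by case: (eqVneq j i) xi => [->|ji] xi; rewrite ?iD /=; [lia|case: ifP => jD; lia].
apply: (filled_lift (D := D) cZ _ _ hF).
- move=> y hy; apply: hW => j; have := hx j; have := hy j.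
  rewrite !inE !siteDE box_shiftE unit_vectorE inE.
  by case: (eqVneq j i) => [->|ji]; rewrite ?iD /=; [lia|case: ifP => jD; lia].
- move=> y hy k; rewrite inE => /eqP ->; right; apply: hZ => j; have := hy j; have :=
    hx j.
  rewrite !inE siteBE !siteDE box_shiftE unit_vectorE inE.
  by case: (eqVneq j i) => [->|ji]; rewrite ?iD /=; [lia|case: ifP => jD; lia].
- move=> j; have := hx j; rewrite !inE !siteDE box_shiftE unit_vectorE inE.
  by case: (eqVneq j i) => [->|ji]; rewrite ?iD /=; [lia|case: ifP => jD; lia].
Qed.

Lemma slide_backward D s W Z b l i : i \in D -> closed_under D s W Z ->
  (forall x, inbox D b l x -> W x) ->
  (forall x, inbox D (b + unit_vector i) l x -> Z x) ->
  filled (D :\: [set i]%SET) b l s ->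
  forall x, inbox D b l x -> Z x.
Proof.
move=> iD cZ hW hZ hF x hx.
have [xi|xi] := eqVneq (x 0 i) (b 0 i); last first.
  apply: hZ => j; have := hx j; rewrite siteDE unit_vectorE.
  by case: (eqVneq j i) xi => [->|ji] xi; rewrite ?iD /=; [lia|case: ifP => jD; lia].
apply: (filled_lift (D := D) cZ _ _ hF).
- move=> y hy; apply: hW => j; have := hx j; have := hy j.
  by rewrite !inE; case: (eqVneq j i) => [->|ji]; rewrite ?iD /=; [lia|case: ifP => jD;
      lia].
- move=> y hy k; rewrite inE => /eqP ->; left; apply: hZ => j; have := hy j; have := hx j.
  rewrite !inE !siteDE unit_vectorE.
  by case: (eqVneq j i) => [->|ji]; rewrite ?iD /=; [lia|case: ifP => jD; lia].
- move=> j; have := hx j; rewrite !inE.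
  by case: (eqVneq j i) => [->|ji]; rewrite ?iD /=; [lia|case: ifP => jD; lia].
Qed.

Definition subbox D a m b l : Prop :=
  forall i, if i \in D then (a 0 i <= b 0 i) && (b 0 i + l%:Z <= a 0 i + m%:Z)
            else b 0 i == a 0 i.

Lemma subbox_inbox D a m b l x : subbox D a m b l -> inbox D b l x -> inbox D a m x.
Proof.
by move=> hb hx i; have := hb i; have := hx i; case: ifP => _; lia.
Qed.

(** The filled box slides to every position inside the large one, by induction on the [l^1] distance
    to its initial position [b0]. *)
Lemma filled_cover D s a m b0 l : (0 < l)%N ->
  subbox D a m b0 l -> (l <= m)%N -> filled D b0 l s ->
  (forall i b, i \in D -> inbox D a m b -> filled (D :\: [set i]%SET) b l s) ->
  filled D a m s.
Proof.
move=> l0 vb0 lm fb0 hF; pose Z := spanned D s (inbox D a m).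
have cZ : closed_under D s (inbox D a m) Z by exact: spanned_closed.
pose dist b := (\sum_(i < d) absz (b 0%R i - b0 0%R i)%R)%N.
have full n : forall b, subbox D a m b l ->
    dist b = n -> forall x, inbox D b l x -> Z x.
  elim: n => [|n ih] b vb bn.
    have -> : b = b0.
      apply/rowP => i; move/eqP: bn; rewrite /dist sum_nat_eq0 => /forallP /(_ i) /=; lia.
    move=> x hx; apply: fb0 hx _ _.
    by apply: closed_under_sub cZ => y; exact: subbox_inbox.
  have [i bi] : exists i, b 0 i != b0 0 i.
    apply: contrapT => nb; move: bn; rewrite /dist big1// => i _.
    have [/eqP -> |ne] := boolP (b 0 i == b0 0 i); first by rewrite subrr.
    by exfalso; apply: nb; exists i.
  have iD : i \in D.
    by have := vb i; have := vb0 i; case: (i \in D) => // /eqP h /eqP h'; move: bi;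
        rewrite h h' eqxx.
  have vbi := vb i; rewrite iD in vbi; have vb0i := vb0 i; rewrite iD in vb0i.
  have step (b' : site d) : (forall j, j != i -> b' 0 j = b 0 j) ->
      (absz (b' 0 i - b0 0 i)%R).+1 = absz (b 0 i - b0 0 i)%R -> dist b' = n.
    move=> b'j b'i; move: bn; rewrite /dist !(bigD1 i (P := xpredT))//= -b'i addSn =>
        -[<-].
    by congr (_ + _)%N; apply: eq_bigr => j ji; rewrite b'j.
  have [lt|gt] : b0 0 i < b 0 i \/ b 0 i < b0 0 i by lia.
    have E : b - unit_vector i + unit_vector i = b by rewrite subrK.
    suff: forall x, inbox D (b - unit_vector i + unit_vector i) l x -> Z x by rewrite E.
    apply: (slide_forward iD cZ).
    - by move=> x; rewrite E; exact: subbox_inbox.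
    - apply: ih.
        move=> j; have := vb j; rewrite siteBE unit_vectorE.
        by case: (eqVneq j i) => [->|ji]; rewrite ?iD /=; [lia|case: ifP => jD; lia].
      apply: step => [j ji|]; rewrite siteBE unit_vectorE ?(negbTE ji) ?subr0// eqxx; lia.
    - apply: hF => // j; have := vb j; rewrite siteDE siteBE box_shiftE unit_vectorE inE.
      by case: (eqVneq j i) => [->|ji]; rewrite ?iD /=; [lia|case: ifP => jD; lia].
  apply: (slide_backward iD cZ).
  - by move=> x; exact: subbox_inbox.
  - apply: ih.
      move=> j; have := vb j; rewrite siteDE unit_vectorE.
      by case: (eqVneq j i) => [->|ji]; rewrite ?iD /=; [lia|case: ifP => jD; lia].
    apply: step => [j ji|]; rewrite siteDE unit_vectorE ?(negbTE ji) ?addr0// eqxx; lia.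
  - by apply: hF => // j; have := vb j; case: ifP => jD; lia.
move=> x hx.
(* A small box containing [x], with its corner pulled back where it would stick out of the large
   box. *)
pose b : site d := \row_i (if i \in D then Num.min (x 0 i) (a 0 i + m%:Z - l%:Z) else a
    0 i).
apply: (full (dist b) b) => //.
  by move=> i; have := hx i; rewrite mxE; case: ifP => iD; lia.
by move=> i; have := hx i; rewrite mxE; case: ifP => iD; lia.
Qed.

End Bootstrap.

(** With [rho = u ^+ 2], one factor [u ^+ l] absorbs one power of [l], because
    [l * u ^+ l * (1 - u) <= 1 - u ^+ l]; the other is left to the induction on [s]. *)
Lemma poly_geometric_bound (R : realType) (rho : R) (s : nat) : 0 <= rho < 1 ->
  exists2 K : R, 0 <= K & forall l : nat, l%:R ^+ s * rho ^+ l <= K.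
Proof.
elim: s rho => [|s ih] rho /andP[r0 r1].
  by exists 1 => // l; rewrite mul1r exprn_ile1// ltW.
have q0 : 0 <= Num.sqrt rho by exact: sqrtr_ge0.
have q1 : Num.sqrt rho < 1 by rewrite -[ltRHS]sqrtr1 ltr_sqrt.
have [K K0 hK] := ih (Num.sqrt rho) (introT andP (conj q0 q1)).
exists ((1 - Num.sqrt rho)^-1 * K); first by rewrite mulr_ge0// invr_ge0 subr_ge0 ltW.
move=> l; set u := Num.sqrt rho in q0 q1 hK *.
have -> : l%:R ^+ s.+1 * rho ^+ l = (l%:R * u ^+ l) * (l%:R ^+ s * u ^+ l).
  have -> : rho = u ^+ 2 by rewrite sqr_sqrtr.
  by rewrite -exprM mulnC exprM expr2 exprS; ring.
apply: ler_pM => //; rewrite ?mulr_ge0 ?exprn_ge0 ?ler0n//.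
have u1 : 0 < 1 - u by rewrite subr_gt0.
rewrite -[leRHS]mul1r ler_pdivlMr//.
have : l%:R * u ^+ l * (1 - u) <= 1 - u ^+ l.
  elim: l => [|l ihl]; first by rewrite mul0r mul0r expr0 subrr.
  rewrite exprS -natr1.
  have ul0 : 0 <= u ^+ l by rewrite exprn_ge0.
  have : u * (l%:R * u ^+ l * (1 - u)) <= u * (1 - u ^+ l) by rewrite ler_wpM2l.
  have : u * u ^+ l * (1 - u) <= 1 - u.
    by rewrite -exprS; apply: ler_piMl; [lra|apply: exprn_ile1 => //; lra].
  lra.
by move=> /le_trans; apply; rewrite gerBl exprn_ge0.
Qed.

Lemma leq_expl (m n k : nat) : (m <= n)%N -> (m ^ k <= n ^ k)%N.
Proof. by move=> mn; elim: k => // k ih; rewrite !expnS leq_mul. Qed.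

Lemma sum_inv_sqr_le (R : realFieldType) (k m : nat) : (0 < k)%N ->
  \sum_(k.+1 <= j < m) (j%:R ^+ 2)^-1 <= k%:R^-1 :> R.
Proof.
move=> k0; have [mm|/ltnW mm] := leqP m k.+1; first by rewrite big_geq// invr_ge0 ler0n.
have H n : \sum_(k.+1 <= j < k.+1 + n) (j%:R ^+ 2)^-1 <= k%:R^-1 - (k + n)%:R^-1 :> R.
  elim: n => [|n ih]; first by rewrite !addn0 big_geq// subrr.
  rewrite addnS big_nat_recr/=; last by rewrite leq_addr.
  rewrite (le_trans (lerD ih (lexx _)))// addnS addSn -natr1.
  have : 0 < ((k + n)%:R : R) by rewrite ltr0n addn_gt0 k0.
  set u := _%:R => u0.
  have : ((u + 1) ^+ 2)^-1 <= u^-1 - (u + 1)^-1.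
    rewrite (_ : u^-1 - (u + 1)^-1 = (u * (u + 1))^-1); last by field; apply/andP;
        split; lra.
    by rewrite lef_pV2 ?posrE; nra.
  lra.
by rewrite -(subnKC mm) (le_trans (H _))// gerBl invr_ge0 ler0n.
Qed.

Section BoxEvents.
Variable d : nat.
Implicit Types (x y a b : site d) (D : {set 'I_d}) (s : site d -> bool) (m : nat).

(** The values of [f] outside [D] are ignored, so sites may be repeated; in exchange the length is
    [m ^ d] for every [D]. *)
Definition box_seq D a m : seq (site d) :=
  [seq a + \row_i (if i \in D then ((f i : 'I_m) : nat)%:Z else 0) | f : {ffun 'I_d ->
      'I_m}].

Lemma box_seqP D a m x : (0 < m)%N -> (x \in box_seq D a m) <-> inbox D a m x.
Proof.
case: m => // m _; split.
  move=> /mapP[f _ ->] i; rewrite siteDE mxE; case: (i \in D).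
    by move: (ltn_ord (f i)); move: (nat_of_ord (f i)) => n nm; lia.
  by rewrite addr0.
move=> hx; apply/mapP; exists [ffun i => inord (absz (x 0 i - a 0 i)%R)] => //.
  by rewrite mem_enum.
apply/rowP => i; rewrite siteDE mxE ffunE; have := hx i; case: (i \in D).
  by move=> h; rewrite inordK; lia.
by move=> /eqP ->; rewrite addr0.
Qed.

Lemma size_box_seq D a m : size (box_seq D a m) = (m ^ d)%N.
Proof. by rewrite size_map -cardT card_ffun !card_ord. Qed.

Lemma closed_under_eq D s s' (W Z : site d -> Prop) :
  (forall x, W x -> s x = s' x) -> closed_under D s W Z -> closed_under D s' W Z.
Proof. by move=> ss' cZ x Wx h; apply: cZ => //; rewrite ss'. Qed.

Lemma filled_determined D a m : (0 < m)%N ->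
  determined_by (box_seq D a m) (filled D a m).
Proof.
move=> m0 s s' ss' fs x hx Z cZ; apply: (fs x hx).
by apply: closed_under_eq cZ => y /(box_seqP _ _ _ m0) /ss'.
Qed.

Definition unfilled D a m s := ~ filled D a m s.

Lemma unfilled_determined D a m : (0 < m)%N ->
  determined_by (box_seq D a m) (unfilled D a m).
Proof. by move=> m0; apply: determined_not; exact: filled_determined. Qed.

End BoxEvents.

(** * Boxes fill up to a superpolynomially small probability *)

Section Growth.
Context {R : realType} {d : nat} {dO : measure_display} {O : measurableType dO}.
Variables (Q : probability O R) (X : site d -> O -> bool) (p : bool -> R).
Hypotheses (mX : forall i b, measurable [set o | X i o = b])
  (cylX : forall (r : seq (site d)) (b : site d -> bool), uniq r ->
    fine (Q [set o | forall i, i \in r -> X i o = b i]) = \prod_(i <- r) p (b i)).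
Hypotheses (p0 : 0 < p true) (p1 : p true <= 1).
Implicit Types (x y a b : site d) (D S : {set 'I_d}) (s : site d -> bool) (m l : nat).

Local Notation prob := (pr Q X).

Definition superpolynomial D : Prop := forall r : nat, exists2 C : R, 0 <= C &
  forall a m, (0 < m)%N -> prob (unfilled D a m) * m%:R ^+ r <= C.

Lemma pr_seed x : prob (fun s => s x) = p true.
Proof.
have := @cylX [:: x] (fun=> true) isT; rewrite big_seq1 => <-.
congr (fine (Q _)); apply/seteqP; split=> o /=; last by apply; rewrite mem_head.
by move=> h i; rewrite inE => /eqP ->.
Qed.

Lemma pr_seeds D a m n : (0 < m)%N -> (m <= n)%N ->
  p true ^+ (n ^ d) <= prob (fun s => forall x, inbox D a m x -> s x).
Proof.
move=> m0 mn; pose r := undup (box_seq D a m).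
have -> : prob (fun s => forall x, inbox D a m x -> s x) =
    prob (fun s => forall x, x \in r -> s x).
  congr (fine (Q _)); apply/seteqP; split=> o /= h x.
    by rewrite mem_undup => /(box_seqP _ _ _ m0); exact: h.
  by move=> /(box_seqP _ _ _ m0) hx; apply: h; rewrite mem_undup.
rewrite (pr_all mX cylX (A := fun x => [:: x]) (E := fun x s => s x)) ?undup_uniq//;
    first last.
- by move=> x y _ _ xy z; rewrite !inE => /eqP -> /eqP zy; rewrite zy eqxx in xy.
- by move=> x _ s s' ss'; rewrite ss'// mem_head.
under eq_bigr do rewrite pr_seed.
rewrite big_const_seq count_predT iter_mulr_1; apply: ler_wiXn2l => //; first exact: ltW.
by rewrite (leq_trans (size_undup _))// size_box_seq leq_expl.
Qed.


(* A nucleus of seeds grows for ever with positive probability, since the faces of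
   the growing box fail to fill with summable probabilities. *)
Lemma pr_filled_lower_bound D (C : R) : 0 <= C ->
  (forall S a m, (0 < #|S|)%N -> S \subset D -> (0 < m)%N ->
     prob (unfilled (D :\: S) a m) * m%:R ^+ 2 <= C) ->
  exists2 delta : R, 0 < delta & forall a m, (0 < m)%N -> delta <= prob (filled D a m).
Proof.
move=> C0 hC.
pose N : R := #|{set 'I_d}|%:R.
have N0 : 0 <= N by rewrite ler0n.
(* For a nucleus of side [k + 1], at most [N] faces of each size [j > k] may fail, each with
   probability at most [C / j ^ 2]; in total at most [N * C / k <= 1 / 2]. *)
have [k k0 kC] : exists2 k : nat, (0 < k)%N & 2 * N * C <= k%:R.
  by exists (Num.trunc (2 * N * C)).+1 => //; exact: ltW (truncnS_gt _).
pose m0 := k.+1.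
exists (p true ^+ (m0 ^ d) / 2); first by rewrite divr_gt0// exprn_gt0.
move=> a m mgt.
have pm0 : 0 < p true ^+ (m0 ^ d) by rewrite exprn_gt0.
have [mm|mm] := leqP m m0.
  apply: (@le_trans _ _ (p true ^+ (m0 ^ d))).
    by rewrite ler_pdivrMr// ler_peMr ?ler1n// ltW.
  rewrite (le_trans (pr_seeds D a mgt mm))//.
  have : prob (fun s => forall x, inbox D a m x -> s x) <= prob (filled D a m).
    apply: (pr_le Q mX (A := box_seq D a m) (B := box_seq D a m)).
    - by move=> s s' ss' h x hx; rewrite -ss' ?h//; apply/(box_seqP _ _ _ mgt).
    - exact: filled_determined.
    - by move=> s h x hx Z cZ; apply: (cZ x hx); left; exact: h.
  by [].
pose r : seq (nat * {set 'I_d}) := [seq (j, U) | j <- iota m0 (m - m0), U <- enum [set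
    U : {set 'I_d} | (0 < #|U|)%N && (U \subset D)]%SET].
have rP j S : (j, S) \in r -> [/\ (m0 <= j < m)%N, (0 < #|S|)%N & S \subset D].
  move=> /allpairsP[[j' S'] /= []]; rewrite mem_iota mem_enum inE.
  by move=> /andP[h1 h2] /andP[S0 SD] [-> ->]; split=> //; rewrite h1 (leq_trans h2)//
      subnKC// ltnW.
have jpos j S : (j, S) \in r -> (0 < j)%N by move=> /rP[/andP[/(leq_trans _) + _] _ _];
    apply.
pose E (t : nat * {set 'I_d}) s := unfilled (D :\: t.2) (a + box_shift t.2 t.1) t.1 s.
pose A (t : nat * {set 'I_d}) := box_seq (D :\: t.2) (a + box_shift t.2 t.1) t.1.
have dE t : t \in r -> determined_by (A t) (E t).
  by case: t => j S jS; apply: unfilled_determined; exact: jpos jS.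
pose bad s := exists2 t, t \in r & E t s.
have dbad : determined_by (flatten [seq A t | t <- r]) bad.
  move=> s s' ss' [t tr Et]; exists t => //; apply: (dE t tr s) Et => i iA.
  by apply: ss'; apply/flattenP; exists (A t) => //; apply: map_f.
have pbad : prob bad <= 1 / 2.
  rewrite (le_trans (pr_exists Q mX dE))//.
  have termle t : t \in r -> prob (E t) <= C * (t.1%:R ^+ 2)^-1.
    case: t => j S jS; have [_ S0 SD] := rP _ _ jS; have j0 := jpos _ _ jS.
    by rewrite ler_pdivlMr ?exprn_gt0 ?ltr0n//; exact: hC.
  rewrite big_seq (le_trans (ler_sum _ termle))// -big_seq.
  rewrite /r big_allpairs/=.
  apply: (@le_trans _ _ (\sum_(j <- iota m0 (m - m0)) N * (C * (j%:R ^+ 2)^-1))).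
    apply: ler_sum => j _; rewrite big_const_seq count_predT iter_addr_0.
    rewrite -[leLHS]mulr_natl ler_wpM2r ?mulr_ge0 ?invr_ge0 ?sqr_ge0//.
    by rewrite /N ler_nat -cardE max_card.
  rewrite -!mulr_sumr -/(index_iota m0 m).
  apply: (@le_trans _ _ (N * (C * k%:R^-1))).
    by rewrite ler_wpM2l// ler_wpM2l// /m0 sum_inv_sqr_le.
  by rewrite mulrA ler_pdivrMr ?ltr0n//; lra.
have pseeds := pr_seeds D a (isT : (0 < m0)%N) (leqnn m0).
have dseeds : determined_by (box_seq D a m0) (fun s => forall x, inbox D a m0 x -> s x).
  by move=> s s' ss' h x hx; rewrite -ss' ?h//; apply/box_seqP.
have -> : p true ^+ (m0 ^ d) / 2 = p true ^+ (m0 ^ d) * (1 - 1 / 2).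
  by congr (_ * _); lra.
apply: (@le_trans _ _ (prob (fun s => (forall x, inbox D a m0 x -> s x) /\ ~ bad s))).
  rewrite (pr_and mX cylX _ dseeds (determined_not dbad)).
    rewrite (pr_not Q mX dbad); apply: ler_pM => //; [exact: ltW|lra|by rewrite lerD2l
        lerN2].
  (* The nucleus and the faces are disjoint, hence independent: in a direction of [S] a face has
     coordinate [a + j] with [j >= m0]. *)
  move=> x /box_seqP hx /flattenP[_ /mapP[[j S] jS ->]] /box_seqP hx'.
  have [/andP[m0j _] S0 SD] := rP _ _ jS; have j0 := jpos _ _ jS.
  have [i iS] := card_gt0P S0; have iD := fintype.subsetP SD _ iS.
  have h1 := hx isT i; rewrite iD in h1.
  have h2 := hx' j0 i; rewrite finset.in_setD iS /= siteDE box_shiftE iS in h2.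
  by move: h1 h2 m0j; rewrite /m0; clear; lia.
apply: (pr_le Q mX (A := box_seq D a m0 ++ flatten [seq A t | t <- r]) (B := box_seq D
    a m)).
- move=> s s' ss' [h1 h2]; split.
    by apply: dseeds h1 => i hi; apply: ss'; rewrite mem_cat hi.
  by apply: (determined_not dbad) h2 => i hi; apply: ss'; rewrite mem_cat hi orbT.
- exact: filled_determined.
move=> s [hs nb]; apply: (@filled_growth _ _ _ _ m0) => //; first exact: ltnW.
move=> j S /andP[h1 h2] S0 SD; apply: contrapT => nf; apply: nb; exists (j, S) => //.
apply/allpairsP; exists (j, S) => /=; split=> //; last by rewrite mem_enum inE S0 SD.
by rewrite mem_iota h1 subnKC// ltnW.
Qed.

Lemma floor_sqrt m : (0 < m)%N -> exists2 l, (0 < l)%N & (l * l <= m <= 4 * (l * l))%N.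
Proof.
elim: m => // m ih _; case: (posnP m) => [->|m0]; first by exists 1%N.
have [l l0 /andP[lm ml]] := ih m0.
have [ml'|ml'] := ltnP m (4 * (l * l)); first by exists l => //; lia.
by exists l.+1 => //; nia.
Qed.

(* In a box of side [m >= l ^ 2] one of [l] disjoint boxes of side [l] is filled up
   to an exponentially small probability, and then slides over the whole box
   unless one of the polynomially many slices of side [l] is not filled. *)
Lemma superpolynomial_step D :
  (forall S, (0 < #|S|)%N -> S \subset D -> superpolynomial (D :\: S)) ->
  superpolynomial D.
Proof.
move=> hD r.
have [D0|[i0 i0D]] := set_0Vmem D.
  (* In dimension zero the condition on neighbours is vacuous and boxes are always filled, which
     starts the induction. *)
  exists 0 => // a m m0; rewrite (_ : prob _ = 0) ?mul0r//.
  rewrite /pr (_ : event _ _ = set0) ?measure0//.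
  apply/seteqP; split=> o //= nf; apply: nf => x hx Z cZ.
  by apply: (cZ x hx); right=> i; rewrite D0 inE.
have unif r' : exists2 C : R, 0 <= C & forall S a m, (0 < #|S|)%N -> S \subset D ->
    (0 < m)%N -> prob (unfilled (D :\: S) a m) * m%:R ^+ r' <= C.
  have ex (S : {set 'I_d}) : exists C : R, 0 <= C /\ ((0 < #|S|)%N -> S \subset D ->
      forall a m, (0 < m)%N -> prob (unfilled (D :\: S) a m) * m%:R ^+ r' <= C).
    have [S0|S0] := boolP (0 < #|S|)%N; last by exists 0.
    have [SD|SD] := boolP (S \subset D); last by exists 0.
    by have [C C0 hC] := hD S S0 SD r'; exists C.
  have [C hC] := choice ex; exists (\sum_S C S).
    by apply: sumr_ge0 => S _; have [] := hC S.
  move=> S a m S0 SD m0; have [_ /(_ S0 SD a m m0)] := hC S.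
  move=> /le_trans; apply; rewrite (bigD1 S)//= lerDl.
  by apply: sumr_ge0 => S' _; have [] := hC S'.
have [C2 C20 hC2] := unif 2%N.
have [delta delta0 hdelta] := pr_filled_lower_bound C20 hC2.
have delta1 : delta <= 1.
  rewrite (le_trans (hdelta 0 1%N isT))//.
  by apply: (pr_le1 Q mX (A := box_seq D 0 1)); exact: filled_determined.
have rho01 : 0 <= 1 - delta < 1 by apply/andP; lra.
(* Since [m <= 4 * l ^ 2], a power of [m] costs twice that power of [l]. In [hC] the additional [d]
   pays for the [m ^ d] base points of slices. *)
have [K K0 hK] := poly_geometric_bound (2 * r) rho01.
have [C C0 hC] := unif (2 * (d + r))%N.
exists (4 ^+ r * K + d%:R * 4 ^+ (d + r) * C).
  by rewrite addr_ge0 ?mulr_ge0 ?exprn_ge0 ?ler0n.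
move=> a m m0; have [l l0 /andP[lm ml]] := floor_sqrt m0.
have l_le_m : (l <= m)%N by nia.
pose E1 s := forall j, j \in iota 0 l -> unfilled D (a + box_shift [set i0]%SET (j *
    l)%N) l s.
pose r2 : seq ('I_d * site d) := [seq (i, c) | i <- enum 'I_d, c <- box_seq D a m].
pose F (t : 'I_d * site d) s := t.1 \in D /\ unfilled (D :\: [set t.1]%SET) t.2 l s.
pose E2 s := exists2 t, t \in r2 & F t s.
have dF t : t \in r2 -> determined_by (box_seq (D :\: [set t.1]%SET) t.2 l) (F t).
  by move=> _ s s' ss' [tD u]; split=> //; exact: (unfilled_determined l0 ss').
have dE2 : determined_by (flatten [seq box_seq (D :\: [set t.1]%SET) t.2 l | t <- r2]) E2.
  move=> s s' ss' [t tr Ft]; exists t => //; apply: (dF t tr s) Ft => i iA.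
  by apply: ss'; apply/flattenP; eexists; [apply: map_f tr|].
pose A1 j := box_seq D (a + box_shift [set i0]%SET (j * l)%N) l.
have dF1 j : j \in iota 0 l -> determined_by (A1 j)
    (unfilled D (a + box_shift [set i0]%SET (j * l)%N) l).
  by move=> _; exact: unfilled_determined.
have dE1 := determined_all dF1.
have pE1 : prob E1 <= (1 - delta) ^+ l.
  rewrite /E1 (pr_all mX cylX (iota_uniq 0 l) dF1); last first.
    move=> j k _ _ jk x /(box_seqP _ _ _ l0) hx /(box_seqP _ _ _ l0) hx'.
    have := hx i0; have := hx' i0; rewrite i0D !siteDE !box_shiftE !inE eqxx.
    by move: jk l0; clear; nia.
  rewrite -[in leRHS](size_iota 0 l) -[leRHS]iter_mulr_1 -[size _](count_predT)
      -big_const_seq.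
  apply: ler_prod => j _; rewrite pr_ge0/= (pr_not Q mX (@filled_determined _ _ _ _ l0)).
  by rewrite lerD2l lerN2 hdelta.
have pE2 : prob E2 <= (d * m ^ d)%:R * (C / l%:R ^+ (2 * (d + r))).
  rewrite (le_trans (pr_exists Q mX dF))//.
  apply: (@le_trans _ _ (\sum_(t <- r2) C / l%:R ^+ (2 * (d + r)))).
    apply: ler_sum => -[i c] _; rewrite ler_pdivlMr ?exprn_gt0 ?ltr0n//.
    have [iD|iD] := boolP (i \in D).
      have i1 : (0 < #|[set i]%SET|)%N by rewrite cards1.
      have iS : [set i]%SET \subset D by rewrite finset.sub1set.
      apply: le_trans (hC _ c l i1 iS l0).
      rewrite ler_wpM2r ?exprn_ge0 ?ler0n//.
      apply: (pr_le Q mX (A := box_seq (D :\: [set i]%SET) c l) (B := box_seq (D :\: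
          [set i]%SET) c l)).
      - move=> s s' ss' [tD u]; split=> //; exact: (unfilled_determined l0 ss').
      - exact: unfilled_determined.
      - by move=> s [].
    rewrite /pr (_ : event _ _ = set0) ?measure0 ?mul0r//.
    by apply/seteqP; split=> o // [] /=; rewrite (negbTE iD).
  rewrite big_const_seq count_predT iter_addr_0 -[leLHS]mulr_natl.
  by rewrite size_allpairs size_enum_ord size_box_seq.
have sub : prob (unfilled D a m) <= prob E1 + prob E2.
  have dE i : i \in [:: true; false] -> determined_by
     (flatten [seq A1 j | j <- iota 0 l] ++ flatten [seq box_seq (D :\: [set t.1]%SET)
         t.2 l | t <- r2])
     (if i then E1 else E2).
    case: i => _.
      by apply: determined_sub dE1 => x; rewrite mem_cat => ->.
    by apply: determined_sub dE2 => x; rewrite mem_cat => ->; rewrite orbT.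
  have := pr_exists Q mX dE; rewrite !big_cons big_nil addr0 => h; apply: le_trans h.
  apply: (pr_le Q mX (A := box_seq D a m) (B := flatten [seq A1 j | j <- iota 0 l] ++
      flatten [seq box_seq (D :\: [set t.1]%SET) t.2 l | t <- r2])).
  - exact: unfilled_determined.
  - move=> s s' ss' [i ib Ei]; exists i => //; exact: (dE i ib s s' ss').
  move=> s nf; have [h1|h1] := pselect (E1 s); first by exists true.
  exists false => //; apply: contrapT => h2; apply: nf.
  have [j jl fj] : exists2 j, (j < l)%N & filled D (a + box_shift [set i0]%SET (j *
      l)%N) l s.
    apply: contrapT => nj; apply: h1 => j; rewrite mem_iota => jl fj.
    by apply: nj; exists j.
  apply: (filled_cover l0 _ l_le_m fj).
    move=> i; rewrite siteDE box_shiftE inE; case: (eqVneq i i0) => [->|ii].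
      by rewrite i0D; move: jl lm; clear; nia.
    by rewrite addr0; case: (i \in D) => //; move: l_le_m; clear; lia.
  move=> i c iD hc; apply: contrapT => nf; apply: h2; exists (i, c) => //.
  by apply/allpairsP; exists (i, c) => /=; split; [rewrite mem_enum|exact/box_seqP|].
have lr : 0 < (l%:R : R) by rewrite ltr0n.
have m4 : m%:R <= 4 * (l%:R ^+ 2) :> R by rewrite expr2 -!natrM ler_nat.
have mr : m%:R ^+ r <= 4 ^+ r * l%:R ^+ (2 * r) :> R.
  by rewrite exprM -exprMn lerXn2r// nnegrE ?mulr_ge0 ?exprn_ge0 ?ler0n.
have mdr : m%:R ^+ (d + r) <= 4 ^+ (d + r) * l%:R ^+ (2 * (d + r)) :> R.
  by rewrite exprM -exprMn lerXn2r// nnegrE ?mulr_ge0 ?exprn_ge0 ?ler0n.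
rewrite (le_trans (ler_wpM2r (exprn_ge0 _ (ler0n _ _)) sub))// mulrDl; apply: lerD.
  apply: (@le_trans _ _ ((1 - delta) ^+ l * (4 ^+ r * l%:R ^+ (2 * r)))).
    by apply: ler_pM; rewrite ?pr_ge0 ?exprn_ge0 ?ler0n.
  rewrite mulrCA ler_wpM2l ?exprn_ge0 ?ler0n// mulrC; exact: hK.
apply: (@le_trans _ _ ((d * m ^ d)%:R * (C / l%:R ^+ (2 * (d + r))) * m%:R ^+ r)).
  by rewrite ler_wpM2r ?exprn_ge0 ?ler0n.
have -> : (d * m ^ d)%:R * (C / l%:R ^+ (2 * (d + r))) * m%:R ^+ r =
   d%:R * (m%:R ^+ (d + r) * (C / l%:R ^+ (2 * (d + r)))) :> R.
  by rewrite natrM natrX exprD; ring.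
rewrite -!mulrA ler_wpM2l ?ler0n//.
apply: (@le_trans _ _ (4 ^+ (d + r) * l%:R ^+ (2 * (d + r)) * (C / l%:R ^+ (2 * (d +
    r))))).
  by rewrite ler_wpM2r// divr_ge0 ?exprn_ge0 ?ler0n.
rewrite -mulrA [_ * (C / _)]mulrC divfK// expf_neq0// gt_eqF//.
Qed.

Lemma superpolynomial_all D : superpolynomial D.
Proof.
have [n] := ubnP #|D|; elim: n D => // n ih D; rewrite ltnS => Dn.
apply: superpolynomial_step => S S0 SD; apply: ih.
by rewrite (leq_trans _ Dn)// cardsDS// ltn_subrL S0 (leq_trans S0 (subset_leq_card SD)).
Qed.

End Growth.

(** * Good cubes and the emptying of adjacent cubes *)

Section GoodBoxes.
Variable d : nat.
Implicit Types (omega : site d -> nat) (s : site d -> bool) (x y z : site d)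
  (A C : {fset site d}) (L c : nat).

Definition stuck omega A C : Prop := forall x, x \in C ->
  (omega x <= empty_neighbors x (fun y => y \notin A))%N -> x \in A.

(** Greedy emptying inside [C] can only stop at a stuck set. An order of legal moves is thus never
    exhibited: closure arguments about stuck sets replace it. *)
Lemma fill_criterion omega A C : (A `<=` C)%fset ->
  (forall A', (A `<=` A')%fset -> (A' `<=` C)%fset -> stuck omega A' C -> (C `<=`
      A')%fset) ->
  fill omega A C.
Proof.
have [n] := ubnP #|` C `\` A|%fset; elim: n A => // n ih A; rewrite ltnS => cn AC hA.
have [CA|nCA] := boolP (C `<=` A)%fset.
  exists [::] => //; apply/fsetP => x; rewrite !inE orbF.
  by apply/idP/idP => [/(fsubsetP CA)|/(fsubsetP AC)].
have [x [xC xA ox]] : exists x, [/\ x \in C, x \notin A &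
    (omega x <= empty_neighbors x (fun y => y \notin A))%N].
  apply: contrapT => nx; move/negP: nCA; apply; apply: hA => // x xC ox.
  by apply: contrapT => /negP xA; apply: nx; exists x.
have xAC : (x |` A `<=` C)%fset.
  by apply/fsubsetP => y; rewrite !inE => /predU1P[->//|]; exact: (fsubsetP AC).
have cn' : (#|` C `\` (x |` A)|%fset < n)%N.
  have -> : (C `\` (x |` A) = (C `\` A) `\ x)%fset.
    by apply/fsetP => y; rewrite !inE negb_or andbA.
  by have := cardfsD1 x (C `\` A)%fset; rewrite inE xA xC /= add1n => E; rewrite -E in
      cn *.
have [xs lxs ->] : fill omega (x |` A)%fset C.
  apply: ih => // A' A1; apply: hA; apply: fsubset_trans A1; exact: fsubsetU1.
exists (x :: xs) => //=.
by apply/fsetP => y; rewrite !inE; case: (y \in A); case: (y == x).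
Qed.

Lemma empty_neighbors_ge1 x A i :
  x + unit_vector i \in A \/ x - unit_vector i \in A ->
  (1 <= empty_neighbors x (fun y => y \notin A))%N.
Proof.
move=> h; rewrite /empty_neighbors (bigD1 i)//=.
by case: h => ->; rewrite ?addnS ?addn1 //= addSn.
Qed.

Lemma empty_neighbors_ged x A :
  (forall i, x + unit_vector i \in A \/ x - unit_vector i \in A) ->
  (d <= empty_neighbors x (fun y => y \notin A))%N.
Proof.
move=> h; rewrite -[X in (X <= _)%N]card_ord -sum1_card; apply: leq_sum => i _.
by case: (h i) => ->; rewrite ?addn1.
Qed.

Variables (omega : site d -> nat) (s : site d -> bool).
Hypotheses (seed1 : forall x, s x -> (omega x <= 1)%N)
  (omegad : forall x, (omega x <= d)%N).

(** The empty neighbour in direction [i] is enough for a site of threshold 1. Any other site of the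
    slice needs in addition one empty neighbour in each remaining direction, hence [d] in all, which
    is what filling the slice provides. *)
Lemma stuck_slice A C i b L : stuck omega A C ->
  (forall y, inbox [set~ i]%SET b L y -> y \in C) ->
  (forall y, inbox [set~ i]%SET b L y ->
     y + unit_vector i \in A \/ y - unit_vector i \in A) ->
  filled [set~ i]%SET b L s ->
  forall y, inbox [set~ i]%SET b L y -> y \in A.
Proof.
move=> sA hC hi fs y /fs sy; apply: (sy (fun y => y \in A)) => x hx hsx; apply: sA;
    first exact: hC.
case: hsx => [sx|hj].
  exact: leq_trans (seed1 sx) (empty_neighbors_ge1 (hi x hx)).
apply: (leq_trans (omegad x)); apply: empty_neighbors_ged => j.
have [->|ji] := eqVneq j i; first exact: hi.
by apply: hj; rewrite !inE ji.
Qed.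

Definition corner L z : site d := \row_i (L%:Z * z 0 i).

Definition cube L z : site d -> Prop := inbox [set: 'I_d]%SET (corner L z) L.

(** All slices in all directions are required, so that the cube can be swept from whichever face
    touches an empty cube. *)
Definition good L s z : Prop := forall i c, (c < L)%N ->
  filled [set~ i]%SET (corner L z + box_shift [set i]%SET c) L s.

Lemma cubeE L z x : cube L z x <-> forall i, L%:Z * z 0 i <= x 0 i < L%:Z * z 0 i + L%:Z.
Proof.
split=> h i; have := h i; rewrite inE mxE //.
Qed.

Lemma slice_cube L z i c x : (c < L)%N ->
  inbox [set~ i]%SET (corner L z + box_shift [set i]%SET c) L x <->
  cube L z x /\ x 0 i = L%:Z * z 0 i + c%:Z.
Proof.
move=> cL; split.
  move=> h; split.
    apply/cubeE => j; have := h j; rewrite !inE siteDE box_shiftE inE mxE.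
    by case: (eqVneq j i) => [->|ji] /=; move: cL; clear; lia.
  have := h i; rewrite !inE siteDE box_shiftE inE mxE eqxx /=; move: cL; clear; lia.
move=> [/cubeE h xi] j; have := h j; rewrite !inE siteDE box_shiftE inE mxE.
case: (eqVneq j i) => [->|ji] /=; first by rewrite xi eqxx.
by clear; lia.
Qed.

Lemma stuck_cube_up A C L z i : stuck omega A C ->
  (forall x, cube L z x -> x \in C) -> good L s z ->
  (forall x, cube L (z - unit_vector i) x -> x \in A) ->
  forall x, cube L z x -> x \in A.
Proof.
move=> sA hC gz hA.
suff H c : forall x, cube L z x -> x 0 i = L%:Z * z 0 i + c%:Z -> x \in A.
  move=> x hx; have := (cubeE L z x).1 hx i => hi.
  apply: (H (absz (x 0 i - L%:Z * z 0 i)%R) x hx).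
  by move: hi; clear; lia.
elim: c => [|c ih] x hx xi.
  have L0 : (0 < L)%N by have := (cubeE L z x).1 hx i; rewrite xi; clear; lia.
  apply: (stuck_slice sA _ _ (gz i 0%N L0)); last by apply/slice_cube.
    by move=> y /(slice_cube _ _ _ L0)[hy _]; exact: hC.
  move=> y /(slice_cube _ _ _ L0)[/cubeE hy yi]; right; apply: hA; apply/cubeE => j.
  have := hy j; rewrite !siteBE unit_vectorE; case: (eqVneq j i) => [->|ji] /=.
    by move: yi L0; clear; lia.
  by rewrite !subr0.
have L0 : (c.+1 < L)%N by have := (cubeE L z x).1 hx i; rewrite xi; clear; lia.
apply: (stuck_slice sA _ _ (gz i c.+1 L0)); last by apply/slice_cube.
  by move=> y /(slice_cube _ _ _ L0)[hy _]; exact: hC.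
move=> y /(slice_cube _ _ _ L0)[/cubeE hy yi]; right; apply: ih.
  apply/cubeE => j; have := hy j; rewrite !siteBE unit_vectorE; case: (eqVneq j i) =>
      [->|ji] /=.
    by move: yi L0; clear; lia.
  by rewrite !subr0.
by rewrite siteBE unit_vectorE eqxx yi; clear; lia.
Qed.

Lemma stuck_cube_down A C L z i : stuck omega A C ->
  (forall x, cube L z x -> x \in C) -> good L s z ->
  (forall x, cube L (z + unit_vector i) x -> x \in A) ->
  forall x, cube L z x -> x \in A.
Proof.
move=> sA hC gz hA.
(* [c] counts the slices from the upper face, the one that touches the empty cube. *)
suff H c : forall x, cube L z x -> x 0 i + c%:Z + 1 = L%:Z * z 0 i + L%:Z -> x \in A.
  move=> x hx; have := (cubeE L z x).1 hx i => hi.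
  apply: (H (absz (L%:Z * z 0 i + L%:Z - 1 - x 0 i)%R) x hx).
  by move: hi; clear; lia.
elim: c => [|c ih] x hx xi.
  have L0 : (L.-1 < L)%N by have := (cubeE L z x).1 hx i; clear; lia.
  have x1 : x 0 i = L%:Z * z 0 i + L.-1%:Z by move: xi L0; clear; lia.
  apply: (stuck_slice sA _ _ (gz i L.-1 L0)); last by apply/slice_cube.
    by move=> y /(slice_cube _ _ _ L0)[hy _]; exact: hC.
  move=> y /(slice_cube _ _ _ L0)[/cubeE hy yi]; left; apply: hA; apply/cubeE => j.
  have := hy j; rewrite !siteDE unit_vectorE; case: (eqVneq j i) => [->|ji] /=.
    by move: yi L0; clear; lia.
  by rewrite !addr0.
have L0 : (L - c.+2 < L)%N by have := (cubeE L z x).1 hx i; move: xi; clear; lia.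
have x1 : x 0 i = L%:Z * z 0 i + (L - c.+2)%:Z.
  by have := (cubeE L z x).1 hx i; move: xi L0; clear; lia.
have x0 := (cubeE L z x).1 hx i.
apply: (stuck_slice sA _ _ (gz i _ L0)); last by apply/slice_cube.
  by move=> y /(slice_cube _ _ _ L0)[hy _]; exact: hC.
move=> y /(slice_cube _ _ _ L0)[/cubeE hy yi]; left; apply: ih.
  apply/cubeE => j; have := hy j; rewrite !siteDE unit_vectorE; case: (eqVneq j i) =>
      [->|ji] /=.
    by move: yi L0 xi x0; clear; lia.
  by rewrite !addr0.
by rewrite siteDE unit_vectorE eqxx yi; move: xi x1 x0; clear; lia.
Qed.

End GoodBoxes.

(** * A staircase of good blocks *)

Section Staircase.
Variable closed_site : int * int -> Prop.
Implicit Types p : int * int.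

(* As in Lipschitz percolation: the boundary of the set of sites that can be reached
   from below by free downward steps and upward steps onto closed sites is an
   infinite open path. *)
Definition height p : int := p.1 + p.2.

Definition reachable p : Prop := forall Z : int * int -> Prop,
  (forall p, height p < 0 -> Z p) ->
  (forall p, Z p -> Z (p.1 - 1, p.2)) -> (forall p, Z p -> Z (p.1, p.2 - 1)) ->
  (forall p, Z p -> closed_site (p.1 + 1, p.2 + 1) -> Z (p.1 + 1, p.2 + 1)) ->
  Z p.

Lemma reachable_low p : height p < 0 -> reachable p.
Proof. by move=> hp Z h _ _ _; exact: h. Qed.

Lemma reachable_left p : reachable p -> reachable (p.1 - 1, p.2).
Proof. by move=> rp Z h1 h2 h3 h4; apply: (h2 p); exact: rp. Qed.

Lemma reachable_down p : reachable p -> reachable (p.1, p.2 - 1).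
Proof. by move=> rp Z h1 h2 h3 h4; apply: (h3 p); exact: rp. Qed.

Lemma reachable_up p : reachable p -> closed_site (p.1 + 1, p.2 + 1) ->
  reachable (p.1 + 1, p.2 + 1).
Proof. by move=> rp cp Z h1 h2 h3 h4; apply: (h4 p) => //; exact: rp. Qed.

(** Border sites are unreachable with a reachable diagonal predecessor, so an upward step shows that
    they are not closed. If the site below is unreachable it is again a border site; if it is
    reachable, it is the diagonal predecessor of the site to the right, which is then a border
    site. *)
Lemma staircase : ~ reachable (0, 0) -> exists p : nat -> int * int,
  p 0%N = (0, 0) /\ forall n, ~ closed_site (p n) /\
    (p n.+1 = ((p n).1 + 1, (p n).2) \/ p n.+1 = ((p n).1, (p n).2 - 1)).
Proof.
move=> r0; pose next p : int * int :=
  if `[< reachable (p.1, p.2 - 1) >] then (p.1 + 1, p.2) else (p.1, p.2 - 1).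
pose border p := ~ reachable p /\ reachable (p.1 - 1, p.2 - 1).
have bnext p : border p -> border (next p).
  move=> [np rp]; rewrite /next; case: asboolP => r; split=> //=.
  - by move: np; case: (p) => u v np /reachable_left; rewrite /= addrK; exact: np.
  - by rewrite addrK.
  - exact: (reachable_down rp).
have bn n : border (iter n next (0, 0)).
  by elim: n => [|n ih]; [split=> //; exact: reachable_low|exact: bnext].
exists (fun n => iter n next (0, 0)); split=> // n; split.
  have [np rp] := bn n; move=> cp; apply: np.
  by have := reachable_up rp; rewrite /= !subrK -surjective_pairing; exact.
by rewrite /=; move: (iter n next (0, 0)) => p; rewrite /next; case: asboolP => _;
    [left|right].
Qed.

End Staircase.

(** * Blocks of two cubes along the staircase *)

Section Blocks.
Variables (d : nat) (i0 i1 : 'I_d).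
Hypothesis i01 : i0 != i1.
Implicit Types (p : int * int) (omega : site d -> nat) (s : site d -> bool) (L : nat).

(* In these coordinates the two free steps of [reachable] move to the neighbouring
   columns, and the block at [p] has a face in common with those at
   [(p.1 + 1, p.2)] and [(p.1, p.2 - 1)]. *)
Definition lower_cube p : site d :=
  \row_i (if i == i0 then p.1 - p.2 else if i == i1 then p.1 + p.2 else 0).

(** The points [(p.1 - p.2, p.1 + p.2)] have coordinates of equal parity; the second cube covers the
    other parity class and supplies the missing common faces. *)
Definition upper_cube p : site d := lower_cube p + unit_vector i1.

Definition good_block L s p : Prop := good L s (lower_cube p) /\ good L s (upper_cube p).

Definition block_seq L p : seq (site d) :=
  box_seq [set: 'I_d]%SET (corner L (lower_cube p)) L ++
  box_seq [set: 'I_d]%SET (corner L (upper_cube p)) L.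

Definition block L p : {fset site d} := [fset x in block_seq L p]%fset.

Lemma in_block L p x : (0 < L)%N -> (x \in block L p) <->
  cube L (lower_cube p) x \/ cube L (upper_cube p) x.
Proof.
move=> L0; rewrite /block !inE /=. split.
  by move=> /orP[/(box_seqP _ _ _ L0)|/(box_seqP _ _ _ L0)]; [left|right].
by move=> [/(box_seqP _ _ _ L0) ->|/(box_seqP _ _ _ L0) ->]; rewrite ?orbT.
Qed.

Lemma block_card L p : (#|` block L p| <= 2 * L ^ d)%N.
Proof.
rewrite card_fseq (leq_trans (size_undup _))// size_cat !size_box_seq; lia.
Qed.

Lemma lower_cubeE0 p : lower_cube p 0 i0 = p.1 - p.2.
Proof. by rewrite mxE eqxx. Qed.

Lemma lower_cubeE1 p : lower_cube p 0 i1 = p.1 + p.2.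
Proof. by rewrite mxE eqxx eq_sym (negbTE i01). Qed.

Lemma upper_cubeE0 p : upper_cube p 0 i0 = p.1 - p.2.
Proof. by rewrite siteDE unit_vectorE lower_cubeE0 (negbTE i01) addr0. Qed.

Lemma upper_cubeE1 p : upper_cube p 0 i1 = p.1 + p.2 + 1.
Proof. by rewrite siteDE unit_vectorE lower_cubeE1 eqxx. Qed.

Lemma cube_coordinate L (z x : site d) i : cube L z x -> z 0 i = divz (x 0 i) L%:Z.
Proof.
move=> /cubeE /(_ i) h; have L0 : (0 : int) < L%:Z by move: h; clear; lia.
have -> : x 0 i = z 0 i * L%:Z + (x 0 i - z 0 i * L%:Z) by rewrite addrC subrK.
rewrite divzMDl ?gt_eqF// divz_small ?addr0//.
by move: h L0; rewrite [L%:Z * _]mulrC; clear; lia.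
Qed.

(** Integer division recovers from [x] the numbers [p.1 - p.2] and [p.1 + p.2 + b], where [b] tells
    the upper cube from the lower; parity then determines [b], hence [p]. *)
Lemma block_disjoint L p p' : (0 < L)%N -> p != p' ->
  forall x, x \in block_seq L p -> x \in block_seq L p' -> False.
Proof.
move=> L0 pp' x; rewrite /block_seq !mem_cat.
have co q : (x \in box_seq [set: 'I_d]%SET (corner L (lower_cube q)) L) ||
    (x \in box_seq [set: 'I_d]%SET (corner L (upper_cube q)) L) ->
    q.1 - q.2 = divz (x 0 i0) L%:Z /\ exists b : bool, q.1 + q.2 + b%:Z = divz (x 0 i1)
        L%:Z.
  move=> /orP[] /(box_seqP _ _ _ L0) hc; have h0 := cube_coordinate i0 hc;
    have h1 := cube_coordinate i1 hc; move: h0 h1.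
    rewrite lower_cubeE0 lower_cubeE1 => -> <-; split=> //; exists false; exact: addr0.
  by rewrite upper_cubeE0 upper_cubeE1 => -> <-; split=> //; exists true.
move=> /co[e1 [b e2]] /co[e3 [b' e4]]; move/negP: pp'; apply.
case: p p' e1 e2 e3 e4 => [u v] [u' v'] /= e1 e2 e3 e4.
have [-> ->] : u = u' /\ v = v' by move: e1 e2 e3 e4; clear; case: b; case: b'; lia.
by [].
Qed.

Section Fill.
Variables (omega : site d -> nat) (s : site d -> bool) (L : nat).
Hypotheses (seed1 : forall x, s x -> (omega x <= 1)%N)
  (omegad : forall x, (omega x <= d)%N) (L0 : (0 < L)%N).

(** The common face is orthogonal to [i0]. It separates the upper cube of [p] from the lower one of
    [p'] for the first kind of step, and the lower cube of [p] from the upper one of [p'] for the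
    second. The cube across the face is swept along [i0], and its companion then along [i1]. *)
Lemma fill_blocks p p' :
  p' = (p.1 + 1, p.2) \/ p' = (p.1, p.2 - 1) ->
  good_block L s p -> good_block L s p' ->
  fill omega (block L p) (block L p `|` block L p')%fset /\
  fill omega (block L p') (block L p `|` block L p')%fset.
Proof.
move=> hp [gl gu] [gl' gu'].
set C := (block L p `|` block L p')%fset.
have inC q x : q = p \/ q = p' ->
    cube L (lower_cube q) x \/ cube L (upper_cube q) x -> x \in C.
  by move=> hq h; rewrite inE; case: hq => <-; apply/orP; [left|right]; apply/in_block.
have up A z i := @stuck_cube_up _ omega s seed1 omegad A C L z i.
have down A z i := @stuck_cube_down _ omega s seed1 omegad A C L z i.
have Cl x : cube L (lower_cube p) x -> x \in C by move=> h; apply: (inC p); left.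
have Cu x : cube L (upper_cube p) x -> x \in C by move=> h; apply: (inC p); [left|right].
have Cl' x : cube L (lower_cube p') x -> x \in C by move=> h; apply: (inC p');
    [right|left].
have Cu' x : cube L (upper_cube p') x -> x \in C by move=> h; apply: (inC p'); right.
have upper q : upper_cube q = lower_cube q + unit_vector i1 by [].
have lower q : lower_cube q = upper_cube q - unit_vector i1 by rewrite addrK.
have all_in A : (forall x, cube L (lower_cube p) x -> x \in A) ->
    (forall x, cube L (upper_cube p) x -> x \in A) ->
    (forall x, cube L (lower_cube p') x -> x \in A) ->
    (forall x, cube L (upper_cube p') x -> x \in A) -> (C `<=` A)%fset.
  move=> h1 h2 h3 h4; apply/fsubsetP => x; rewrite inE => /orP[] /in_block; move=> /(_
      L0).
    by case=> [/h1|/h2].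
  by case=> [/h3|/h4].
have sub A q : (block L q `<=` A)%fset -> (forall x, cube L (lower_cube q) x -> x \in
    A) /\
    (forall x, cube L (upper_cube q) x -> x \in A).
  by move=> /fsubsetP h; split=> x hx; apply: h; apply/in_block => //; [left|right].
split.
  apply: fill_criterion; first exact: fsubsetUl.
  move=> A /sub[Al Au] _ sA.
  case: hp => pE.
    have E : lower_cube p' - unit_vector i0 = upper_cube p.
      apply/rowP => j; rewrite /upper_cube ?siteBE ?siteDE !unit_vectorE !mxE pE /=.
      by case: (eqVneq j i0) => [->|_]; rewrite ?(negbTE i01) /=; [|case: (eqVneq j i1)
          => _ /=]; clear; lia.
    have Al' x : cube L (lower_cube p') x -> x \in A.
      by apply: (up A _ i0) => //; rewrite E.
    apply: all_in => // x; apply: (up A _ i1) => //; by rewrite -lower.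
  have E : upper_cube p' - unit_vector i0 = lower_cube p.
    apply/rowP => j; rewrite /upper_cube ?siteBE ?siteDE !unit_vectorE !mxE pE /=.
    by case: (eqVneq j i0) => [->|_]; rewrite ?(negbTE i01) /=; [|case: (eqVneq j i1)
        => _ /=]; clear; lia.
  have Au' x : cube L (upper_cube p') x -> x \in A.
    by apply: (up A _ i0) => //; rewrite E.
  by apply: all_in => // x; apply: (down A _ i1).
apply: fill_criterion; first exact: fsubsetUr.
move=> A /sub[Al' Au'] _ sA.
case: hp => pE.
  have E : upper_cube p + unit_vector i0 = lower_cube p'.
    apply/rowP => j; rewrite /upper_cube ?siteBE ?siteDE !unit_vectorE !mxE pE /=.
    by case: (eqVneq j i0) => [->|_]; rewrite ?(negbTE i01) /=; [|case: (eqVneq j i1)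
        => _ /=]; clear; lia.
  have Au x : cube L (upper_cube p) x -> x \in A.
    by apply: (down A _ i0) => //; rewrite E.
  by apply: all_in => // x; apply: (down A _ i1).
have E : lower_cube p + unit_vector i0 = upper_cube p'.
  apply/rowP => j; rewrite /upper_cube ?siteBE ?siteDE !unit_vectorE !mxE pE /=.
  by case: (eqVneq j i0) => [->|_]; rewrite ?(negbTE i01) /=; [|case: (eqVneq j i1) =>
      _ /=]; clear; lia.
have Al x : cube L (lower_cube p) x -> x \in A.
  by apply: (down A _ i0) => //; rewrite E.
by apply: all_in => // x; apply: (up A _ i1) => //; rewrite -lower.
Qed.

End Fill.

End Blocks.

(** * Reversed walks and their closed sites *)

Section Walks.
Variable closed_site : int * int -> Prop.
Implicit Types (p : int * int) (w : seq (option bool)).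

(* Steps of the reversed walks witnessing [reachable]: [None] leaves a closed
   site, the two others are free.  A walk of length [n] from 0 to a negative height
   has more than [n / 3] steps [None]. *)
Definition step p (c : option bool) : int * int :=
  match c with
  | None => (p.1 - 1, p.2 - 1)
  | Some true => (p.1 + 1, p.2)
  | Some false => (p.1, p.2 + 1)
  end.

Fixpoint walk p w : seq (int * int) :=
  if w is c :: w' then step p c :: walk (step p c) w' else [::].

Fixpoint descents p w : seq (int * int) :=
  if w is c :: w' then nseq (c == None) p ++ descents (step p c) w' else [::].

Lemma subseq_descents p w : subseq (descents p w) (p :: walk p w).
Proof.
elim: w p => [|c w ih] p; first by rewrite sub0seq.
have -> : walk p (c :: w) = step p c :: walk (step p c) w by [].
have -> : descents p (c :: w) = nseq (c == None) p ++ descents (step p c) w by [].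
case: eqP => _; first by rewrite /= eqxx; exact: ih.
apply: (@subseq_trans _ (step p c :: walk (step p c) w)); first exact: ih.
exact: subseq_cons.
Qed.

(** A free step raises the height by 1, and a step [None] changes it by [-2 = 1 - 3]. *)
Lemma height_walk p w :
  height (last p (walk p w)) = height p + (size w)%:Z - 3 * (size (descents p w))%:Z.
Proof.
elim: w p => [|c w ih] p /=; first by rewrite mulr0 subr0 addr0.
by rewrite ih size_cat size_nseq /height; case: c => [[]|] /=; lia.
Qed.

(** The derivation of reachability, read backwards, is a path from [p] to a negative height.
    Shortening it to a simple path makes its closed sites distinct, so that independence can be
    used. *)
Lemma reachable_walk p : reachable closed_site p -> exists w,
  [/\ uniq (p :: walk p w), height (last p (walk p w)) < 0
    & forall x, x \in descents p w -> closed_site x].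
Proof.
pose e p p' := [exists c : option bool,
   (p' == step p c) && ((c == None) ==> `[< closed_site p >])].
have eS x c : (c = None -> closed_site x) -> e x (step x c).
  move=> h; apply/existsP; exists c; rewrite eqxx; apply/implyP => /eqP /h.
  by move=> ?; apply/asboolP.
have key q ps : path e q ps -> exists2 w, ps = walk q w &
    forall x, x \in descents q w -> closed_site x.
  elim: ps q => [|q' ps ih] q /=; first by exists [::].
  move=> /andP[/existsP[c /andP[/eqP -> /implyP h]] /ih[w -> hw]].
  exists (c :: w) => //= x; rewrite mem_cat mem_nseq => /orP[/andP[]|]; last exact: hw.
  by rewrite lt0b => /h /asboolP ? /eqP ->.
move=> /(_ (fun p => exists2 ps, path e p ps & height (last p ps) < 0)) [].
- by move=> q hq; exists [::].
- move=> q [ps pps hl]; exists (q :: ps) => //=; rewrite pps andbT.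
  by have := @eS (q.1 - 1, q.2) (Some true); rewrite /= subrK -surjective_pairing; apply.
- move=> q [ps pps hl]; exists (q :: ps) => //=; rewrite pps andbT.
  by have := @eS (q.1, q.2 - 1) (Some false); rewrite /= subrK -surjective_pairing; apply.
- move=> q [ps pps hl] cq; exists (q :: ps) => //=; rewrite pps andbT.
  have := @eS (q.1 + 1, q.2 + 1) None; rewrite /= !addrK -surjective_pairing; exact.
move=> ps pps; case/shortenP: pps => ps' pps' ups' _ hl.
by have [w psE hw] := key _ _ pps'; exists w; rewrite -psE.
Qed.

End Walks.

(** * Probabilities of bad blocks and of bad walks *)

Section GoodProbability.
Context {R : realType} {d : nat} {dO : measure_display} {O : measurableType dO}.
Variables (Q : probability O R) (X : site d -> O -> bool) (p : bool -> R).
Hypotheses (mX : forall i b, measurable [set o | X i o = b])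
  (cylX : forall (r : seq (site d)) (b : site d -> bool), uniq r ->
    fine (Q [set o | forall i, i \in r -> X i o = b i]) = \prod_(i <- r) p (b i)).
Hypotheses (p0 : 0 < p true) (p1 : p true <= 1).

Local Notation prob := (pr Q X).

Lemma good_determined L z : (0 < L)%N ->
  determined_by (box_seq [set: 'I_d]%SET (corner L z) L) (fun s => good L s z).
Proof.
move=> L0 s s' ss' gz i c cL; apply: (filled_determined L0 _ (gz i c cL)).
move=> x /(box_seqP _ _ _ L0) /(slice_cube _ _ _ cL)[hx _]; apply: ss'.
exact/box_seqP.
Qed.

(** A cube has [d * L] slices, each failing with probability of order [L ^ -2]. *)
Lemma bad_cube_small (e : R) : 0 < e -> exists2 L : nat, (0 < L)%N &
  forall z, prob (fun s => ~ good L s z) <= e.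
Proof.
move=> e0.
have ex (i : 'I_d) : exists C : R, 0 <= C /\ forall a m, (0 < m)%N ->
    prob (unfilled [set~ i]%SET a m) * m%:R ^+ 2 <= C.
  by have [C C0 hC] := superpolynomial_all mX cylX p0 p1 [set~ i]%SET 2; exists C.
have [C hC] := choice ex.
pose K := d%:R * \sum_i C i.
have C0 : 0 <= \sum_i C i by apply: sumr_ge0 => i _; have [] := hC i.
have K0 : 0 <= K by rewrite mulr_ge0 ?ler0n.
have [L L0 LK] : exists2 L : nat, (0 < L)%N & K / e < L%:R.
  by exists (Num.trunc (K / e)).+1 => //; exact: truncnS_gt.
have L0' : 0 < (L%:R : R) by rewrite ltr0n.
exists L => // z.
pose r : seq ('I_d * nat) := [seq (i, c) | i <- enum 'I_d, c <- iota 0 L].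
pose a (t : 'I_d * nat) := corner L z + box_shift [set t.1]%SET t.2.
pose F (t : 'I_d * nat) (s : site d -> bool) := unfilled [set~ t.1]%SET (a t) L s.
have dF t : t \in r -> determined_by (box_seq [set~ t.1]%SET (a t) L) (F t).
  by move=> _; exact: unfilled_determined.
apply: (@le_trans _ _ (prob (fun s => exists2 t, t \in r & F t s))).
  apply: (pr_le Q mX (A := box_seq [set: 'I_d]%SET (corner L z) L)
     (B := flatten [seq box_seq [set~ t.1]%SET (a t) L | t <- r])).
  - exact: (determined_not (@good_determined L z L0)).
  - move=> s s' ss' [t tr Ft]; exists t => //; apply: (dF t tr s) Ft => i iA.
    by apply: ss'; apply/flattenP; eexists; [apply: map_f tr|].
  move=> s ng; apply: contrapT => nF; apply: ng => i c cL; apply: contrapT => nf.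
  apply: nF; exists (i, c) => //; apply/allpairsP; exists (i, c).
  by split=> //=; [rewrite mem_enum|rewrite mem_iota].
rewrite (le_trans (pr_exists Q mX dF))//.
apply: (@le_trans _ _ (\sum_(t <- r) ((\sum_i C i) / L%:R ^+ 2))).
  apply: ler_sum => -[i c] _; rewrite ler_pdivlMr ?exprn_gt0//.
  have [_ h] := hC i; rewrite (le_trans (h _ _ L0))// (bigD1 i)//= lerDl.
  by apply: sumr_ge0 => j _; have [] := hC j.
rewrite big_const_seq count_predT iter_addr_0 -[leLHS]mulr_natl.
rewrite size_allpairs size_enum_ord size_iota natrM.
have -> : d%:R * L%:R * ((\sum_i C i) / L%:R ^+ 2) = K / L%:R.
  by rewrite /K; field; rewrite gt_eqF.
by rewrite ler_pdivrMr// mulrC -ler_pdivrMr// ltW.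
Qed.

Variables (i0 i1 : 'I_d).
Hypothesis i01 : i0 != i1.

Lemma good_block_determined L q : (0 < L)%N ->
  determined_by (block_seq i0 i1 L q) (fun s => ~ good_block i0 i1 L s q).
Proof.
move=> L0; apply: determined_not => s s' ss' [g1 g2]; split.
  by apply: (good_determined L0 _ g1) => x xA; apply: ss'; rewrite /block_seq mem_cat xA.
by apply: (good_determined L0 _ g2) => x xA; apply: ss'; rewrite /block_seq mem_cat xA
    orbT.
Qed.

Lemma bad_block_small (e : R) : 0 < e -> exists2 L : nat, (0 < L)%N &
  forall q, prob (fun s => ~ good_block i0 i1 L s q) <= e.
Proof.
move=> e0; have [|L L0 hL] := @bad_cube_small (e / 2); first by rewrite divr_gt0.
exists L => // q.
pose E (b : bool) s := ~ good L s (if b then lower_cube i0 i1 q else upper_cube i0 i1 q).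
pose A (b : bool) := box_seq [set: 'I_d]%SET (corner L (if b then lower_cube i0 i1 q
    else upper_cube i0 i1 q)) L.
have dE b : b \in [:: true; false] -> determined_by (A b) (E b).
  by move=> _; apply: determined_not; exact: good_determined.
have := pr_exists Q mX dE; rewrite !big_cons big_nil addr0.
have := hL (lower_cube i0 i1 q); have := hL (upper_cube i0 i1 q) => h1 h2 h3.
have h4 : prob (fun s => exists2 b, b \in [:: true; false] & E b s) <= e by
  move: h1 h2 h3; rewrite /E; lra.
apply: le_trans h4; apply: (pr_le Q mX (A := block_seq i0 i1 L q) (B := block_seq i0 i1
    L q)).
- exact: good_block_determined.
- move=> s s' ss' [b bb Eb]; exists b => //; apply: (dE b bb s s') Eb => x xA.
  by apply: ss'; rewrite /block_seq mem_cat; move: xA; rewrite /A; case: (b) => ->;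
      rewrite ?orbT.
move=> s ng; apply: contrapT => nE; apply: ng; split; apply: contrapT => g.
  by apply: nE; exists true.
by apply: nE; exists false.
Qed.

(** Fixing the length gives an event that depends on finitely many sites, ready for a union bound
    over tuples. *)
Definition bad_walk L n (s : site d -> bool) : Prop :=
  exists2 w : n.-tuple (option bool), w \in enum {: n.-tuple (option bool)} &
   [/\ uniq (descents (0, 0) w), (n < 3 * size (descents (0%R, 0%R) w))%N
     & forall x, x \in descents (0, 0) w -> ~ good_block i0 i1 L s x].

Lemma reachable_bad_walk L s :
  reachable (fun q => ~ good_block i0 i1 L s q) (0, 0) -> exists n, bad_walk L n s.
Proof.
move=> /reachable_walk[w [uw hw cw]]; exists (size w); exists (in_tuple w).
  by rewrite mem_enum.
split=> //=; first exact: subseq_uniq (subseq_descents _ _) uw.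
by move: hw; rewrite height_walk /height /=; clear; lia.
Qed.

(** Each of the [3 ^ n] walks has at least [(n + 1) / 3] distinct closed sites, whose blocks are
    disjoint and hence independent. The cube in the hypothesis compensates the division by 3. *)
Lemma pr_bad_walk L n (e : R) : (0 < L)%N -> 0 < e -> e <= 1 ->
  (forall q, prob (fun s => ~ good_block i0 i1 L s q) <= e ^+ 3) ->
  exists2 A, determined_by A (bad_walk L n) & prob (bad_walk L n) <= 3 ^+ n * e ^+ n.+1.
Proof.
move=> L0 e0 e1 hq.
pose F (w : n.-tuple (option bool)) (s : site d -> bool) :=
 [/\ uniq (descents (0, 0) w), (n < 3 * size (descents (0%R, 0%R) w))%N
     & forall x, x \in descents (0, 0) w -> ~ good_block i0 i1 L s x].
pose A (w : n.-tuple (option bool)) := flatten [seq block_seq i0 i1 L x | x <- descents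
    (0, 0) w].
have dw (w : n.-tuple (option bool)) : forall x, x \in descents (0, 0) w ->
    determined_by (block_seq i0 i1 L x) (fun s => ~ good_block i0 i1 L s x).
  by move=> x _; exact: good_block_determined.
have dF w : w \in enum {: n.-tuple (option bool)} -> determined_by (A w) (F w).
  move=> _ s s' ss' [h1 h2 h3]; split=> //.
  exact: (determined_all (dw w) ss' h3).
exists (flatten [seq A w | w <- enum {: n.-tuple (option bool)}]).
  move=> s s' ss' [w ww Fw]; exists w => //; apply: (dF w ww s s') Fw => i iA.
  by apply: ss'; apply/flattenP; exists (A w) => //; apply: map_f.
rewrite (le_trans (pr_exists Q mX dF))//.
apply: (@le_trans _ _ (\sum_(w <- enum {: n.-tuple (option bool)}) e ^+ n.+1)).
  apply: ler_sum => w _.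
  have [ud|nu] := boolP (uniq (descents (0, 0) w)); last first.
    rewrite /pr (_ : event _ _ = set0) ?measure0 ?exprn_ge0 ?ltW//.
    by apply/seteqP; split=> // o [] h; rewrite h in nu.
  have [nd|nn] := boolP (n < 3 * size (descents (0%R, 0%R) w))%N; last first.
    rewrite /pr (_ : event _ _ = set0) ?measure0 ?exprn_ge0 ?ltW//.
    by apply/seteqP; split=> // o [] _ h; rewrite h in nn.
  apply: (@le_trans _ _ (prob (fun s => forall x, x \in descents (0, 0) w -> ~
      good_block i0 i1 L s x))).
    apply: (pr_le Q mX (A := A w) (B := A w)).
    - by apply: dF; rewrite mem_enum.
    - exact: (determined_all (dw w)).
    - by move=> s [].
  rewrite (pr_all mX cylX ud (dw w)); last first.
    by move=> x y _ _ xy z; exact: block_disjoint.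
  apply: (@le_trans _ _ (\prod_(x <- descents (0, 0) w) e ^+ 3)).
    by apply: ler_prod => x _; rewrite pr_ge0 hq.
  rewrite big_const_seq count_predT iter_mulr_1 -exprM.
  by apply: ler_wiXn2l => //; exact: ltW.
rewrite big_const_seq count_predT iter_addr_0 -[leLHS]mulr_natl.
by rewrite -cardE card_tuple card_option card_bool natrX.
Qed.

End GoodProbability.

(** * Chains of droplets in almost every environment *)

Section Environment.
Context {R : realType} {d : nat} {dO : measure_display} {O : measurableType dO}.
Variables (Q : probability O R) (nu : probability nat R) (omega : site d -> O -> nat).
Hypothesis homega : iid_family Q nu omega.

(** Filling of boxes sees the environment only through these indicators: sites that are not seeds
    are treated as if their threshold were [d]. *)
Definition seed (x : site d) (o : O) : bool := omega x o == 1%N.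

Definition seed_law (b : bool) : R := fine (nu (if b then [set 1%N] else ~` [set 1%N])).

Lemma measurable_seed x b : measurable [set o | seed x o = b].
Proof.
have [mo _] := homega; have := mo x measurableT (if b then [set 1%N] else ~` [set 1%N]) _.
rewrite setTI => h; rewrite (_ : [set _ | _] = omega x @^-1` (if b then [set 1%N] else
    ~` [set 1%N])).
  exact: h.
apply/seteqP; split=> o /=; rewrite /seed; case: b {h} => /=.
- by move=> /eqP.
- by move=> /eqP.
- by move=> ->.
- by move=> /eqP/negbTE.
Qed.

Lemma seed_cylinder (r : seq (site d)) (b : site d -> bool) : uniq r ->
  fine (Q [set o | forall i, i \in r -> seed i o = b i]) = \prod_(i <- r) seed_law (b i).
Proof.
move=> ur; have [_ hA] := homega.
pose Bs i := if b i then [set 1%N] else ~` [set 1%N].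
have := hA [fset i in r]%fset Bs (fun=> I).
rewrite (_ : \bigcap_(i in _) _ = [set o | forall i, i \in r -> seed i o = b i]); last
    first.
  apply/seteqP; split=> o /= h i.
    move=> ir; have := h i; rewrite /= !inE => /(_ ir); rewrite /Bs /seed.
    by case: (b i) => [->//|/eqP/negbTE].
  rewrite /= !inE => ir; have := h i ir; rewrite /Bs /seed.
  by case: (b i) => [/eqP|/eqP].
move=> ->; rewrite (perm_big r); last first.
  by apply: uniq_perm => // [|x]; rewrite ?fset_uniq// !inE.
elim: r {ur} => [|i r ih]; first by rewrite !big_nil.
rewrite !big_cons fineM ?ih//; first exact: fin_num_measure.
apply: prode_fin_num => j _; exact: fin_num_measure.
Qed.

Lemma ae_le_dimension : nu [set k : nat | (d < k)%N] = 0%E ->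
  {ae Q, forall o, forall x, (omega x o <= d)%N}.
Proof.
move=> hnud; have [mo hA] := homega.
have ax x : {ae Q, forall o, (omega x o <= d)%N}.
  exists (omega x @^-1` [set k | (d < k)%N]); split.
  - by have := mo x measurableT [set k | (d < k)%N] I; rewrite setTI.
  - have := hA [fset x]%fset (fun=> [set k | (d < k)%N]) (fun=> I).
    rewrite big_seq_fset1 hnud => <-; congr (Q _); apply/seteqP; split=> o /=.
      by move=> h i /=; rewrite inE => /eqP ->.
    by apply; rewrite /= inE.
  by move=> o /= /negP; rewrite -ltnNge.
have : {ae Q, forall o, forall n : nat, forall x : site d,
    @choice.unpickle 'rV[int]_d n = Some x -> (omega x o <= d)%N}.
  apply: ae_foralln => n; case E : (choice.unpickle n) => [x|]; last first.
    by apply: filterE => o x.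
  by apply: filterS (ax x) => o ho y [<-].
apply: filterS => o ho x.
by apply: (ho (@choice.pickle 'rV[int]_d x)); exact: choice.pickleK.
Qed.

Lemma staircase_chain (i0 i1 : 'I_d) (o : O) (L : nat) : i0 != i1 ->
  (0 < L)%N -> (forall x, (omega x o <= d)%N) ->
  (forall n, ~ bad_walk i0 i1 L n (fun x => seed x o)) ->
  exists M B, droplet_chain (fun x => omega x o) M B.
Proof.
move=> i01 L0 od nobad; set s := fun x => seed x o in nobad.
have [] := @staircase (fun q => ~ good_block i0 i1 L s q).
  by move=> /reachable_bad_walk[n]; exact: nobad.
move=> p [p00 hp].
have gp n : good_block i0 i1 L s (p n) by have [h _] := hp n; exact: contrapT.
(* Both kinds of step increase this difference by 1, so the staircase never revisits a block. *)
have pn n : (p n).1 - (p n).2 = n%:Z.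
  elim: n => [|n ih]; first by rewrite p00 subrr.
  by have [_ [->|->]] := hp n; move: ih => /=; clear; lia.
exists (2 * L ^ d)%N, (fun n => block i0 i1 L (p n)).
have seed1 x : s x -> (omega x o <= 1)%N by rewrite /s /seed => /eqP ->.
have fb n := fill_blocks i01 seed1 od L0 (proj2 (hp n)) (gp n) (gp n.+1).
split.
- apply/in_block => //; left; apply/cubeE => i.
  have -> : lower_cube i0 i1 (p 0%N) 0 i = 0.
    by rewrite mxE p00 /=; case: ifP => // _; case: ifP.
  by rewrite mulr0 add0r mxE lexx ltz_nat.
- by move=> n; exact: block_card.
- move=> i j ij; apply/fdisjointP => x; rewrite !inE => xi; apply/negP => xj.
  have pij : p i != p j.
    by apply: contraNneq ij => pij; have := pn i; rewrite pij pn => -[->].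
  by apply: (block_disjoint i01 L0 pij (x := x)); rewrite /block_seq mem_cat.
- by move=> n; have [] := fb n.
- by move=> n; have [] := fb n.
Qed.

(** For the side [L k] some bad walk exists with probability at most [2 * e k]. As [e k] tends to 0,
    the event that every [L k] has a bad walk is null. *)
Lemma ae_no_bad_walk (i0 i1 : 'I_d) : i0 != i1 -> nu [set 1%N] <> 0%E ->
  {ae Q, forall o, exists2 L : nat, (0 < L)%N &
    forall n, ~ bad_walk i0 i1 L n (fun x => seed x o)}.
Proof.
move=> i01 hnu1.
have p0 : 0 < seed_law true.
  rewrite /seed_law lt0r fine_ge0// andbT fine_eq0 ?fin_num_measure//.
  exact/eqP.
have p1 : seed_law true <= 1.
  by rewrite /seed_law -lee_fin fineK ?fin_num_measure//; exact: probability_le1.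
(* The 6 gives [3 * e k <= 1 / 2], so that [3 ^+ n * e k ^+ n.+1 <= e k * 2^-1 ^+ n] is summable in
   [n], with sum at most [2 * e k]. *)
pose e (k : nat) : R := (k + 6)%:R^-1.
have e0 k : 0 < e k by rewrite invr_gt0 ltr0n addn_gt0 orbT.
have e6 k : e k <= 6^-1.
  by rewrite lef_pV2 ?posrE ?ltr0n ?addn_gt0 ?orbT// ler_nat leq_addl.
have ex k : exists L : nat, (0 < L)%N /\ forall q,
    pr Q seed (fun s => ~ good_block i0 i1 L s q) <= e k ^+ 3.
  have [|L L0 hL] := @bad_block_small _ _ _ _ Q seed seed_law measurable_seed
    seed_cylinder p0 p1 i0 i1 (e k ^+ 3); first exact: exprn_gt0.
  by exists L.
have [L hL] := choice ex.
have e1 k : e k <= 1 by rewrite (le_trans (e6 k))// invf_le1// ler1n.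
pose F k n := event seed (bad_walk i0 i1 (L k) n).
have hF k n : measurable (F k n) /\ (Q (F k n) <= (2 * e k / (2 ^ n.+1)%:R)%:E)%E.
  have [L0 hq] := hL k.
  have [A dA pA] := pr_bad_walk measurable_seed seed_cylinder i01 n L0 (e0 k) (e1 k) hq.
  have mF : measurable (F k n) by exact: measurable_event measurable_seed _ _ dA.
  split=> //; rewrite -[Q _]fineK ?fin_num_measure// lee_fin (le_trans pA)//.
  have -> : 2 * e k / (2 ^ n.+1)%:R = e k * 2^-1 ^+ n.
    by rewrite natrX exprS exprVn; field; rewrite expf_neq0.
  have -> : 3 ^+ n * e k ^+ n.+1 = e k * (3 * e k) ^+ n by rewrite exprS exprMn; ring.
  rewrite ler_pM2l// lerXn2r ?nnegrE//; first by rewrite mulr_ge0// ltW.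
  by have := e6 k; lra.
pose N k := \bigcup_n F k n.
have mN k : measurable (N k) by apply: bigcupT_measurable => n; have [] := hF k n.
have QN k : (Q (N k) <= (2 * e k)%:E)%E.
  apply: (@le_trans _ _ (\sum_(n <oo) Q (F k n))%E).
    apply: measure_sigma_subadditive => //; first by move=> n; have [] := hF k n.
  apply: (@le_trans _ _ (\sum_(n <oo) (2 * e k / (2 ^ n.+1)%:R)%:E)%E).
    by apply: lee_nneseries => // n _; have [] := hF k n.
  by apply: (epsilon_trick0 xpredT); rewrite mulr_ge0// ltW.
exists (\bigcap_k N k); split.
- exact: bigcapT_measurable.
- apply/eqP; rewrite eq_le measure_ge0 andbT; apply/lee_addgt0Pr => eps eps0.
  rewrite add0e; pose k := Num.trunc (2 / eps).
  have mcap : measurable (\bigcap_k N k) by exact: bigcapT_measurable.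
  apply: (@le_trans _ _ (Q (N k))).
    by apply: le_measure; rewrite ?inE// => o; apply.
  rewrite (le_trans (QN k))// lee_fin /e ler_pdivrMr ?ltr0n ?addn_gt0 ?orbT//.
  have := truncnS_gt (2 / eps); rewrite ltr_pdivrMr// -/k => h.
  by rewrite (le_trans (ltW h))// mulrC ler_pM2l// ler_nat -addn1 leq_add2l.
move=> o /= no k _; apply: contrapT => nF; apply: no.
exists (L k); first by have [] := hL k.
by move=> n bw; apply: nF; exists n.
Qed.

(** The staircase needs two distinct directions. In dimension one all thresholds are at most 1, and
    single sites along the line are droplets. *)
Lemma line_chain (i : 'I_d) (o : O) : (forall x, (omega x o <= 1)%N) ->
  exists M B, droplet_chain (fun x => omega x o) M B.
Proof.
move=> o1; pose z (n : nat) : site d := \row_j (if j == i then n%:Z else 0).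
have zS n : z n.+1 = z n + unit_vector i.
  apply/rowP => j; rewrite siteDE unit_vectorE !mxE; case: eqP => _ /=; clear; lia.
have zi n : z n 0 i = n%:Z by rewrite mxE eqxx.
have fill1 x y : x != y -> (y + unit_vector i = x \/ y - unit_vector i = x) ->
    fill (fun x => omega x o) [fset x]%fset ([fset x] `|` [fset y])%fset.
  move=> xy h; exists [:: y]; last first.
    by apply/fsetP => t; rewrite !inE orbF.
  split=> //; first by rewrite inE eq_sym.
  apply: leq_trans (o1 y) _; apply: (@empty_neighbors_ge1 _ y _ i).
  by case: h => h; [left|right]; rewrite h; exact: fset11.
have zne m n : m != n -> z m != z n.
  by apply: contraNneq => mn; have := zi m; rewrite mn zi => -[->].
exists 1%N, (fun n => [fset z n]%fset); split.
- rewrite inE; apply/eqP/rowP => j; rewrite !mxE; by case: ifP.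
- by move=> n; rewrite cardfs1.
- by move=> m n mn; rewrite fdisjoint1X inE zne.
- move=> n; apply: fill1; first by rewrite zne// neq_ltn ltnSn.
  by right; rewrite zS addrK.
- move=> n; rewrite fsetUC; apply: fill1; first by rewrite zne// neq_ltn ltnSn orbT.
  by left; rewrite zS.
Qed.

Lemma ae_droplet_chain : nu [set 0%N] = 0%E -> nu [set 1%N] <> 0%E ->
  nu [set k : nat | (d < k)%N] = 0%E ->
  {ae Q, forall o, exists M B, droplet_chain (fun x => omega x o) M B}.
Proof.
move=> hnu0 hnu1 hnud; have od := ae_le_dimension hnud.
have [d0|d0] := posnP d.
  (* In dimension zero every threshold is either 0 or larger than [d], so the hypotheses would make
     [nu] vanish. *)
  exfalso; have : (nu [set: nat] <= nu [set 0%N] + nu [set k | (d < k)%N])%E.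
    rewrite (_ : [set: nat] = [set 0%N] `|` [set k | (d < k)%N]); first exact: measureU2.
    by apply/seteqP; split=> // -[|k] _; [left|right; rewrite /= d0].
  by rewrite hnu0 hnud probability_setT adde0 lee_fin ler10.
have [d1|d2] := leqP d 1.
  apply: filterS od => o od; apply: (line_chain (Ordinal d0)) => x.
  exact: leq_trans (od x) d1.
have i01 : Ordinal d0 != Ordinal d2 by [].
apply: filterS2 od (ae_no_bad_walk i01 hnu1) => o od [L L0 nb].
exact: staircase_chain i01 L0 od nb.
Qed.

End Environment.

Theorem theorem2p6 (R : realType) (d : nat)
    (dO : measure_display) (O : measurableType dO) (Q : probability O R)
    (nu : probability nat R) (omega : site d -> O -> nat)
    (homega : iid_family Q nu omega)
    (hnu0 : nu [set 0%N] = 0%E)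
    (hnu1 : nu [set 1%N] <> 0%E)
    (hnud : nu [set k : nat | (d < k)%N] = 0%E) :
  {ae Q, forall o : O, exists alpha_low alpha_up : R,
    forall (dT : measure_display) (T : R -> measurableType dT)
      (P : forall q : R, probability (T q) R)
      (eta : forall q : R, R -> T q -> config d),
      (forall q : R, 0 < q < 1 ->
         stationary_kcm (P q) (fun x => omega x o) q (eta q)) ->
      (P q [set w | ((q `^ (- alpha_up))%:E <= emptying_time (eta q) w)%E]
         @[q --> 0^'+] --> 0%E) /\
      (P q [set w | (emptying_time (eta q) w <= (q `^ (- alpha_low))%:E)%E]
         @[q --> 0^'+] --> 0%E)}.
Proof.
apply: filterS (ae_droplet_chain homega hnu0 hnu1 hnud) => o [M [B chain]].
exact: chain_emptying_time chain.
Qed.
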